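(* Let $\mathbb{K}=\mathbb{R}$ or $\mathbb{C}$, $\alpha_0,\alpha_1>0$, and equip $\mathrm{St}_{\mathbb{K},p,n}$ with the metric induced by $\mathsf{g}_Y\omega=\alpha_0\omega+(\alpha_1-\alpha_0)YY^{\mathfrak t}\omega$ and the Grassmann manifold $\mathrm{Gr}_{\mathbb{K},p,n}$ with the quotient metric. Let $\mathrm{csr}$ and $\mathrm{ssr}$ be the entire functions that are the analytic continuations of $\cos z^{1/2}$ and $z^{-1/2}\sin z^{1/2}$. (1) Let $\tilde Y\in\mathrm{St}_{\mathbb{K},p,n}$ and let $\eta$ be a tangent vector at $\tilde Y$ with $\tilde Y^{\mathfrak t}\eta=0$. Then the Stiefel exponential map is given by $$\mathrm{Exp}^{\mathrm{St}}_{\tilde Y}\eta=\tilde Y\,\mathrm{csr}(\eta^{\mathfrak t}\eta)+\eta\,\mathrm{ssr}(\eta^{\mathfrak t}\eta)=\tilde Y\cos(\eta^{\mathfrak t}\eta)^{1/2}+\eta\{(\eta^{\mathfrak t}\eta)^{-1/2}\sin(\eta^{\mathfrak t}\eta)^{1/2}\},$$ and the class $\llbracket\mathrm{Exp}^{\mathrm{St}}_{\tilde Y}\eta\rrbracket$ represents the Grassmann exponential $\mathrm{Exp}^{\mathrm{Gr}}_{\llbracket\tilde Y\rrbracket}\llbracket\eta\rrbracket$. (2) Conversely, let $\tilde Y,Z\in\mathrm{St}_{\mathbb{K},p,n}$ and let $\tilde Y^{\mathfrak t}Z=U\Sigma V$ be an SVD of $\tilde Y^{\mathfrak t}Z\in\mathbb{K}^{p\times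 p}$. Set $$\eta=(Z-\tilde Y\tilde Y^{\mathfrak t}Z)V^{\mathfrak t}\,(I_p-\Sigma^2)^{-1/2}\arccos\Sigma\;U^{\mathfrak t}.$$ Then $\eta$ is a horizontal vector at $\tilde Y$ on the Stiefel manifold and $\mathrm{Exp}^{\mathrm{St}}_{\tilde Y}\eta=ZV^{\mathfrak t}U^{\mathfrak t}$. Thus $\mathrm{Exp}^{\mathrm{St}}_{\tilde Y}\eta$ and $Z$ represent the same element of $\mathrm{Gr}_{\mathbb{K},p,n}$. The length of $\eta$ is $(\alpha_0\mathrm{Tr}_{\mathbb{R}}\arccos^2\Sigma)^{1/2}$, which is the geodesic distance in $\mathrm{Gr}_{\mathbb{K},p,n}$ between $\llbracket\tilde Y\rrbracket$ and $\llbracket Z\rrbracket$; hence $\eta$ is the lift to $\tilde Y$ of a geodesic logarithm $\mathrm{Log}^{\mathrm{Gr}}_{\llbracket\tilde Y\rrbracket}\llbracket Z\rrbracket$.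
   Context: $\mathfrak t$ denotes the transpose if $\mathbb{K}=\mathbb{R}$ and the Hermitian transpose if $\mathbb{K}=\mathbb{C}$; $\mathrm{Tr}_{\mathbb{R}}$ is the (real part of the) trace. $\mathrm{St}_{\mathbb{K},p,n}=\{Y\in\mathbb{K}^{n\times p}:Y^{\mathfrak t}Y=I_p\}$, with tangent vectors at $Y$ the matrices $\eta\in\mathbb{K}^{n\times p}$ such that $Y^{\mathfrak t}\eta$ is $\mathfrak t$-antisymmetric, and metric $\langle\omega_1,\omega_2\rangle_Y=\mathrm{Tr}_{\mathbb{R}}\,\omega_1^{\mathfrak t}(\alpha_0\omega_2+(\alpha_1-\alpha_0)YY^{\mathfrak t}\omega_2)$. The Grassmann manifold $\mathrm{Gr}_{\mathbb{K},p,n}$ is the quotient of $\mathrm{St}_{\mathbb{K},p,n}$ by the right multiplication action $(Y,U)\mapsto YU$ of the group $\{U\in\mathbb{K}^{p\times p}:U^{\mathfrak t}U=I_p\}$, with the quotient (Riemannian submersion) metric; $\llbracket Y\rrbracket$ and $\llbracket\eta\rrbracket$ denote the images of a point $Y$ and a tangent vector $\eta$ in the quotient. A tangent vector $\eta$ at $Y$ is horizontal if $Y^{\mathfrak t}\eta=0$. $\mathrm{Exp}_{x}\eta$ is the point at time $1$ of the geodesic with initial point $x$ and initial velocity $\eta$; $\mathrm{Log}_{x}z$ denotes a tangent vector $\eta$ at $x$ of minimal length with $\mathrm{Exp}_x\eta=z$ (it need not be unique). Superscripts $\mathrm{St}$, $\mathrm{Gr}$ indicate the manifold. Entire functions are applied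 to square matrices through their power series; $(\eta^{\mathfrak t}\eta)^{-1/2}\sin(\eta^{\mathfrak t}\eta)^{1/2}$ means $\mathrm{ssr}(\eta^{\mathfrak t}\eta)$. In the SVD, $U,V$ satisfy $U^{\mathfrak t}U=V^{\mathfrak t}V=I_p$ and $\Sigma$ is diagonal with entries in $[0,1]$; $(I_p-\Sigma^2)^{-1/2}\arccos\Sigma$ is obtained by applying $x\mapsto(1-x^2)^{-1/2}\arccos x$ to the diagonal entries, with the convention that this function equals $1$ at $x=1$. *)

(* Defs.v *)
(* MathComp-Analysis development, over an arbitrary [R : realType]. *)
From HB Require Import structures.
From mathcomp Require Import all_boot all_order all_algebra.
From mathcomp Require Import all_classical all_reals all_analysis.
From mathcomp Require Import complex.

Set Implicit Arguments.
Unset Strict Implicit.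
Unset Printing Implicit Defensive.

Import Order.TTheory GRing.Theory Num.Theory.
Import numFieldNormedType.Exports.

Local Open Scope classical_set_scope.
Local Open Scope ring_scope.

Variant scalar_kind := RealScalars | ComplexScalars.

Definition scalars (R : realType) (k : scalar_kind) : numFieldType :=
  match k with
  | RealScalars => R : numFieldType
  | ComplexScalars => (R[i])%C : numFieldType
  end.

(* The scalar a + i b; over the reals there is no imaginary part, so that
   b is dropped. *)
Definition scal_of (R : realType) (k : scalar_kind) : R -> R -> scalars R k :=
  match k with
  | RealScalars => fun a _ => a
  | ComplexScalars => fun a b => Complex a b
  end.

Definition scal_re (R : realType) (k : scalar_kind) : scalars R k -> R :=
  match k with
  | RealScalars => fun z => z
  | ComplexScalars => fun z => complex.Re z
  end.

Definition scal_im (R : realType) (k : scalar_kind) : scalars R k -> R :=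
  match k with
  | RealScalars => fun _ => 0
  | ComplexScalars => fun z => complex.Im z
  end.

Definition scal_conj (R : realType) (k : scalar_kind) :
    scalars R k -> scalars R k :=
  match k with
  | RealScalars => fun z => z
  | ComplexScalars => fun z => conjc z
  end.

Definition scal_real (R : realType) (k : scalar_kind) (a : R) : scalars R k :=
  scal_of k a 0.

Definition ctr (R : realType) (k : scalar_kind) (m n : nat)
    (A : 'M[scalars R k]_(m, n)) : 'M[scalars R k]_(n, m) :=
  map_mx (@scal_conj R k) A^T.

Notation "A ^H" := (ctr A) (at level 1, left associativity, format "A ^H") : ring_scope.

Definition trR (R : realType) (k : scalar_kind) (m : nat)
    (A : 'M[scalars R k]_m) : R := scal_re (\tr A).

Section MatrixFunctions.
Variables (R : realType) (k : scalar_kind).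
Local Notation K := (scalars R k).

Definition mx_lim (m n : nat) (u : nat -> 'M[K]_(m, n)) : 'M[K]_(m, n) :=
  \matrix_(i, j) scal_of k (limn (fun N => scal_re (u N i j)))
                           (limn (fun N => scal_im (u N i j))).

Definition mx_pseries (p : nat) (c : nat -> R) (A : 'M[K]_p) : 'M[K]_p :=
  mx_lim (fun N => \sum_(0 <= l < N) scal_real k (c l) *: A ^+ l).

Definition csr_coeff (l : nat) : R := (-1) ^+ l / (l.*2)`!%:R.
Definition ssr_coeff (l : nat) : R := (-1) ^+ l / (l.*2.+1)`!%:R.

Definition mxcsr (p : nat) (A : 'M[K]_p) := mx_pseries csr_coeff A.
Definition mxssr (p : nat) (A : 'M[K]_p) := mx_pseries ssr_coeff A.

(* [cos_coeff 1] is the sequence of Taylor coefficients of cos at 0. *)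
Definition mxcos (p : nat) (A : 'M[K]_p) := mx_pseries (cos_coeff 1) A.

Definition psdmx (p : nat) (S : 'M[K]_p) : Prop :=
  S^H = S /\ forall x : 'cV[K]_p, 0 <= (x^H *m S *m x) ord0 ord0.

Definition mxsqrt (p : nat) (A : 'M[K]_p) : 'M[K]_p :=
  xget 0 [set S | psdmx S /\ S *m S = A].

End MatrixFunctions.

(* The coefficients above are those of the entire functions continuing
   cos (z ^ (1/2)) and z ^ (- 1/2) sin (z ^ (1/2)). *)
Lemma csr_sqr (R : realType) (x : R) :
  series (fun l => csr_coeff R l * (x ^+ 2) ^+ l) @ \oo --> cos x.
Proof.
rewrite [X in series X](_ : _ = cos_coeff' x); first exact: cvg_cos_coeff'.
apply/funext => l; rewrite /csr_coeff /cos_coeff' -exprM mul2n -exprnP.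
by rewrite mulrAC.
Qed.

Lemma ssr_sqr (R : realType) (x : R) :
  series (fun l => ssr_coeff R l * (x ^+ 2) ^+ l * x) @ \oo --> sin x.
Proof.
rewrite [X in series X](_ : _ = sin_coeff' x); first exact: cvg_sin_coeff'.
apply/funext => l; rewrite /ssr_coeff /sin_coeff' -exprM mul2n -exprnP.
by rewrite -mulrA -exprSr mulrAC.
Qed.

Section Calculus.
Variable R : realType.

Fixpoint Cr (r : nat) (V : normedModType R) (f : V -> R) : Prop :=
  continuous f /\
  match r with
  | 0 => True
  | r'.+1 => forall v : V,
      (forall x, derivable f x v) /\ Cr r' (fun x => 'D_v f x)
  end.

Definition Cinfty (V : normedModType R) (f : V -> R) : Prop :=
  forall r, Cr r f.

Variables (k : scalar_kind) (n p : nat).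
Local Notation M := 'M[scalars R k]_(n, p).

Definition smooth_mx (V : normedModType R) (F : V -> M) : Prop :=
  forall i j, Cinfty (fun x => scal_re (F x i j)) /\
              Cinfty (fun x => scal_im (F x i j)).

Definition partial_mx (V : normedModType R) (F : V -> M) (v x : V) : M :=
  \matrix_(i, j) scal_of k ('D_v (fun y => scal_re (F y i j)) x)
                           ('D_v (fun y => scal_im (F y i j)) x).

Definition vel (g : R -> M) (t : R) : M := partial_mx (g : R^o -> M) 1 t.

Definition dds (F : R^o * R^o -> M) (s t : R) : M := partial_mx F (1, 0) (s, t).
Definition ddt (F : R^o * R^o -> M) (s t : R) : M := partial_mx F (0, 1) (s, t).

End Calculus.

Section Manifolds.
Variables (R : realType) (k : scalar_kind) (n p : nat).
Local Notation K := (scalars R k).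
Local Notation M := 'M[K]_(n, p).

Definition stiefel (Y : M) : Prop := Y^H *m Y = 1%:M.
Definition antisym (A : 'M[K]_p) : Prop := A^H = - A.
Definition unitaryK (U : 'M[K]_p) : Prop := U^H *m U = 1%:M.
Definition tangent (Y w : M) : Prop := antisym (Y^H *m w).
Definition horizontal (Y w : M) : Prop := Y^H *m w = 0.

Definition smooth_curve (g : R -> M) : Prop :=
  (forall t, stiefel (g t)) /\ smooth_mx (g : R^o -> M).

Definition smooth_family (F : R^o * R^o -> M) : Prop :=
  (forall z, stiefel (F z)) /\ smooth_mx F.

(* The Stiefel manifold and its quotients are treated uniformly: a space is
   given by the projection [proj] of the Stiefel manifold onto its points, the
   differential [dproj Y w] of this projection, and the inner product
   [metric Y w1 w2] of [dproj Y w1] and [dproj Y w2].  Smooth curves and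
   smooth two-parameter families in the space are the projections of smooth
   ones in the Stiefel manifold.  For the quotient by a compact group acting
   freely this is the quotient smooth structure, because a smooth map from
   the contractible space R or R^2 into the quotient lifts globally. *)
Record riem_space := RiemSpace {
  pt : Type;
  tvec : Type;
  proj : M -> pt;
  dproj : M -> M -> tvec;
  metric : M -> M -> M -> R }.

Section Riemannian.
Variable X : riem_space.

Definition lift_of (c : R -> pt X) (g : R -> M) : Prop :=
  smooth_curve g /\ forall t, c t = proj X (g t).

Definition tangent_at (x : pt X) (v : tvec X) : Prop :=
  exists Y w, [/\ stiefel Y, tangent Y w, proj X Y = x & dproj X Y w = v].

Definition tnorm (v : tvec X) : R :=
  xget 0 [set r | exists Y w, [/\ stiefel Y, tangent Y w, dproj X Y w = v
                                & r = Num.sqrt (metric X Y w w)]].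

Definition velocity (c : R -> pt X) (t : R) (v : tvec X) : Prop :=
  exists g, lift_of c g /\ dproj X (g t) (vel g t) = v.

(* 2 <D_t d_t F, d_s F> at (0, t), D being the Levi-Civita covariant
   derivative: Koszul's formula for the commuting fields d_s F, d_t F. *)
Definition koszul (F : R^o * R^o -> M) (t : R) : R :=
  2 * derive1 (fun u : R => metric X (F (0, u)) (ddt F 0 u) (dds F 0 u)) t
  - derive1 (fun s : R => metric X (F (s, t)) (ddt F s t) (ddt F s t)) 0.

(* The covariant acceleration of c is orthogonal to d_s F, for every family F
   through c = F (0, _).  As the Stiefel and Grassmann manifolds are compact,
   hence complete, geodesics are taken to be defined on all of R. *)
Definition geodesic (c : R -> pt X) : Prop :=
  (exists g, lift_of c g) /\
  forall F, smooth_family F -> (forall t, proj X (F (0, t)) = c t) ->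
    forall t, koszul F t = 0.

Definition geodesic_from (x : pt X) (v : tvec X) (c : R -> pt X) : Prop :=
  [/\ geodesic c, c 0 = x & velocity c 0 v].

(* Exp_x v is well defined and equal to z. *)
Definition is_Exp (x : pt X) (v : tvec X) (z : pt X) : Prop :=
  (exists c, geodesic_from x v c) /\
  (forall c, geodesic_from x v c -> c 1 = z).

(* v is a (not necessarily unique) value of Log_x z. *)
Definition is_Log (x : pt X) (z : pt X) (v : tvec X) : Prop :=
  [/\ tangent_at x v, is_Exp x v z &
      forall w, tangent_at x w -> is_Exp x w z -> tnorm v <= tnorm w].

Definition curve_length (g : R -> M) : R :=
  \int[lebesgue_measure]_(t in `[0, 1]%classic)
     Num.sqrt (metric X (g t) (vel g t) (vel g t)).

(* Smooth curves give the same infimum as piecewise smooth ones, which become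
   smooth after a reparametrization that is flat at the break points. *)
Definition geodesic_dist (x z : pt X) : \bar R :=
  ereal_inf [set (curve_length g)%:E | g in
    [set g | [/\ smooth_curve g, proj X (g 0) = x & proj X (g 1) = z]]].

End Riemannian.

Variables a0 a1 : R.

Definition metric_op (Y w : M) : M :=
  scal_real k a0 *: w + scal_real k (a1 - a0) *: (Y *m Y^H *m w).

Definition st_metric (Y w1 w2 : M) : R := trR (w1^H *m metric_op Y w2).

Definition St : riem_space :=
  {| pt := M; tvec := M * M; proj := id; dproj := pair; metric := st_metric |}.

Definition orbit_mx (Y : M) : set M :=
  [set Y *m U | U in [set U : 'M[K]_p | unitaryK U]].

(* (Y, w) and (Y', w') have the same image in the tangent bundle of the
   quotient iff Y' = Y U and w' - w U is tangent to the orbit at Y U. *)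
Definition orbit_tvec (Y w : M) : set (M * M) :=
  [set q | exists U A : 'M[K]_p, [/\ unitaryK U, antisym A &
             q = (Y *m U, w *m U + Y *m U *m A)]].

(* Horizontal representative of the class of w: Y Y^H w is tangent to the
   orbit of Y. *)
Definition hor_part (Y w : M) : M := w - Y *m (Y^H *m w).

Definition gr_metric (Y w1 w2 : M) : R :=
  st_metric Y (hor_part Y w1) (hor_part Y w2).

Definition Gr : riem_space :=
  {| pt := set M; tvec := set (M * M);
     proj := orbit_mx; dproj := orbit_tvec; metric := gr_metric |}.

End Manifolds.

Definition acos_ratio (R : realType) (x : R) : R :=
  if x == 1 then 1 else (Num.sqrt (1 - x ^+ 2))^-1 * acos x.

Definition real_diag (R : realType) (k : scalar_kind) (p : nat)
    (s : 'rV[R]_p) : 'M[scalars R k]_p := diag_mx (map_mx (@scal_real R k) s).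

(* Main.v *)
Require Import Defs.
From HB Require Import structures.
From mathcomp Require Import all_boot all_order all_algebra.
From mathcomp Require Import all_classical all_reals all_analysis.
From mathcomp Require Import sesquilinear spectral complex ring lra.

Set Implicit Arguments.
Unset Strict Implicit.
Unset Printing Implicit Defensive.

Import Order.TTheory GRing.Theory Num.Theory.
Import numFieldNormedType.Exports.

Local Open Scope classical_set_scope.
Local Open Scope ring_scope.

(* Along a horizontal curve E(t) = Y C(t) + eta S(t), with C = cos (t A^(1/2)),
   S = A^(-1/2) sin (t A^(1/2)) and A = eta^H eta, one has E^H E' = 0 and
   E'' = - E A; the first variation formula then shows that E is a geodesic,
   both upstairs and, since only the horizontal part of the velocity enters the
   quotient metric, downstairs.  Uniqueness needs no ODE theory: the unitary
   groups act by isometries, so Noether's theorem makes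
   Om = h g^H - g h^H constant along any geodesic g, h being the horizontal part
   of g', and hence g' = Om g + g B with B antisymmetric.  As E' = Om E, the
   matrix W = E^H g stays unitary, which forces g = E W.
   For the distance, let v_i be an orthonormal frame moved along a curve by the
   horizontal lift: each vector g v_i sweeps an angle, and the lengths of these
   arcs are bounded by the speed through Cauchy-Schwarz.  Choosing the frame
   from the SVD of Y^H Z, the i-th angle is at least arccos of the i-th singular
   value.  Instead of solving the parallel transport equation, the unitary that
   matches the end frames is built up from short pieces of the curve by the
   spherical triangle inequality. *)

(** * Scalars and conjugate transposes *)

(** On Stiefel points the quotient metric coincides with the Stiefel form taken with second
    parameter 0, so the first variation and Noether's theorem, proved for an arbitrary second
    parameter, serve both spaces. [Cr] speaks only of directional derivatives of real functions;
    calculus is therefore carried out on real and imaginary parts, with the chain rule along affine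
    maps and with flows given by explicit functional calculus. The length bound is run with a fixed
    linear functional of the p angles, whose weights have square sum at most [a0], and not with
    their Euclidean norm: a weighted sum adds up over successive pieces of the curve as soon as each
    single angle satisfies the triangle inequality. Only at the end are the weights taken
    proportional to arccos of the singular values, where Cauchy-Schwarz is an equality. The frame
    must stay free until then too, since it depends on the accumulated unitary matrix; hence bounds
    that are uniform over all frames. *)

Section Scalars.
Variables (R : realType) (k : scalar_kind).
Local Notation K := (scalars R k).

Lemma scal_conj_zmod_morphism : zmod_morphism (@scal_conj R k).
Proof. by case: k => //= x y; exact: (rmorphB (@conjc R)). Qed.

Lemma scal_conj_monoid_morphism : monoid_morphism (@scal_conj R k).
Proof.
by case: k; split=> //= [|x y]; [exact: (rmorph1 (@conjc R))
                              |exact: (rmorphM (@conjc R))].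
Qed.

HB.instance Definition _ :=
  GRing.isZmodMorphism.Build K K (@scal_conj R k) scal_conj_zmod_morphism.
HB.instance Definition _ :=
  GRing.isMonoidMorphism.Build K K (@scal_conj R k) scal_conj_monoid_morphism.

Lemma scal_real_zmod_morphism : zmod_morphism (@scal_real R k).
Proof. by case: k => //= x y; rewrite /scal_real /=; congr Complex; rewrite subrr. Qed.

Lemma scal_real_monoid_morphism : monoid_morphism (@scal_real R k).
Proof.
case: k; split=> //= x y; rewrite /scal_real /=.
by congr Complex; rewrite ?mulr0 ?mul0r ?subr0 ?addr0.
Qed.

HB.instance Definition _ :=
  GRing.isZmodMorphism.Build R K (@scal_real R k) scal_real_zmod_morphism.
HB.instance Definition _ :=
  GRing.isMonoidMorphism.Build R K (@scal_real R k) scal_real_monoid_morphism.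

Lemma scal_re_zmod_morphism : zmod_morphism (@scal_re R k).
Proof. by case: k => //= -[? ?] [? ?]. Qed.

Lemma scal_im_zmod_morphism : zmod_morphism (@scal_im R k).
Proof. by case: k => [|[? ?] [? ?]] //= _ _; rewrite subr0. Qed.

HB.instance Definition _ :=
  GRing.isZmodMorphism.Build K R (@scal_re R k) scal_re_zmod_morphism.
HB.instance Definition _ :=
  GRing.isZmodMorphism.Build K R (@scal_im R k) scal_im_zmod_morphism.

Lemma scal_ofK (z : K) : scal_of k (scal_re z) (scal_im z) = z.
Proof. by move: z; case: k => //= -[]. Qed.

Lemma scal_re_of (a b : R) : scal_re (scal_of k a b) = a :> R.
Proof. by case: k. Qed.

Lemma scal_im_of (a b : R) :
  scal_im (scal_of k a b) = (if k is ComplexScalars then b else 0) :> R.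
Proof. by case: k. Qed.

Lemma scal_eqP (z w : K) : scal_re z = scal_re w -> scal_im z = scal_im w -> z = w.
Proof. by move=> hr hi; rewrite -[z]scal_ofK -[w]scal_ofK hr hi. Qed.

Lemma scal_re_real (a : R) : scal_re (scal_real k a) = a :> R.
Proof. exact: scal_re_of. Qed.

Lemma scal_im_real (a : R) : scal_im (scal_real k a) = 0 :> R.
Proof. by case: k. Qed.

Lemma scal_reM (z w : K) :
  scal_re (z * w) = scal_re z * scal_re w - scal_im z * scal_im w.
Proof. by move: z w; case: k => /= [z w|[? ?] [? ?]]; rewrite ?mulr0 ?subr0. Qed.

Lemma scal_imM (z w : K) :
  scal_im (z * w) = scal_re z * scal_im w + scal_im z * scal_re w.
Proof.
by move: z w; case: k => /= [z w|[? ?] [? ?]]; rewrite ?mulr0 ?mul0r ?addr0.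
Qed.

Lemma scal_re_conj (z : K) : scal_re (scal_conj z) = scal_re z.
Proof. by move: z; case: k => //= -[]. Qed.

Lemma scal_im_conj (z : K) : scal_im (scal_conj z) = - scal_im z.
Proof. by move: z; case: k => [z|[]] //=; rewrite oppr0. Qed.

Lemma scal_conjK : involutive (@scal_conj R k).
Proof. by move=> z; apply: scal_eqP; rewrite ?scal_re_conj ?scal_im_conj ?opprK. Qed.

Lemma scal_conj_real (a : R) : scal_conj (scal_real k a) = scal_real k a.
Proof.
by apply: scal_eqP; rewrite ?scal_re_conj // scal_im_conj scal_im_real oppr0.
Qed.

Lemma scal_reZ (a : R) (z : K) : scal_re (scal_real k a * z) = a * scal_re z.
Proof. by rewrite scal_reM scal_re_real scal_im_real mul0r subr0. Qed.

Lemma scal_imZ (a : R) (z : K) : scal_im (scal_real k a * z) = a * scal_im z.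
Proof. by rewrite scal_imM scal_re_real scal_im_real mul0r addr0. Qed.

Lemma scal_re_gram (z : K) :
  scal_re (scal_conj z * z) = scal_re z ^+ 2 + scal_im z ^+ 2.
Proof. by rewrite scal_reM scal_re_conj scal_im_conj mulNr opprK !expr2. Qed.

Lemma scal_gram_ge0 (z : K) : 0 <= scal_conj z * z.
Proof.
move: z; case: k => /= z; first by rewrite -expr2 sqr_ge0.
by rewrite mulrC; exact: mulcJ_ge0.
Qed.

Lemma ctrE m n (A : 'M[K]_(m, n)) i j : A^H i j = scal_conj (A j i).
Proof. by rewrite !mxE. Qed.

Section Ctr.
Variables (m n : nat).
Implicit Types A B : 'M[K]_(m, n).

Lemma ctrK A : A^H^H = A.
Proof. by apply/matrixP=> i j; rewrite !ctrE scal_conjK. Qed.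

Lemma ctrD A B : (A + B)^H = A^H + B^H.
Proof. by rewrite /ctr raddfD map_mxD. Qed.

Lemma ctrN A : (- A)^H = - A^H.
Proof. by rewrite /ctr raddfN map_mxN. Qed.

Lemma ctrB A B : (A - B)^H = A^H - B^H.
Proof. by rewrite ctrD ctrN. Qed.

Lemma ctr0 : (0 : 'M[K]_(m, n))^H = 0.
Proof. by rewrite /ctr raddf0 map_mx0. Qed.

Lemma ctrZ (a : R) A : (scal_real k a *: A)^H = scal_real k a *: A^H.
Proof. by rewrite /ctr linearZ /= map_mxZ /= scal_conj_real. Qed.

Lemma ctr_sum I (r : seq I) (P : pred I) (F : I -> 'M[K]_(m, n)) :
  (\sum_(i <- r | P i) F i)^H = \sum_(i <- r | P i) (F i)^H.
Proof. by rewrite (big_morph (@ctr R k m n) ctrD ctr0). Qed.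

End Ctr.

Lemma ctrM m n p (A : 'M[K]_(m, n)) (B : 'M[K]_(n, p)) : (A *m B)^H = B^H *m A^H.
Proof. by rewrite /ctr trmx_mul map_mxM. Qed.

Lemma scal_re_mulmx m n p (A : 'M[K]_(m, n)) (B : 'M[K]_(n, p)) i j :
  scal_re ((A *m B) i j) =
  \sum_l (scal_re (A i l) * scal_re (B l j) - scal_im (A i l) * scal_im (B l j)).
Proof. by rewrite mxE raddf_sum; apply: eq_bigr => l _; exact: scal_reM. Qed.

Lemma scal_im_mulmx m n p (A : 'M[K]_(m, n)) (B : 'M[K]_(n, p)) i j :
  scal_im ((A *m B) i j) =
  \sum_l (scal_re (A i l) * scal_im (B l j) + scal_im (A i l) * scal_re (B l j)).
Proof. by rewrite mxE raddf_sum; apply: eq_bigr => l _; exact: scal_imM. Qed.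

Lemma ctr1 n : (1%:M : 'M[K]_n)^H = 1%:M.
Proof. by rewrite /ctr trmx1 map_mx1. Qed.

Lemma ctr_real_diag n (s : 'rV[R]_n) : (real_diag k s)^H = real_diag k s.
Proof.
apply/matrixP=> i j; rewrite ctrE !mxE rmorphMn /= scal_conj_real.
by rewrite eq_sym; case: eqP => [->|].
Qed.

Lemma gram_antisym n p (Y : 'M[K]_(n, p)) (w : 'M[K]_(n, p)) :
  w^H *m Y + Y^H *m w = 0 -> antisym (Y^H *m w).
Proof. by move=> /eqP; rewrite /antisym ctrM ctrK addr_eq0 => /eqP. Qed.

Lemma trRD n (A B : 'M[K]_n) : trR (A + B) = trR A + trR B.
Proof. by rewrite /trR !raddfD. Qed.

Lemma trRN n (A : 'M[K]_n) : trR (- A) = - trR A.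
Proof. by rewrite /trR !raddfN. Qed.

Lemma trRB n (A B : 'M[K]_n) : trR (A - B) = trR A - trR B.
Proof. by rewrite trRD trRN. Qed.

Lemma trR0 n : trR (0 : 'M[K]_n) = 0.
Proof. by rewrite /trR !raddf0. Qed.

Lemma trRZ n (a : R) (A : 'M[K]_n) : trR (scal_real k a *: A) = a * trR A.
Proof. by rewrite /trR mxtraceZ scal_reZ. Qed.

Lemma trR_mulC m n (A : 'M[K]_(m, n)) (B : 'M[K]_(n, m)) :
  trR (A *m B) = trR (B *m A).
Proof. by rewrite /trR mxtrace_mulC. Qed.

Lemma trRE n (A : 'M[K]_n) : trR A = \sum_i scal_re (A i i).
Proof. by rewrite /trR raddf_sum. Qed.

Lemma trR_ctr n (A : 'M[K]_n) : trR A^H = trR A.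
Proof. by rewrite !trRE; apply: eq_bigr => i _; rewrite ctrE scal_re_conj. Qed.

Lemma trR_gramE m n (A : 'M[K]_(m, n)) :
  trR (A^H *m A) = \sum_j \sum_i (scal_re (A i j) ^+ 2 + scal_im (A i j) ^+ 2).
Proof.
rewrite trRE; apply: eq_bigr => j _; rewrite mxE raddf_sum /=.
by apply: eq_bigr => i _; rewrite ctrE scal_re_gram.
Qed.

Lemma trR_gram_ge0 m n (A : 'M[K]_(m, n)) : 0 <= trR (A^H *m A).
Proof.
by rewrite trR_gramE; do 2![apply: sumr_ge0 => ? _]; rewrite addr_ge0 ?sqr_ge0.
Qed.

Lemma trR_gram_eq0 m n (A : 'M[K]_(m, n)) : trR (A^H *m A) = 0 -> A = 0.
Proof.
rewrite trR_gramE => /eqP; rewrite psumr_eq0; last first.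
  by move=> j _; apply: sumr_ge0 => i _; rewrite addr_ge0 ?sqr_ge0.
move=> /allP h; apply/matrixP=> i j; have := h j (mem_index_enum _).
rewrite psumr_eq0; last by move=> l _; rewrite addr_ge0 ?sqr_ge0.
move=> /allP/(_ i (mem_index_enum _)); rewrite /= paddr_eq0 ?sqr_ge0//.
rewrite !sqrf_eq0 => /andP[/eqP re0 /eqP im0].
by apply: scal_eqP; rewrite mxE raddf0.
Qed.

(** Conjugate transposition sends [S X] to [- X S], so the real trace is its own opposite. This
    orthogonality kills the acceleration term in the first variation. *)
Lemma trR_antisym_herm n (X S : 'M[K]_n) : X^H = - X -> S^H = S -> trR (S *m X) = 0.
Proof.
move=> hX hS; have := trR_ctr (S *m X).
rewrite ctrM hX hS mulNmx trRN trR_mulC; lra.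
Qed.

Lemma unitaryC n (U : 'M[K]_n) : U^H *m U = 1%:M -> U *m U^H = 1%:M.
Proof. exact: mulmx1C. Qed.

Lemma unitaryM n (U V : 'M[K]_n) :
  U^H *m U = 1%:M -> V^H *m V = 1%:M -> (U *m V)^H *m (U *m V) = 1%:M.
Proof. by move=> hU hV; rewrite ctrM mulmxA -(mulmxA V^H) hU mulmx1. Qed.

End Scalars.

(** * Smooth real functions *)

Section SmoothReal.
Variable R : realType.

Section OneSpace.
Variable V : normedModType R.
Implicit Types f g : V -> R.

(** In the product rule at order r + 1 the undifferentiated factors are needed at order r. *)
Lemma Cr_le r f : Cr r.+1 f -> Cr r f.
Proof.
elim: r f => [|r IHr] f [cf df]; first by split.
by split=> // v; have [dfv /IHr] := df v.
Qed.

Lemma Cinfty_continuous f : Cinfty f -> continuous f.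
Proof. by move=> /(_ 0%N)[]. Qed.

Lemma Cinfty_derivable f : Cinfty f -> forall x v, derivable f x v.
Proof. by move=> /(_ 1%N)[_ df] x v; have [] := df v. Qed.

Lemma Cinfty_derive f : Cinfty f -> forall v, Cinfty (fun x => 'D_v f x).
Proof. by move=> sf v r; have [_ /(_ v)[]] := sf r.+1. Qed.

Lemma Cr_cst r (c : R) : Cr r (fun _ : V => c).
Proof.
elim: r c => [|r IHr] c; first by split => //; exact: cst_continuous.
split; first exact: cst_continuous.
move=> v; split=> [x|]; first exact: derivable_cst.
rewrite [X in _ X](_ : _ = fun _ => 0); first exact: IHr.
by apply/funext => x; rewrite derive_cst.
Qed.

Lemma CrD r f g : Cr r f -> Cr r g -> Cr r (fun x => f x + g x).
Proof.
elim: r f g => [|r IHr] f g [cf df] [cg dg].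
  by split=> // x; apply: continuousD; [exact: cf|exact: cg].
split; first by move=> x; apply: continuousD; [exact: cf|exact: cg].
move=> v; have [dfv sfv] := df v; have [dgv sgv] := dg v.
split=> [x|]; first exact: derivableD.
rewrite [X in _ X](_ : _ = fun x => 'D_v f x + 'D_v g x); first exact: IHr.
by apply/funext => x; rewrite deriveD.
Qed.

Lemma CrM r f g : Cr r f -> Cr r g -> Cr r (fun x => f x * g x).
Proof.
elim: r f g => [|r IHr] f g sf sg; have [cf df] := sf; have [cg dg] := sg.
  by split=> // x; apply: continuousM; [exact: cf|exact: cg].
split; first by move=> x; apply: continuousM; [exact: cf|exact: cg].
move=> v; have [dfv sfv] := df v; have [dgv sgv] := dg v.
split=> [x|]; first exact: derivableM.
rewrite [X in _ X](_ : _ = fun x => f x * 'D_v g x + g x * 'D_v f x).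
  by apply: CrD; apply: IHr => //; exact: Cr_le.
by apply/funext => x; rewrite deriveM.
Qed.

Lemma derive_mul f g x v : Cinfty f -> Cinfty g ->
  'D_v (fun y => f y * g y) x = 'D_v f x * g x + f x * 'D_v g x.
Proof.
move=> sf sg; rewrite deriveM; [|exact: Cinfty_derivable|exact: Cinfty_derivable].
by rewrite addrC mulrC.
Qed.

Lemma Cinfty_cst (c : R) : Cinfty (fun _ : V => c).
Proof. by move=> r; exact: Cr_cst. Qed.

Lemma CinftyD f g : Cinfty f -> Cinfty g -> Cinfty (fun x => f x + g x).
Proof. by move=> sf sg r; exact: CrD. Qed.

Lemma CinftyM f g : Cinfty f -> Cinfty g -> Cinfty (fun x => f x * g x).
Proof. by move=> sf sg r; exact: CrM. Qed.

Lemma CinftyN f : Cinfty f -> Cinfty (fun x => - f x).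
Proof.
move=> sf; rewrite [X in _ X](_ : _ = fun x => -1 * f x).
  by apply: CinftyM => //; exact: Cinfty_cst.
by apply/funext => x; rewrite mulN1r.
Qed.

Lemma CinftyB f g : Cinfty f -> Cinfty g -> Cinfty (fun x => f x - g x).
Proof. by move=> sf sg; apply: CinftyD => //; exact: CinftyN. Qed.

Lemma Cinfty_sum (I : Type) (s : seq I) (F : I -> V -> R) :
  (forall i, Cinfty (F i)) -> Cinfty (fun x => \sum_(i <- s) F i x).
Proof.
move=> sF; elim: s => [|i s IHs].
  by under eq_fun do rewrite big_nil; exact: Cinfty_cst.
by under eq_fun do rewrite big_cons; exact: CinftyD.
Qed.

Lemma derive_bigsum (I : Type) (s : seq I) (F : I -> V -> R) x v :
  (forall i, Cinfty (F i)) ->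
  'D_v (fun x => \sum_(i <- s) F i x) x = \sum_(i <- s) 'D_v (F i) x.
Proof.
move=> sF; elim: s => [|i s IHs].
  by under eq_fun do rewrite big_nil; rewrite derive_cst big_nil.
under eq_fun do rewrite big_cons.
rewrite big_cons -IHs deriveD//; first exact: Cinfty_derivable.
by apply: Cinfty_derivable; exact: Cinfty_sum.
Qed.

End OneSpace.

Section Pullback.
Variables (V W : normedModType R) (L : V -> W).
Hypotheses (linL : linear L) (cL : continuous L).

(** For a linear inner map the chain rule is an identity between difference quotients, so
    directional derivatives of [f] suffice. *)
Lemma pullback_quotient (f : W -> R) x v (h : R) :
  h^-1 *: (f (L (h *: v + x)) - f (L x)) =
  h^-1 *: (f (h *: L v + L x) - f (L x)).
Proof. by rewrite linL. Qed.

Lemma derivable_pullback (f : W -> R) x v :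
  derivable f (L x) (L v) -> derivable (f \o L) x v.
Proof.
rewrite /derivable; under eq_fun do rewrite /= -pullback_quotient.
by [].
Qed.

Lemma derive_pullback (f : W -> R) x v : 'D_v (f \o L) x = 'D_(L v) f (L x).
Proof.
rewrite /derive; under [in RHS]eq_fun do rewrite /= -pullback_quotient.
by [].
Qed.

Lemma Cinfty_pullback (f : W -> R) : Cinfty f -> Cinfty (f \o L).
Proof.
move=> sf r; elim: r f sf => [|r IHr] f sf.
  by split=> // x; apply: continuous_comp; [exact: cL|exact: (Cinfty_continuous sf)].
split; first by move=> x; apply: continuous_comp; [exact: cL|exact: (Cinfty_continuous sf)].
move=> v; split=> [x|].
  by apply: derivable_pullback; exact: Cinfty_derivable.
rewrite [X in _ X](_ : _ = (fun y => 'D_(L v) f y) \o L).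
  by apply: IHr; exact: Cinfty_derive.
by apply/funext => x; rewrite derive_pullback.
Qed.

End Pullback.

Lemma is_derive_Cinfty (f : R -> R) : Cinfty (f : R^o -> R) ->
  forall t : R, is_derive (t : R^o) 1 (f : R^o -> R^o) ('D_1 (f : R^o -> R) t).
Proof. by move=> sf t; apply: DeriveDef => //; exact: Cinfty_derivable. Qed.

(** The clauses of [Cr] quantify over all directions [v] of the line; differentiability in dimension
    one reduces them to the direction 1. *)
Lemma derive_scale (f : R -> R) (df t v : R) :
  is_derive (t : R^o) 1 (f : R^o -> R^o) df ->
  derivable (f : R^o -> R) t v /\ 'D_v (f : R^o -> R) t = v * df.
Proof.
move=> [dft <-].
have /derivable1_diffP difft : derivable (f : R^o -> R^o) t 1 by exact: dft.
split; first exact: (@diff_derivable R R^o R^o f t v difft).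
have E w : 'D_w (f : R^o -> R^o) t = 'd (f : R^o -> R^o) t w by exact: deriveE.
have -> : 'D_v (f : R^o -> R) t = 'd (f : R^o -> R^o) t v by exact: E.
by rewrite (E 1) -[v in LHS]mulr1 -[v * 1]/(v *: (1 : R^o)) linearZ.
Qed.

Lemma Cinfty_sin_cos :
  Cinfty (@sin R : R^o -> R) /\ Cinfty (@cos R : R^o -> R).
Proof.
(* The orders of sin and cos must rise together, each being up to sign the derivative of the
   other. *)
suff h r : Cr r (@sin R : R^o -> R) /\ Cr r (@cos R : R^o -> R).
  by split=> r; have [] := h r.
elim: r => [|r [IHs IHc]].
  by split; (split; last by []); [exact: continuous_sin|exact: continuous_cos].
split; (split; first by [exact: continuous_sin|exact: continuous_cos]) => v.
  split=> [x|]; first by have [] := derive_scale v (is_derive_sin x).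
  rewrite [X in _ X](_ : _ = fun x => v * cos x).
    by apply: CrM => //; exact: Cr_cst.
  by apply/funext => x; have [_] := derive_scale v (is_derive_sin x).
split=> [x|]; first by have [] := derive_scale v (is_derive_cos x).
rewrite [X in _ X](_ : _ = fun x => (- v) * sin x).
  by apply: CrM => //; exact: Cr_cst.
by apply/funext => x; have [_ ->] := derive_scale v (is_derive_cos x); rewrite mulrN mulNr.
Qed.

Lemma Cinfty_id : Cinfty (fun t : R^o => t : R).
Proof.
case=> [|r]; first by split=> // x; exact: cvg_id.
split; first by move=> x; exact: cvg_id.
move=> v; split=> [x|]; first exact: derivable_id.
rewrite [X in _ X](_ : _ = fun _ => v); first exact: Cr_cst.
by apply/funext => x; rewrite derive_id.
Qed.

Lemma Cinfty_scale (a : R) (f : R -> R) :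
  Cinfty (f : R^o -> R) -> Cinfty ((fun t => f (a * t)) : R^o -> R).
Proof.
move=> sf; apply: (@Cinfty_pullback R^o R^o (fun t => a * t)) sf.
- by move=> c x y; rewrite mulrDr mulrCA.
- exact: mulrl_continuous.
Qed.

End SmoothReal.

(** * Symmetry of second derivatives *)

Section Schwarz.
Variables (R : realType) (V : normedModType R).
Implicit Types (f : V -> R) (v w x : V).

Lemma is_derive_line f x v : Cinfty f -> forall t : R,
  is_derive (t : R^o) 1 (fun s : R^o => f (x + s *: v) : R^o)
    ('D_v f (x + t *: v)).
Proof.
move=> sf t.
have E : (fun h : R => h^-1 *: ((fun s : R^o => f (x + s *: v) : R^o)
            (h *: (1 : R^o) + t) - f (x + t *: v))) =
  (fun h : R => h^-1 *: (f (h *: v + (x + t *: v)) - f (x + t *: v))).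
  apply/funext => h; congr (_ *: (f _ - _)).
  by rewrite -[h *: (1 : R^o)]/(h * 1) mulr1 scalerDl addrCA.
apply: DeriveDef; last by rewrite /derive /= E.
by rewrite /derivable /= E; exact: (@Cinfty_derivable R V f sf (x + t *: v) v).
Qed.

(** The mean value theorem is applied to the difference of [f] on the two lines, which gives the
    same [a] on both; a second application can then follow in the direction of [y - x]. *)
Lemma MVT_line_diff f x y v (h : R) : Cinfty f -> 0 < h -> exists2 a : R,
  0 <= a <= h &
  f (y + h *: v) - f (x + h *: v) - (f y - f x) =
  h * ('D_v f (y + a *: v) - 'D_v f (x + a *: v)).
Proof.
move=> sf h0.
have d t := is_deriveB (is_derive_line y v sf t) (is_derive_line x v sf t).
have [|a ah] := @MVT_segment R (fun s => f (y + s *: v) - f (x + s *: v))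
  (fun s => 'D_v f (y + s *: v) - 'D_v f (x + s *: v)) _ _ (ltW h0) (fun t _ => d t).
  apply: derivable_within_continuous => t _.
  by case: (d t).
rewrite !scale0r !addr0 subr0 mulrC => E; by exists a.
Qed.

Lemma second_difference f x v w (h : R) : Cinfty f -> 0 < h ->
  exists a b : R, [/\ 0 <= a <= h, 0 <= b <= h &
    f (x + h *: w + h *: v) - f (x + h *: v) - (f (x + h *: w) - f x) =
    h * (h * 'D_w (fun y => 'D_v f y) (x + a *: v + b *: w))].
Proof.
move=> sf h0.
have [a ah ->] := MVT_line_diff x (x + h *: w) v sf h0.
have d t := is_derive_line (x + a *: v) w (Cinfty_derive sf v) t.
have [|b bh] := @MVT_segment R _ _ _ _ (ltW h0) (fun t _ => d t).
  apply: derivable_within_continuous => t _.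
  by case: (d t).
rewrite scale0r addr0 subr0 mulrC => E; exists a, b; split=> //.
by rewrite -E addrAC.
Qed.

Lemma derive_comm f x v w : Cinfty f ->
  'D_w (fun y => 'D_v f y) x = 'D_v (fun y => 'D_w f y) x.
Proof.
(* The second difference of [f] over the parallelogram spanned by [h v] and [h w] is symmetric in
   [v] and [w]. *)
have swap (A B C D : R) : A - B - (C - D) = A - C - (B - D) by lra.
move=> sf; apply/eqP; rewrite -subr_eq0 -normr_le0 leNgt; apply/negP.
(* If the mixed derivatives at [x] differed by [d > 0], each would stay within [d / 2] of its value
   at [x] on a small ball; yet the two evaluations of the second difference make them agree at two
   points of that ball. *)
set d := `|_| => d0.
have near_pt u u' : \forall z \near ((0, 0) : R^o * R^o),
    `|'D_u' (fun y => 'D_u f y) x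
      - 'D_u' (fun y => 'D_u f y) (x + z.1 *: u + z.2 *: u')| < d / 2.
  have c : continuous (fun z : R^o * R^o => x + z.1 *: u + z.2 *: u').
    move=> z; apply: cvgD; first apply: cvgD.
    - exact: cvg_cst.
    - by apply: cvgZr_tmp; exact: cvg_fst.
    - by apply: cvgZr_tmp; exact: cvg_snd.
  have := Cinfty_continuous (Cinfty_derive (Cinfty_derive sf u) u').
  move=> /(_ (x + 0 *: u + 0 *: u')) cD.
  have := @continuous_comp _ _ _ _ _ ((0, 0) : R^o * R^o) (c _) cD.
  move=> /cvgrPdist_lt/(_ (d / 2)).
  rewrite /= !scale0r !addr0; apply; lra.
have := near_pt w v => /nbhs_ballP[e2 /= e20 h2].
have := near_pt v w => /nbhs_ballP[e1 /= e10 h1].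
pose h := Num.min e1 e2 / 2.
have hm : 0 < Num.min e1 e2 by rewrite lt_min e10.
have h0 : 0 < h by rewrite /h; lra.
have he1 : h < e1 by rewrite /h; have := ge_min e1 e1 e2; rewrite lexx /=; lra.
have he2 : h < e2 by rewrite /h; have := ge_min e2 e1 e2; rewrite lexx orbT /=; lra.
have inball (a b e : R) : 0 <= a <= h -> 0 <= b <= h -> h < e ->
    ball ((0, 0) : R^o * R^o) e (a, b).
  move=> /andP[a0 ah] /andP[b0 bh] he.
  by split; rewrite /ball /= sub0r normrN ger0_norm//; exact: le_lt_trans he.
have [a1 [b1 [ha1 hb1 E1]]] := second_difference x v w sf h0.
have [a2 [b2 [ha2 hb2 E2]]] := second_difference x w v sf h0.
have {}h1 := h1 _ (inball _ _ _ ha1 hb1 he1).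
have {}h2 := h2 _ (inball _ _ _ ha2 hb2 he2).
have E : 'D_w (fun y => 'D_v f y) (x + a1 *: v + b1 *: w) =
         'D_v (fun y => 'D_w f y) (x + a2 *: w + b2 *: v).
  have hI := mulfI (lt0r_neq0 h0).
  apply: (hI); apply: (hI); apply: (eq_trans (esym E1)); apply: (eq_trans _ E2).
  by rewrite [x + h *: v + h *: w]addrAC; exact: swap.
move: h1; rewrite E => h1'.
move: h2; rewrite distrC => h2'.
have := le_lt_trans (ler_distD _ _ _) (ltrD h1' h2').
by rewrite -splitr ltxx.
Qed.

End Schwarz.

(** * Smooth matrix-valued functions *)

Section MatrixCalculus.
Variables (R : realType) (k : scalar_kind).
Local Notation K := (scalars R k).

Section OneSpace.
Variable V : normedModType R.

Section Additive.
Variables m n : nat.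
Implicit Types F G : V -> 'M[K]_(m, n).

Lemma smooth_mx_re F i j : smooth_mx F -> Cinfty (fun x => scal_re (F x i j)).
Proof. by move=> /(_ i j)[]. Qed.

Lemma smooth_mx_im F i j : smooth_mx F -> Cinfty (fun x => scal_im (F x i j)).
Proof. by move=> /(_ i j)[]. Qed.

Lemma re_partial F v x i j :
  scal_re (partial_mx F v x i j) = 'D_v (fun y => scal_re (F y i j)) x.
Proof. by rewrite mxE scal_re_of. Qed.

(** For real scalars [scal_of] discards its second argument, harmlessly since the imaginary part is
    constantly 0. *)
Lemma im_partial F v x i j :
  scal_im (partial_mx F v x i j) = 'D_v (fun y => scal_im (F y i j)) x.
Proof.
by rewrite mxE scal_im_of; move: F; case: k => // F; rewrite derive_cst.
Qed.

Lemma smooth_mx_cst (A : 'M[K]_(m, n)) : smooth_mx (fun _ : V => A).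
Proof. by split; exact: Cinfty_cst. Qed.

Lemma partial_cst (A : 'M[K]_(m, n)) v x : partial_mx (fun _ : V => A) v x = 0.
Proof.
by apply/matrixP=> i j; apply: scal_eqP;
  rewrite ?re_partial ?im_partial derive_cst mxE raddf0.
Qed.

Lemma smooth_mxD F G : smooth_mx F -> smooth_mx G -> smooth_mx (fun x => F x + G x).
Proof.
move=> sF sG i j; have [? ?] := sF i j; have [? ?] := sG i j.
by split; [under eq_fun do rewrite mxE raddfD|under eq_fun do rewrite mxE raddfD];
  exact: CinftyD.
Qed.

Lemma partialD F G v x : smooth_mx F -> smooth_mx G ->
  partial_mx (fun x => F x + G x) v x = partial_mx F v x + partial_mx G v x.
Proof.
move=> sF sG; apply/matrixP=> i j; rewrite [RHS]mxE.
have [? ?] := sF i j; have [? ?] := sG i j.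
apply: scal_eqP; rewrite ?re_partial ?im_partial raddfD /= ?re_partial ?im_partial.
  under eq_fun do rewrite mxE raddfD.
  by rewrite deriveD//; exact: Cinfty_derivable.
under eq_fun do rewrite mxE raddfD.
by rewrite deriveD//; exact: Cinfty_derivable.
Qed.

Lemma smooth_mxZ (f : V -> R) F : Cinfty f -> smooth_mx F ->
  smooth_mx (fun x => scal_real k (f x) *: F x).
Proof.
move=> sf sF i j; have [? ?] := sF i j; split.
  by under eq_fun do rewrite mxE scal_reZ; exact: CinftyM.
by under eq_fun do rewrite mxE scal_imZ; exact: CinftyM.
Qed.

Lemma partialZ (f : V -> R) F v x : Cinfty f -> smooth_mx F ->
  partial_mx (fun x => scal_real k (f x) *: F x) v x =
  scal_real k ('D_v f x) *: F x + scal_real k (f x) *: partial_mx F v x.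
Proof.
move=> sf sF; apply/matrixP=> i j; rewrite 3![in RHS]mxE.
have [? ?] := sF i j.
apply: scal_eqP; rewrite ?re_partial ?im_partial raddfD /=
    ?scal_reZ ?scal_imZ ?re_partial ?im_partial.
  under eq_fun do rewrite mxE scal_reZ.
  by rewrite derive_mul.
under eq_fun do rewrite mxE scal_imZ.
by rewrite derive_mul.
Qed.

Lemma smooth_mxN F : smooth_mx F -> smooth_mx (fun x => - F x).
Proof.
move=> sF i j; have [? ?] := sF i j.
by split; [under eq_fun do rewrite mxE raddfN|under eq_fun do rewrite mxE raddfN];
  exact: CinftyN.
Qed.

Lemma partialN F v x : smooth_mx F ->
  partial_mx (fun x => - F x) v x = - partial_mx F v x.
Proof.
move=> sF; apply/eqP; rewrite -addr_eq0 -partialD//; last exact: smooth_mxN.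
by under eq_fun do rewrite addNr; rewrite partial_cst.
Qed.

Lemma partialB F G v x : smooth_mx F -> smooth_mx G ->
  partial_mx (fun x => F x - G x) v x = partial_mx F v x - partial_mx G v x.
Proof. by move=> sF sG; rewrite partialD ?partialN//; exact: smooth_mxN. Qed.

Lemma smooth_mx_sum (I : Type) (s : seq I) (F : I -> V -> 'M[K]_(m, n)) :
  (forall i, smooth_mx (F i)) -> smooth_mx (fun x => \sum_(i <- s) F i x).
Proof.
move=> sF; elim: s => [|i s IHs].
  by under eq_fun do rewrite big_nil; exact: smooth_mx_cst.
by under eq_fun do rewrite big_cons; exact: smooth_mxD.
Qed.

Lemma partial_sum (I : Type) (s : seq I) (F : I -> V -> 'M[K]_(m, n)) v x :
  (forall i, smooth_mx (F i)) ->
  partial_mx (fun x => \sum_(i <- s) F i x) v x = \sum_(i <- s) partial_mx (F i) v x.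
Proof.
move=> sF; elim: s => [|i s IHs].
  by under eq_fun do rewrite big_nil; rewrite partial_cst big_nil.
under eq_fun do rewrite big_cons.
by rewrite big_cons partialD// ?IHs//; exact: smooth_mx_sum.
Qed.

Lemma smooth_partial F v : smooth_mx F -> smooth_mx (fun x => partial_mx F v x).
Proof.
move=> sF i j; have [? ?] := sF i j; split.
  by under eq_fun do rewrite re_partial; exact: Cinfty_derive.
by under eq_fun do rewrite im_partial; exact: Cinfty_derive.
Qed.

Lemma partial_comm F v w x : smooth_mx F ->
  partial_mx (fun y => partial_mx F v y) w x =
  partial_mx (fun y => partial_mx F w y) v x.
Proof.
move=> sF; apply/matrixP=> i j; have [? ?] := sF i j.
have Ere u : (fun y => scal_re (partial_mx F u y i j)) =
             (fun y => 'D_u (fun y => scal_re (F y i j)) y).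
  by apply/funext => y; exact: re_partial.
have Eim u : (fun y => scal_im (partial_mx F u y i j)) =
             (fun y => 'D_u (fun y => scal_im (F y i j)) y).
  by apply/funext => y; exact: im_partial.
apply: scal_eqP.
  apply: (etrans (re_partial _ _ _ _ _)); rewrite Ere.
  apply: (etrans _ (esym (re_partial _ _ _ _ _))); rewrite Ere.
  exact: (@derive_comm R V (fun y => scal_re (F y i j)) x v w).
apply: (etrans (im_partial _ _ _ _ _)); rewrite Eim.
apply: (etrans _ (esym (im_partial _ _ _ _ _))); rewrite Eim.
exact: (@derive_comm R V (fun y => scal_im (F y i j)) x v w).
Qed.

End Additive.

Lemma smooth_mx_ctr m n (F : V -> 'M[K]_(m, n)) : smooth_mx F -> smooth_mx (fun x => (F x)^H).
Proof.
move=> sF i j; have [? ?] := sF j i; split.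
  by under eq_fun do rewrite ctrE scal_re_conj.
by under eq_fun do rewrite ctrE scal_im_conj; exact: CinftyN.
Qed.

Lemma partial_ctr m n (F : V -> 'M[K]_(m, n)) v x : smooth_mx F ->
  partial_mx (fun x => (F x)^H) v x = (partial_mx F v x)^H.
Proof.
move=> sF; apply/matrixP=> i j; rewrite [RHS]ctrE; have [? ?] := sF j i.
apply: scal_eqP; rewrite ?scal_re_conj ?scal_im_conj ?re_partial ?im_partial
    ?re_partial ?im_partial.
  by under eq_fun do rewrite /= ctrE scal_re_conj.
under eq_fun do rewrite /= ctrE scal_im_conj.
by rewrite deriveN//; exact: Cinfty_derivable.
Qed.

Lemma smooth_mxM m n p (F : V -> 'M[K]_(m, n)) (G : V -> 'M[K]_(n, p)) :
  smooth_mx F -> smooth_mx G -> smooth_mx (fun x => F x *m G x).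
Proof.
move=> sF sG i j; split.
  under eq_fun do rewrite scal_re_mulmx.
  apply: Cinfty_sum => l; have [? ?] := sF i l; have [? ?] := sG l j.
  by apply: CinftyB; exact: CinftyM.
under eq_fun do rewrite scal_im_mulmx.
apply: Cinfty_sum => l; have [? ?] := sF i l; have [? ?] := sG l j.
by apply: CinftyD; exact: CinftyM.
Qed.

Lemma partialM m n p (F : V -> 'M[K]_(m, n)) (G : V -> 'M[K]_(n, p)) v x :
  smooth_mx F -> smooth_mx G ->
  partial_mx (fun x => F x *m G x) v x =
  partial_mx F v x *m G x + F x *m partial_mx G v x.
Proof.
move=> sF sG; apply/matrixP=> i j.
have reM (a b c d : R) : a - b + (c - d) = a + c - (b + d) by ring.
have imM (a b c d : R) : a + b + (c + d) = a + c + (b + d) by ring.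
have sreM l : Cinfty (fun x => scal_re (F x i l) * scal_re (G x l j)).
  by apply: CinftyM; exact: smooth_mx_re.
have simM l : Cinfty (fun x => scal_im (F x i l) * scal_im (G x l j)).
  by apply: CinftyM; exact: smooth_mx_im.
have sriM l : Cinfty (fun x => scal_re (F x i l) * scal_im (G x l j)).
  by apply: CinftyM; [exact: smooth_mx_re|exact: smooth_mx_im].
have sirM l : Cinfty (fun x => scal_im (F x i l) * scal_re (G x l j)).
  by apply: CinftyM; [exact: smooth_mx_im|exact: smooth_mx_re].
apply: scal_eqP; [rewrite re_partial|rewrite im_partial];
  [under eq_fun do rewrite scal_re_mulmx|under eq_fun do rewrite scal_im_mulmx];
  (rewrite derive_bigsum; last by move=> l; first [exact: CinftyB|exact: CinftyD]);
  rewrite !mxE raddfD /= !raddf_sum -big_split /=; apply: eq_bigr => l _.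
  rewrite deriveB; [|exact: Cinfty_derivable|exact: Cinfty_derivable].
  rewrite !derive_mul; try exact: smooth_mx_re; try exact: smooth_mx_im.
  by rewrite !scal_reM !re_partial !im_partial reM.
rewrite deriveD; [|exact: Cinfty_derivable|exact: Cinfty_derivable].
rewrite !derive_mul; try exact: smooth_mx_re; try exact: smooth_mx_im.
by rewrite !scal_imM !re_partial !im_partial imM.
Qed.

Lemma Cinfty_trR n (F : V -> 'M[K]_n) : smooth_mx F -> Cinfty (fun x => trR (F x)).
Proof.
move=> sF; under eq_fun do rewrite trRE.
by apply: Cinfty_sum => i; exact: smooth_mx_re.
Qed.

Lemma derive_trR n (F : V -> 'M[K]_n) v x : smooth_mx F ->
  'D_v (fun x => trR (F x)) x = trR (partial_mx F v x).
Proof.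
move=> sF; under eq_fun do rewrite trRE.
rewrite derive_bigsum; last by move=> i; exact: smooth_mx_re.
by rewrite trRE; apply: eq_bigr => i _; rewrite re_partial.
Qed.

End OneSpace.

Section Pullback.
Variables (V W : normedModType R) (L : V -> W).
Hypotheses (linL : linear L) (cL : continuous L).
Variables (m n : nat) (F : W -> 'M[K]_(m, n)).

Lemma smooth_mx_pullback : smooth_mx F -> smooth_mx (fun x => F (L x)).
Proof.
move=> sF i j; have [sr si] := sF i j.
by split; [exact: (Cinfty_pullback linL cL sr)|exact: (Cinfty_pullback linL cL si)].
Qed.

Lemma partial_pullback v x :
  partial_mx (fun x => F (L x)) v x = partial_mx F (L v) (L x).
Proof.
apply/matrixP=> i j; apply: scal_eqP; rewrite ?re_partial ?im_partial.
  exact: (derive_pullback linL (fun y => scal_re (F y i j))).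
exact: (derive_pullback linL (fun y => scal_im (F y i j))).
Qed.

End Pullback.

End MatrixCalculus.

(** * Spectral resolution of Hermitian matrices *)

Section UnitaryCalculus.
Variables (R : realType) (k : scalar_kind) (p : nat).
Local Notation K := (scalars R k).
Variables (P : 'M[K]_p) (d : 'rV[R]_p).
Hypothesis uP : P^H *m P = 1%:M.

(** Functional calculus [e(A)] of [A = P^H diag(d) P] in a given eigenbasis. *)
Definition ucalc (e : R -> R) : 'M[K]_p := P^H *m real_diag k (map_mx e d) *m P.

Lemma ucalc_ext e e' : (forall i, e (d 0 i) = e' (d 0 i)) -> ucalc e = ucalc e'.
Proof.
move=> ee; rewrite /ucalc (_ : map_mx e d = map_mx e' d)//.
by apply/rowP => i; rewrite !mxE ee.
Qed.

Lemma ucalc_id : ucalc id = P^H *m real_diag k d *m P.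
Proof. by rewrite /ucalc (_ : map_mx id d = d)//; apply/rowP => i; rewrite mxE. Qed.

Lemma ucalcM e e' : ucalc e *m ucalc e' = ucalc (fun x => e x * e' x).
Proof.
rewrite /ucalc !mulmxA -(mulmxA _ P) (unitaryC uP) mulmx1 -(mulmxA P^H).
rewrite /real_diag mulmx_diag; congr (_ *m diag_mx _ *m _); apply/rowP => i.
by rewrite !mxE rmorphM.
Qed.

Lemma ucalc_ctr e : (ucalc e)^H = ucalc e.
Proof. by rewrite /ucalc !ctrM ctrK ctr_real_diag mulmxA. Qed.

Lemma ucalc1 : ucalc (fun=> 1) = 1%:M.
Proof.
rewrite /ucalc (_ : map_mx _ d = const_mx 1); last by apply/rowP => i; rewrite !mxE.
by rewrite /real_diag map_const_mx rmorph1 diag_const_mx mulmx1.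
Qed.

Lemma ucalcD e e' : ucalc e + ucalc e' = ucalc (fun x => e x + e' x).
Proof.
rewrite /ucalc -mulmxDl -mulmxDr /real_diag -raddfD /=.
by congr (_ *m diag_mx _ *m _); apply/rowP => i; rewrite !mxE raddfD.
Qed.

Lemma ucalcZ c e : scal_real k c *: ucalc e = ucalc (fun x => c * e x).
Proof.
rewrite /ucalc scalemxAl scalemxAr /real_diag -linearZ /=.
by congr (_ *m diag_mx _ *m _); apply/rowP => i; rewrite !mxE rmorphM.
Qed.

Lemma ucalc0 : ucalc (fun=> 0) = 0.
Proof.
rewrite (@ucalc_ext _ (fun x => 0 * 0)); last by move=> i; rewrite mul0r.
by rewrite -(ucalcZ 0 (fun=> 0)) rmorph0 scale0r.
Qed.

End UnitaryCalculus.

Section Spectral.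
Variables (R : realType) (k : scalar_kind).
Local Notation K := (scalars R k).
Local Notation C := (scalars R ComplexScalars).

Lemma hermitian_diagonalization p (A : 'M[C]_p) : A^H = A ->
  exists (P : 'M[C]_p) (d : 'rV[R]_p),
    P^H *m P = 1%:M /\ A = P^H *m real_diag ComplexScalars d *m P.
Proof.
move=> hA; pose B : 'M[(R[i])%C : numClosedFieldType]_p := A.
have hB : B \is hermsymmx.
  by apply/is_hermitianmxP; rewrite expr0 scale1r; exact: (esym hA).
have /orthomx_spectralP EB := hermitian_normalmx hB.
have uP := spectral_unitarymx B; rewrite invmx_unitary// in EB.
have dR := hermitian_spectral_diag_real hB.
exists (spectralmx B), (map_mx (@complex.Re R) (spectral_diag B)).
have ctrP (M : 'M[C]_p) : M^H = map_mx (@Num.conj ((R[i])%C : numClosedFieldType)) M^T.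
  by [].
split.
  apply: mulmx1C; rewrite ctrP.
  by have /unitarymxP := uP.
rewrite ctrP; apply: (etrans EB); congr (_ *m _ *m _).
rewrite /real_diag; congr diag_mx; apply/matrixP=> i j; rewrite !mxE.
by have /mxOverP/(_ i j)/RRe_real <- := dR.
Qed.

(** Complexification for real scalars and the identity for complex ones: the complex spectral
    theorem serves both kinds. *)
Definition scal_embed (z : K) : C := Complex (scal_re z) (scal_im z).

Lemma scal_embed_inj : injective scal_embed.
Proof. by move=> z w [] /scal_eqP; exact. Qed.

Lemma scal_embed_zmod_morphism : zmod_morphism scal_embed.
Proof. by move=> z w; apply: scal_eqP => /=; rewrite raddfB. Qed.

Lemma scal_embed_monoid_morphism : monoid_morphism scal_embed.
Proof.
split; first by apply: scal_eqP => /=; case: (k).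
move=> z w; apply: scal_eqP; first by rewrite scal_reM /= scal_reM.
by rewrite scal_imM /= scal_imM.
Qed.

HB.instance Definition _ :=
  GRing.isZmodMorphism.Build K C scal_embed scal_embed_zmod_morphism.
HB.instance Definition _ :=
  GRing.isMonoidMorphism.Build K C scal_embed scal_embed_monoid_morphism.

Lemma scal_embed_real (a : R) : scal_embed (scal_real k a) = scal_real ComplexScalars a.
Proof. by rewrite /scal_embed scal_re_real scal_im_real. Qed.

Lemma map_embed_ctr m n (A : 'M[K]_(m, n)) :
  map_mx scal_embed A^H = (map_mx scal_embed A)^H.
Proof.
apply/matrixP=> i j; rewrite ctrE !mxE.
by apply: scal_eqP => /=; rewrite ?scal_re_conj ?scal_im_conj.
Qed.

Lemma map_embed_inj m n : injective (fun A : 'M[K]_(m, n) => map_mx scal_embed A).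
Proof.
move=> A B /matrixP AB; apply/matrixP => i j.
by have := AB i j; rewrite !mxE => /scal_embed_inj.
Qed.

Definition resolution p m (Pi : 'I_m -> 'M[K]_p) :=
  [/\ \sum_i Pi i = 1%:M,
      forall i j, Pi i *m Pi j = if i == j then Pi i else 0
    & forall i, (Pi i)^H = Pi i].

(* The spectral projections are Lagrange polynomials in A; hence they descend
   from the complexification of A to A, and commute with its commutant. *)
Lemma spectral_resolution p (A : 'M[K]_p) : A^H = A ->
  exists m (a : 'I_m -> R) (Pi : 'I_m -> 'M[K]_p),
    [/\ resolution Pi, A = \sum_i scal_real k (a i) *: Pi i
      & forall X, X *m A = A *m X -> forall i, X *m Pi i = Pi i *m X].
Proof.
move=> hA; pose AC := map_mx scal_embed A.
have hAC : AC^H = AC by rewrite -map_embed_ctr hA.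
have [P [d [uP EA]]] := hermitian_diagonalization hAC.
(* [J e] is [e(A)] over the complex numbers. Only its algebraic laws are kept; matrices over [K] are
   recognised by their images. *)
pose J := ucalc P d.
have J_ext e e' : (forall i, e (d 0 i) = e' (d 0 i)) -> J e = J e' by exact: ucalc_ext.
have JM e e' : J e *m J e' = J (fun x => e x * e' x) by exact: ucalcM.
have JH e : (J e)^H = J e by exact: ucalc_ctr.
have J1 : J (fun=> 1) = 1%:M by exact: ucalc1.
have JD e e' : J e + J e' = J (fun x => e x + e' x) by exact: ucalcD.
have JZ c e : scal_real ComplexScalars c *: J e = J (fun x => c * e x) by exact: ucalcZ.
have J0 : J (fun=> 0) = 0 by exact: ucalc0.
have EAJ : AC = J id.
  by rewrite EA; exact: (esym (ucalc_id P d)).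
clearbody J.
(* Repeated eigenvalues are merged: interpolation needs distinct nodes, and it is the projection of
   a whole eigenspace that is a polynomial in [A]. *)
pose s := undup [seq d 0 i | i : 'I_p].
have ds i : d 0 i \in s by rewrite mem_undup; apply/mapP; exists i; rewrite ?mem_enum.
have us : uniq s by exact: undup_uniq.
clearbody s.
pose lagr (l : seq R) (a : R) : 'M[K]_p :=
  foldr (fun b M => scal_real k (a - b)^-1 *: (A - (scal_real k b)%:M) *m M) 1%:M l.
have lagrJ l a : map_mx scal_embed (lagr l a) =
    J (fun x => \prod_(b <- l) ((a - b)^-1 * (x - b))).
  elim: l => [|b l IHl] /=.
    by rewrite map_mx1 -J1; apply: J_ext => i; rewrite big_nil.
  rewrite map_mxM IHl map_mxZ map_mxB map_scalar_mx -/AC EAJ /= !scal_embed_real.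
  rewrite -scalemx1 -J1 -scaleNr.
  rewrite (_ : - scal_real ComplexScalars b = scal_real ComplexScalars (- b)).
    by rewrite JZ JD JZ JM; apply: J_ext => i; rewrite big_cons mulr1.
  by rewrite rmorphN.
have lagr_comm X l a : X *m A = A *m X -> X *m lagr l a = lagr l a *m X.
  move=> XA; elim: l => [|b l IHl] /=; first by rewrite mulmx1 mul1mx.
  rewrite mulmxA -(mulmxA _ (lagr l a)) -IHl !mulmxA; congr (_ *m _).
  by rewrite -scalemxAr -scalemxAl mulmxBr mulmxBl XA scalar_mxC.
pose Pi a := lagr [seq b <- s | b != a] a.
have PiJ a : a \in s -> map_mx scal_embed (Pi a) = J (fun x => (x == a)%:R).
  move=> sa; rewrite lagrJ; apply: J_ext => i; rewrite big_filter.
  have [->|da] := eqVneq (d 0 i) a.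
    by rewrite big1 // => b ba; rewrite mulVf // subr_eq0 eq_sym.
  apply/eqP; rewrite prodf_seq_eq0; apply/hasP; exists (d 0 i) => //.
  by rewrite da /= subrr mulr0.
have Pi_comm X a : X *m A = A *m X -> X *m Pi a = Pi a *m X by exact: lagr_comm.
clearbody Pi.
have sz (i : 'I_(size s)) : s`_i \in s by exact: mem_nth.
(* A partition of unity on the spectrum: exactly one node equals the eigenvalue [d 0 i]. *)
have pick_sum (f : R -> R) i :
    \sum_(j < size s) f s`_j * (d 0 i == s`_j)%:R = f (d 0 i).
  have hi : (index (d ord0 i) s < size s)%N by rewrite index_mem.
  rewrite (bigD1 (Ordinal hi)) //= nth_index // eqxx mulr1 big1 ?addr0 // => j ji.
  case: eqP => [E|]; last by rewrite mulr0.
  by case/eqP: ji; apply: val_inj; rewrite /= E index_uniq// undup_uniq.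
have J_sum (f : R -> R) : \sum_(j < size s) scal_real ComplexScalars (f s`_j) *:
     map_mx scal_embed (Pi s`_j) = J f.
  transitivity (\sum_(j < size s) J (fun x => f s`_j * (x == s`_j)%:R)).
    by apply: eq_bigr => j _; rewrite (PiJ _ (sz j)); exact: JZ.
  have -> : J f = J (fun x => \sum_(j < size s) f s`_j * (x == s`_j)%:R).
    by apply: J_ext => i; rewrite pick_sum.
  elim: (index_enum _) => [|j l IHl].
    by rewrite big_nil -J0; apply: J_ext => i; rewrite big_nil.
  by rewrite big_cons IHl JD; apply: J_ext => i; rewrite big_cons.
exists (size s), (fun i => s`_i), (fun i => Pi s`_i); split.
- split.
  + apply: map_embed_inj; rewrite map_mx1 raddf_sum -J1 -J_sum.
    by apply: eq_bigr => i _; rewrite rmorph1 scale1r.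
  + move=> i j; apply: map_embed_inj; rewrite map_mxM !PiJ ?sz// JM.
    have [->|/negPf ij] := eqVneq i j.
      by rewrite PiJ ?sz//; apply: J_ext => t; case: eqP; rewrite ?mulr1 ?mulr0.
    rewrite map_mx0 -J0; apply: J_ext => t.
    case: eqP => [->|]; last by rewrite mul0r.
    by rewrite nth_uniq ?us// [_ == _]ij mulr0.
  + by move=> i; apply: map_embed_inj; rewrite map_embed_ctr PiJ ?sz.
- apply: map_embed_inj; rewrite -/AC EAJ raddf_sum -J_sum.
  by apply: eq_bigr => i _; rewrite [RHS]map_mxZ; congr (_ *: _); rewrite [RHS]scal_embed_real.
- by move=> X XA i; exact: Pi_comm.
Qed.

End Spectral.

Lemma cvg_bigsum (R : realType) (T : Type) (F : set_system T) (I : Type) (s : seq I)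
    (f : I -> T -> R) (l : I -> R) : Filter F ->
  (forall i, f i @ F --> l i) ->
  (fun x => \sum_(i <- s) f i x) @ F --> \sum_(i <- s) l i.
Proof.
move=> FF fl; have -> : (fun x => \sum_(i <- s) f i x) = \sum_(i <- s) f i.
  by apply/funext => x; rewrite fct_sumE.
elim: s => [|i s IHs]; first by rewrite !big_nil; exact: cvg_cst.
by rewrite !big_cons; exact: cvgD.
Qed.

(** * Functional calculus on a resolution and the power series csr, ssr, cos *)

Section ResolutionCalculus.
Variables (R : realType) (k : scalar_kind).
Local Notation K := (scalars R k).

(** Values are attached to the index of a projection and not to an eigenvalue, so that [th i] and
    its square can both parametrise the same projections. *)
Definition rcalc p m (Pi : 'I_m -> 'M[K]_p) (f : 'I_m -> R) : 'M[K]_p :=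
  \sum_i scal_real k (f i) *: Pi i.

Section Rcalc.
Variables (p m : nat) (Pi : 'I_m -> 'M[K]_p).
Hypothesis rPi : resolution Pi.
Implicit Types f g : 'I_m -> R.

Lemma rcalc_ext f g : f =1 g -> rcalc Pi f = rcalc Pi g.
Proof. by move=> fg; apply: eq_bigr => i _; rewrite fg. Qed.

Lemma rcalcM f g : rcalc Pi f *m rcalc Pi g = rcalc Pi (fun i => f i * g i).
Proof.
have [_ PiM _] := rPi.
rewrite /rcalc mulmx_suml; apply: eq_bigr => i _.
rewrite mulmx_sumr (bigD1 i)//= big1 ?addr0; last first.
  move=> j ji; rewrite -scalemxAl -scalemxAr PiM.
  by rewrite eq_sym (negPf ji) !scaler0.
by rewrite -scalemxAl -scalemxAr PiM eqxx scalerA -rmorphM.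
Qed.

Lemma rcalc_ctr f : (rcalc Pi f)^H = rcalc Pi f.
Proof.
by have [_ _ PiH] := rPi; rewrite /rcalc ctr_sum; apply: eq_bigr => i _; rewrite ctrZ PiH.
Qed.

Lemma rcalcD f g : rcalc Pi f + rcalc Pi g = rcalc Pi (fun i => f i + g i).
Proof. by rewrite -big_split; apply: eq_bigr => i _; rewrite raddfD scalerDl. Qed.

Lemma rcalcZ (c : R) f : scal_real k c *: rcalc Pi f = rcalc Pi (fun i => c * f i).
Proof. by rewrite scaler_sumr; apply: eq_bigr => i _; rewrite scalerA -rmorphM. Qed.

Lemma rcalc1 : rcalc Pi (fun=> 1) = 1%:M.
Proof.
by have [<- _ _] := rPi; apply: eq_bigr => i _; rewrite rmorph1 scale1r.
Qed.

Lemma rcalc0 : rcalc Pi (fun=> 0) = 0.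
Proof. by apply: big1 => i _; rewrite rmorph0 scale0r. Qed.

Lemma rcalcX f l : rcalc Pi f ^+ l = rcalc Pi (fun i => f i ^+ l).
Proof.
elim: l => [|l IHl]; first by rewrite expr0; exact: (esym rcalc1).
by rewrite exprS IHl -mulmxE rcalcM; apply: rcalc_ext => i; rewrite exprS.
Qed.

Lemma rcalc_psd f : (forall i, 0 <= f i) -> psdmx (rcalc Pi f).
Proof.
move=> f0; split; first exact: rcalc_ctr.
move=> x; pose T := rcalc Pi (fun i => Num.sqrt (f i)).
rewrite (_ : rcalc Pi f = T^H *m T); last first.
  by rewrite rcalc_ctr rcalcM; apply: rcalc_ext => i; rewrite -expr2 sqr_sqrtr.
rewrite mulmxA -ctrM -mulmxA mxE; apply: sumr_ge0 => i _.
by rewrite ctrE; exact: scal_gram_ge0.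
Qed.

(** Partial sums of a power series in [rcalc Pi a] are again of the form [rcalc], so only scalar
    convergence at each [a i] is at stake; the limit is then read off entrywise, in real and
    imaginary parts, as [mx_lim] prescribes. *)
Lemma rcalc_pseries (c : nat -> R) (a f : 'I_m -> R) :
  (forall i, series (fun l => c l * a i ^+ l) @ \oo --> f i) ->
  mx_pseries c (rcalc Pi a) = rcalc Pi f.
Proof.
move=> cf.
have E N : \sum_(0 <= l < N) scal_real k (c l) *: rcalc Pi a ^+ l =
    rcalc Pi (fun i => series (fun l => c l * a i ^+ l) N).
  elim: N => [|N IHN].
    by rewrite big_geq// -rcalc0; apply: rcalc_ext => i; rewrite /series /= big_geq.
  rewrite big_nat_recr//= IHN rcalcX rcalcZ rcalcD; apply: rcalc_ext => i.
  by rewrite /series /= big_nat_recr.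
have cvg_entry (phi : {additive K -> R}) x y :
    (forall (b : R) z, phi (scal_real k b * z) = b * phi z) ->
    phi ((\sum_(0 <= l < N) scal_real k (c l) *: rcalc Pi a ^+ l) x y) @[N --> \oo]
      --> phi (rcalc Pi f x y).
  move=> phiZ.
  have phiE g : phi (rcalc Pi g x y) = \sum_i g i * phi (Pi i x y).
    by rewrite /rcalc summxE raddf_sum; apply: eq_bigr => i _; rewrite mxE phiZ.
  rewrite phiE; under eq_fun do rewrite E phiE.
  apply: cvg_bigsum => i; apply: cvgMr_tmp; exact: cf.
apply/matrixP=> x y; rewrite mxE -[RHS]scal_ofK; congr scal_of.
  by apply/cvg_lim => //; apply: cvg_entry => b z; exact: scal_reZ.
by apply/cvg_lim => //; apply: cvg_entry => b z; exact: scal_imZ.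
Qed.

(** The value at 0 makes [sinc x] the value of ssr at [x ^ 2] for every real [x]. *)
Definition sinc (x : R) : R := if x == 0 then 1 else sin x / x.

Lemma mxcsr_rcalc (th : 'I_m -> R) :
  mxcsr (rcalc Pi (fun i => th i ^+ 2)) = rcalc Pi (fun i => cos (th i)).
Proof. by apply: rcalc_pseries => i; exact: csr_sqr. Qed.

Lemma mxcos_rcalc (th : 'I_m -> R) :
  mxcos (rcalc Pi th) = rcalc Pi (fun i => cos (th i)).
Proof.
apply: rcalc_pseries => i.
rewrite [X in series X](_ : _ = cos_coeff (th i)).
  by rewrite unlock; exact: is_cvg_series_cos_coeff.
apply/funext => l; rewrite /cos_coeff /=.
by rewrite expr1n mulr1 mulrAC.
Qed.

Lemma mxssr_rcalc (th : 'I_m -> R) :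
  mxssr (rcalc Pi (fun i => th i ^+ 2)) = rcalc Pi (fun i => sinc (th i)).
Proof.
apply: rcalc_pseries => i; rewrite /sinc; case: eqVneq => [->|th0].
  (* At 0 only the term of index 0 survives, and a partial sum contains it once [N] is positive. *)
  apply/cvgrPdist_lt => e e0; near=> N.
  have N0 : (0 < N)%N by near: N; exact: nbhs_infty_gt.
  rewrite /series /= big_ltn// big_nat_cond big1 => [|l /andP[/andP[l0 _] _]].
    rewrite /ssr_coeff !expr0 (_ : ((0.*2).+1)`! = 1%N)// divr1 mulr1 addr0.
    by rewrite subrr normr0.
  by rewrite expr0n/= expr0n gtn_eqF// mulr0.
have -> : series (fun l => ssr_coeff R l * (th i ^+ 2) ^+ l) = fun N =>
    series (fun l => ssr_coeff R l * (th i ^+ 2) ^+ l * th i) N * (th i)^-1.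
  apply/funext => N; rewrite /series /= mulr_suml.
  by apply: eq_bigr => l _; rewrite mulfK.
by apply: cvgMr_tmp; exact: ssr_sqr.
Unshelve. all: by end_near. Qed.

End Rcalc.

(** One rank-one projection for each eigenvector, with possibly repeated eigenvalues. This carries
    the power series results over to matrices that come already diagonalised, as from an SVD. *)
Lemma ucalc_resolution p (P : 'M[K]_p) (d : 'rV[R]_p) : P^H *m P = 1%:M ->
  exists Pi : 'I_p -> 'M[K]_p, resolution Pi /\
    forall f, ucalc P d f = rcalc Pi (fun i => f (d ord0 i)).
Proof.
move=> uP; have uP' := unitaryC uP.
have deltaH i : (delta_mx i i : 'M[K]_p)^H = delta_mx i i.
  apply/matrixP=> x y; rewrite ctrE !mxE andbC.
  by case: (_ && _); [exact: rmorph1|exact: rmorph0].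
have sumE (f : 'I_p -> R) : \sum_i scal_real k (f i) *: delta_mx i i =
    diag_mx (\row_i scal_real k (f i)).
  apply/matrixP=> x y; rewrite summxE !mxE.
  under eq_bigr do rewrite !mxE.
  rewrite (bigD1 x)//= big1 ?addr0 => [|i ix].
    by rewrite eqxx /= eq_sym; case: eqP => _; rewrite ?mulr1 ?mulr0.
  by rewrite eq_sym (negPf ix) mulr0.
have rE f : rcalc (fun i => P^H *m delta_mx i i *m P) f =
    P^H *m diag_mx (\row_i scal_real k (f i)) *m P.
  rewrite -sumE mulmx_sumr mulmx_suml; apply: eq_bigr => i _.
  by rewrite -scalemxAr -scalemxAl.
exists (fun i => P^H *m delta_mx i i *m P); split; last first.
  by move=> f; rewrite rE /ucalc; congr (_ *m diag_mx _ *m _); apply/rowP => i; rewrite !mxE.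
split.
- have := rE (fun=> 1); rewrite /rcalc; under eq_bigr do rewrite rmorph1 scale1r.
  move=> ->; rewrite (_ : \row_i _ = const_mx 1); last first.
    by apply/rowP => i; rewrite !mxE rmorph1.
  by rewrite diag_const_mx mulmx1.
- move=> i j; rewrite !mulmxA -(mulmxA _ P) uP' mulmx1 -(mulmxA P^H) mul_delta_mx_cond.
  by case: eqP => [->|_]; rewrite ?mulr1n// mulr0n mulmx0 mul0mx.
- by move=> i; rewrite !ctrM ctrK deltaH mulmxA.
Qed.

(** The [th i] are singular values of [eta]. The commutation clause makes the flows built from these
    projections commute with their generator. *)
Lemma gram_resolution n p (eta : 'M[K]_(n, p)) :
  exists m (th : 'I_m -> R) (Pi : 'I_m -> 'M[K]_p),
    [/\ resolution Pi, forall i, 0 <= th i,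
        eta^H *m eta = rcalc Pi (fun i => th i ^+ 2)
      & forall X, X *m (eta^H *m eta) = (eta^H *m eta) *m X ->
        forall f, X *m rcalc Pi f = rcalc Pi f *m X].
Proof.
have hA : (eta^H *m eta)^H = eta^H *m eta by rewrite ctrM ctrK.
have [m [a [Pi [rPi EA PiC]]]] := spectral_resolution hA.
have [_ PiM PiH] := rPi.
exists m, (fun i => Num.sqrt (a i)), Pi; split=> //.
- rewrite {1}EA; apply: eq_bigr => i _.
  have [a0|a0] := leP 0 (a i); first by rewrite sqr_sqrtr.
  (* A negative [a i] belongs to a zero projection: [a i] times the trace of [Pi i] is the squared
     norm of [eta Pi i], and both this norm and the trace are nonnegative. *)
  suff -> : Pi i = 0 by rewrite !scaler0.
  apply: trR_gram_eq0; apply/eqP; rewrite eq_le trR_gram_ge0 andbT.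
  have : 0 <= trR ((eta *m Pi i)^H *m (eta *m Pi i)) by exact: trR_gram_ge0.
  rewrite ctrM mulmxA -(mulmxA (Pi i)^H) EA PiH.
  rewrite -/(rcalc Pi a).
  have -> : Pi i *m rcalc Pi a = scal_real k (a i) *: Pi i.
    rewrite mulmx_sumr (bigD1 i)//= big1 ?addr0; last first.
      by move=> j ji; rewrite -scalemxAr PiM eq_sym (negPf ji) scaler0.
    by rewrite -scalemxAr PiM eqxx.
  by rewrite -scalemxAl trRZ nmulr_rge0.
- move=> X XA f; rewrite /rcalc mulmx_sumr mulmx_suml; apply: eq_bigr => i _.
  by rewrite -scalemxAl -scalemxAr PiC.
Qed.

(** Cosine is even: an eigenvalue [b j] of a Hermitian square root, whatever its sign, has
    [cos (b j)] equal to csr at [b j ^ 2]. The root [rcalc Pi th] shows that [mxsqrt] does not fall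
    back on its default value 0. *)
Lemma mxcos_sqrt_gram n p (eta : 'M[K]_(n, p)) :
  mxcos (mxsqrt (eta^H *m eta)) = mxcsr (eta^H *m eta).
Proof.
have [m [th [Pi [rPi th0 EA _]]]] := gram_resolution eta.
have [[SH _] SS] : psdmx (mxsqrt (eta^H *m eta)) /\
    mxsqrt (eta^H *m eta) *m mxsqrt (eta^H *m eta) = eta^H *m eta.
  apply: (@xgetPex _ 0 [set S | psdmx S /\ S *m S = eta^H *m eta]).
  exists (rcalc Pi th); split; first exact: rcalc_psd.
  by rewrite rcalcM// EA; apply: rcalc_ext => i; rewrite expr2.
move: (mxsqrt _) SH SS => S SH <-.
have [q [b [Rho [rRho ES _]]]] := spectral_resolution SH.
have {ES} -> : S = rcalc Rho b by exact: ES.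
rewrite (rcalcM rRho) (mxcos_rcalc rRho b) -(mxcsr_rcalc rRho).
by congr mxcsr; apply: rcalc_ext => i; rewrite expr2.
Qed.

End ResolutionCalculus.

(** * One-parameter unitary groups and horizontal Stiefel geodesics *)

Section Flows.
Variables (R : realType) (k : scalar_kind).
Local Notation K := (scalars R k).

Section VelRules.
Variables (m n : nat).
Implicit Types F G : R -> 'M[K]_(m, n).

Lemma velD F G t : smooth_mx (F : R^o -> _) -> smooth_mx (G : R^o -> _) ->
  vel (fun t => F t + G t) t = vel F t + vel G t.
Proof. exact: partialD. Qed.

Lemma velB F G t : smooth_mx (F : R^o -> _) -> smooth_mx (G : R^o -> _) ->
  vel (fun t => F t - G t) t = vel F t - vel G t.
Proof. exact: partialB. Qed.

Lemma vel_cst (A : 'M[K]_(m, n)) t : vel (fun _ => A) t = 0.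
Proof. exact: partial_cst. Qed.

Lemma smooth_vel F : smooth_mx (F : R^o -> _) -> smooth_mx ((vel F) : R^o -> _).
Proof. exact: smooth_partial. Qed.

End VelRules.

Lemma velM m n p (F : R -> 'M[K]_(m, n)) (G : R -> 'M[K]_(n, p)) t :
  smooth_mx (F : R^o -> _) -> smooth_mx (G : R^o -> _) ->
  vel (fun t => F t *m G t) t = vel F t *m G t + F t *m vel G t.
Proof. exact: partialM. Qed.

Lemma vel_ctr m n (F : R -> 'M[K]_(m, n)) t : smooth_mx (F : R^o -> _) ->
  vel (fun t => (F t)^H) t = (vel F t)^H.
Proof. exact: partial_ctr. Qed.

Lemma velMl m n p (A : 'M[K]_(m, n)) (G : R -> 'M[K]_(n, p)) t :
  smooth_mx (G : R^o -> _) -> vel (fun t => A *m G t) t = A *m vel G t.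
Proof.
by move=> sG; rewrite velM ?vel_cst ?mul0mx ?add0r//; exact: smooth_mx_cst.
Qed.

Lemma velMr m n p (F : R -> 'M[K]_(m, n)) (A : 'M[K]_(n, p)) t :
  smooth_mx (F : R^o -> _) -> vel (fun t => F t *m A) t = vel F t *m A.
Proof.
by move=> sF; rewrite velM ?vel_cst ?mulmx0 ?addr0//; exact: smooth_mx_cst.
Qed.

Lemma smooth_rcalc p m (Pi : 'I_m -> 'M[K]_p) (f : 'I_m -> R -> R) :
  (forall i, Cinfty (f i : R^o -> R)) ->
  smooth_mx ((fun t => rcalc Pi (f^~ t)) : R^o -> _).
Proof.
move=> sf; apply: (@smooth_mx_sum R k R^o p p _ _ (fun i t => scal_real k (f i t) *: Pi i)).
by move=> i; apply: smooth_mxZ => //; exact: smooth_mx_cst.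
Qed.

Lemma vel_rcalc p m (Pi : 'I_m -> 'M[K]_p) (f : 'I_m -> R -> R) t :
  (forall i, Cinfty (f i : R^o -> R)) ->
  vel (fun t => rcalc Pi (f^~ t)) t = rcalc Pi (fun i => 'D_1 (f i : R^o -> R) t).
Proof.
move=> sf; rewrite /vel.
rewrite (@partial_sum R k R^o p p _ _ (fun i t => scal_real k (f i t) *: Pi i)).
  apply: eq_bigr => i _; rewrite partialZ//; last exact: smooth_mx_cst.
  by rewrite partial_cst scaler0 addr0.
by move=> i; apply: smooth_mxZ => //; exact: smooth_mx_cst.
Qed.

(** [sin (a t) / a], extended to [a = 0] by its limit: the time derivative is [cos (a t)] in all
    cases, and [sint a 1 = sinc a]. *)
Definition sint (a t : R) : R := if a == 0 then t else sin (a * t) / a.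

Lemma Cinfty_cost (a : R) : Cinfty ((fun t => cos (a * t)) : R^o -> R).
Proof. by apply: Cinfty_scale; have [] := Cinfty_sin_cos R. Qed.

Lemma Cinfty_sint (a : R) : Cinfty ((sint a) : R^o -> R).
Proof.
rewrite /sint; case: eqP => _; first exact: Cinfty_id.
apply: CinftyM; last exact: Cinfty_cst.
by apply: Cinfty_scale; have [] := Cinfty_sin_cos R.
Qed.

Lemma derive_cost (a t : R) :
  'D_1 ((fun t => cos (a * t)) : R^o -> R) t = - (a ^+ 2 * sint a t).
Proof.
have := derive_scale a (is_derive_cos (a * t)) => -[_].
have -> : 'D_1 ((fun t => cos (a * t)) : R^o -> R) t = 'D_a (cos : R^o -> R) (a * t).
  have := @derive_pullback R R^o R^o (fun t => a * t) _ (@cos R) t 1.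
  rewrite mulr1; apply; by move=> c x y; rewrite mulrDr mulrCA.
move=> ->; rewrite /sint; case: eqP => [->|/eqP a0]; first by rewrite expr0n !mul0r oppr0.
by rewrite mulrN expr2 -mulrA [_ / a]mulrC mulVKf.
Qed.

Lemma derive_sint (a t : R) : 'D_1 ((sint a) : R^o -> R) t = cos (a * t).
Proof.
rewrite /sint; case: eqP => [->|/eqP a0].
  by rewrite derive_id mul0r cos0.
have ss : Cinfty ((fun t => sin (a * t)) : R^o -> R).
  by apply: Cinfty_scale; have [] := Cinfty_sin_cos R.
rewrite (derive_mul _ _ ss (@Cinfty_cst _ _ _)) derive_cst mulr0 addr0.
have -> : 'D_1 ((fun t => sin (a * t)) : R^o -> R) t = 'D_a (sin : R^o -> R) (a * t).
  have := @derive_pullback R R^o R^o (fun t => a * t) _ (@sin R) t 1.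
  rewrite mulr1; apply; by move=> c x y; rewrite mulrDr mulrCA.
by have [_ ->] := derive_scale a (is_derive_sin (a * t)); rewrite mulrAC divff ?mul1r.
Qed.

(* C t and S t are cos (t A^(1/2)) and A^(-1/2) sin (t A^(1/2)). *)
Record gram_flow p (A : 'M[K]_p) (C S : R -> 'M[K]_p) : Prop := GramFlow {
  flow_smoothC : smooth_mx (C : R^o -> _);
  flow_smoothS : smooth_mx (S : R^o -> _);
  flow_C0 : C 0 = 1%:M;
  flow_S0 : S 0 = 0;
  flow_velC : forall t, vel C t = - (A *m S t);
  flow_velS : forall t, vel S t = C t;
  flow_ctrC : forall t, (C t)^H = C t;
  flow_ctrS : forall t, (S t)^H = S t;
  flow_comm : forall t, S t *m C t = C t *m S t;
  flow_commC : forall X, X *m A = A *m X -> forall t, X *m C t = C t *m X;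
  flow_commS : forall X, X *m A = A *m X -> forall t, X *m S t = S t *m X;
  flow_pythagoras : forall t, C t *m C t + A *m S t *m S t = 1%:M;
  flow_C1 : C 1 = mxcsr A;
  flow_S1 : S 1 = mxssr A }.

Lemma gram_flow_exists n p (eta : 'M[K]_(n, p)) :
  exists C S, gram_flow (eta^H *m eta) C S.
Proof.
have [m [th [Pi [rPi th0 EA PiC]]]] := gram_resolution eta.
have sC i : Cinfty ((fun t => cos (th i * t)) : R^o -> R) by exact: Cinfty_cost.
have sS i : Cinfty ((sint (th i)) : R^o -> R) by exact: Cinfty_sint.
exists (fun t => rcalc Pi (fun i => cos (th i * t))).
exists (fun t => rcalc Pi (fun i => sint (th i) t)); split.
- exact: smooth_rcalc.
- exact: smooth_rcalc.
- by rewrite -(rcalc1 rPi); apply: rcalc_ext => i; rewrite mulr0 cos0.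
- rewrite -(rcalc0 Pi); apply: rcalc_ext => i.
  by rewrite /sint mulr0 sin0 mul0r if_same.
- move=> t; rewrite (@vel_rcalc _ _ Pi (fun i t => cos (th i * t)))// EA rcalcM//.
  rewrite -[RHS]scaleN1r -(rmorphN1 (@scal_real R k)) rcalcZ; apply: rcalc_ext => i.
  by rewrite derive_cost mulN1r.
- move=> t; rewrite (@vel_rcalc _ _ Pi (fun i => sint (th i)))//; apply: rcalc_ext => i.
  exact: derive_sint.
- by move=> t; exact: rcalc_ctr.
- by move=> t; exact: rcalc_ctr.
- by move=> t; rewrite !rcalcM//; apply: rcalc_ext => i; rewrite mulrC.
- by move=> X XA t; exact: PiC.
- by move=> X XA t; exact: PiC.
- move=> t; rewrite EA !rcalcM// rcalcD -(rcalc1 rPi); apply: rcalc_ext => i.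
  rewrite -expr2 -mulrA -expr2 -exprMn /sint.
  case: eqP => [->|/eqP a0]; first by rewrite !mul0r cos0 expr1n expr0n addr0.
  by rewrite mulrCA divff// mulr1 cos2Dsin2.
- by rewrite EA mxcsr_rcalc//; apply: rcalc_ext => i; rewrite mulr1.
- by rewrite EA mxssr_rcalc//; apply: rcalc_ext => i; rewrite /sint /sinc mulr1.
Qed.

(** With [A = X^H X = - X^2], the exponential of [t X] is [cos (t A^(1/2)) + X A^(-1/2) sin (t
    A^(1/2))]: one-parameter unitary groups come from the same functional calculus as the
    geodesics. *)
Lemma unitary_flow p (X : 'M[K]_p) : X^H = - X ->
  exists Q : R -> 'M[K]_p, [/\ smooth_mx (Q : R^o -> _),
    forall t, (Q t)^H *m Q t = 1%:M, Q 0 = 1%:M & forall t, vel Q t = X *m Q t].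
Proof.
move=> hX; have [C [S []]] := gram_flow_exists X.
set A := X^H *m X => sC sS C0 S0 vC vS hC hS CS XC XS CS1 _ _.
have XA : X *m A = A *m X by rewrite /A hX !mulNmx mulmxN mulmxA.
have AS t : A *m S t = S t *m A by exact: XS.
exists (fun t => C t + X *m S t); split.
- by apply: smooth_mxD => //; apply: smooth_mxM => //; exact: smooth_mx_cst.
- move=> t; have {}XS : X *m S t = S t *m X by exact: XS.
  have {}XC : X *m C t = C t *m X by exact: XC.
  have e1 : S t *m X *m C t = C t *m (X *m S t).
    by rewrite -XS -mulmxA CS !mulmxA XC.
  have e2 : S t *m X *m (X *m S t) = - (A *m S t *m S t).
    rewrite -XS -mulmxA [S t *m (X *m S t)]mulmxA -XS !mulmxA /A hX.
    by rewrite !mulNmx opprK.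
  rewrite ctrD ctrM hX hC hS mulmxN mulmxDr !mulmxDl !mulNmx e1 e2 opprK.
  by rewrite -(CS1 t) -addrA; congr (_ + _); rewrite addKr.
- by rewrite C0 S0 mulmx0 addr0.
- move=> t; rewrite velD//; last by apply: smooth_mxM => //; exact: smooth_mx_cst.
  rewrite velMl// vC vS mulmxDr addrC /A hX.
  by rewrite !mulNmx opprK mulmxA.
Qed.

(** All that is used later about the explicit curve: [hg_acc] feeds the first variation, [hg_ode]
    the uniqueness argument, where its constant matrix is the momentum, and [hg_speed] the
    length. *)
Record horizontal_geodesic n p (Y eta : 'M[K]_(n, p)) (E : R -> 'M[K]_(n, p)) :
    Prop := HorizontalGeodesic {
  hg_smooth : smooth_curve E;
  hg_0 : E 0 = Y;
  hg_vel0 : vel E 0 = eta;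
  hg_hor : forall t, (E t)^H *m vel E t = 0;
  hg_ode : forall t, vel E t = (eta *m Y^H - Y *m eta^H) *m E t;
  hg_speed : forall t, (vel E t)^H *m vel E t = eta^H *m eta;
  hg_acc : forall t, vel (vel E) t = - (E t *m (eta^H *m eta));
  hg_1 : E 1 = Y *m mxcsr (eta^H *m eta) + eta *m mxssr (eta^H *m eta) }.

Lemma horizontal_geodesic_exists n p (Y eta : 'M[K]_(n, p)) :
  stiefel Y -> horizontal Y eta -> exists E, horizontal_geodesic Y eta E.
Proof.
rewrite /stiefel /horizontal => YY Yeta.
have etaY : eta^H *m Y = 0 by rewrite -[LHS]ctrK ctrM ctrK Yeta ctr0.
have [C [S []]] := gram_flow_exists eta.
set A := eta^H *m eta => sC sS C0 S0 vC vS hC hS CS AC AS CS1 C1 S1.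
have {}AC t : A *m C t = C t *m A by exact: AC.
have {}AS t : A *m S t = S t *m A by exact: AS.
have hA : A^H = A by rewrite /A ctrM ctrK.
have EA : eta^H *m eta = A by [].
clearbody A.
pose E t := Y *m C t + eta *m S t.
have sYC : smooth_mx ((fun t => Y *m C t) : R^o -> _).
  by apply: smooth_mxM => //; exact: smooth_mx_cst.
have seS : smooth_mx ((fun t => eta *m S t) : R^o -> _).
  by apply: smooth_mxM => //; exact: smooth_mx_cst.
have sAS : smooth_mx ((fun t => A *m S t) : R^o -> _).
  by apply: smooth_mxM => //; exact: smooth_mx_cst.
have vE t : vel E t = eta *m C t - Y *m (A *m S t).
  by rewrite velD// !velMl// vC vS mulmxN addrC.
have EH t : (E t)^H = C t *m Y^H + S t *m eta^H by rewrite ctrD !ctrM hC hS.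
have vEH t : (vel E t)^H = C t *m eta^H - A *m S t *m Y^H.
  by rewrite vE ctrB (ctrM eta) (ctrM Y) (ctrM A) hA hC hS -AS.
have E1 t : Y^H *m E t = C t.
  by rewrite mulmxDr !mulmxA YY Yeta mul1mx mul0mx addr0.
have E2 t : eta^H *m E t = A *m S t.
  by rewrite mulmxDr !mulmxA etaY mul0mx add0r EA.
have E3 t : Y^H *m vel E t = - (A *m S t).
  by rewrite vE mulmxBr !mulmxA YY Yeta mul1mx mul0mx add0r.
have E4 t : eta^H *m vel E t = A *m C t.
  by rewrite vE mulmxBr !mulmxA etaY !mul0mx subr0 EA.
exists E; split.
- split; last exact: smooth_mxD.
  move=> t; rewrite /stiefel EH mulmxDl -!mulmxA E1 E2 -(CS1 t); congr (_ + _).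
  by rewrite mulmxA -AS.
- by rewrite /E C0 S0 mulmx1 mulmx0 addr0.
- by rewrite vE C0 S0 mulmx1 !mulmx0 subr0.
- move=> t; rewrite EH mulmxDl -!mulmxA E3 E4 mulmxN AC AS.
  by rewrite !mulmxA CS addNr.
- by move=> t; rewrite mulmxBl -!mulmxA E1 E2 vE.
- move=> t; rewrite EA vEH mulmxBl -!mulmxA E3 E4 !mulmxN opprK.
  rewrite -[RHS]mulmx1 -(CS1 t) mulmxDr. congr (_ + _); first by rewrite !mulmxA AC.
  by rewrite !mulmxA -(mulmxA A (S t) A) -AS !mulmxA.
- move=> t; have -> : vel E = fun t => eta *m C t - Y *m (A *m S t).
    by apply/funext => u; exact: vE.
  rewrite velB//; last first.
  + by apply: smooth_mxM => //; exact: smooth_mx_cst.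
  + by apply: smooth_mxM => //; exact: smooth_mx_cst.
  rewrite !velMl// vC vS mulmxN -opprD; congr (- _).
  by rewrite EA /E mulmxDl addrC -!mulmxA AC AS.
- by rewrite EA /E C1 S1.
Qed.

End Flows.

(** * First variation: horizontal curves are geodesics *)

Section Metrics.
Variables (R : realType) (k : scalar_kind) (n p : nat).
Local Notation K := (scalars R k).
Local Notation M := 'M[K]_(n, p).
Implicit Types (Y w : M) (U B : 'M[K]_p).

Lemma st_metricE a0 a1 Y w1 w2 : st_metric a0 a1 Y w1 w2 =
  a0 * trR (w1^H *m w2) + (a1 - a0) * trR ((Y^H *m w1)^H *m (Y^H *m w2)).
Proof.
rewrite /st_metric /metric_op mulmxDr trRD -!scalemxAr !trRZ; congr (_ + _ * trR _).
by rewrite ctrM ctrK !mulmxA.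
Qed.

Lemma hor_part_horizontal Y w : stiefel Y -> Y^H *m hor_part Y w = 0.
Proof.
by rewrite /hor_part => YY; rewrite mulmxBr [_ *m (Y *m _)]mulmxA YY mul1mx subrr.
Qed.

Lemma hor_part_id Y w : horizontal Y w -> hor_part Y w = w.
Proof. by rewrite /hor_part => ->; rewrite mulmx0 subr0. Qed.

Lemma horizontal_ctr Y w : horizontal Y w -> w^H *m Y = 0.
Proof. by move=> h; rewrite -[LHS]ctrK ctrM ctrK h ctr0. Qed.

Lemma gr_metricE a0 a1 Y w1 w2 : stiefel Y ->
  gr_metric a0 a1 Y w1 w2 = a0 * trR ((hor_part Y w1)^H *m hor_part Y w2).
Proof.
move=> YY; rewrite /gr_metric st_metricE (hor_part_horizontal w1 YY) ctr0 mul0mx trR0.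
by rewrite mulr0 addr0.
Qed.

(** [hor_part Y] is the orthogonal projection [1 - Y Y^H], so its Gram form is
    [w1^H w2 - w1^H Y Y^H w2], the Stiefel expression with second parameter 0. *)
Lemma gr_metric_degenerate a0 a1 Y w1 w2 : stiefel Y ->
  gr_metric a0 a1 Y w1 w2 = st_metric a0 0 Y w1 w2.
Proof.
move=> YY; rewrite gr_metricE// st_metricE sub0r mulNr -mulrBr -trRB; congr (_ * trR _).
have hY := horizontal_ctr (hor_part_horizontal w1 YY).
rewrite [X in _ *m X]/hor_part mulmxBr [_ *m (Y *m _)]mulmxA hY mul0mx subr0.
by rewrite /hor_part ctrB mulmxBl !ctrM ctrK !mulmxA.
Qed.

Lemma stiefelM Y U : stiefel Y -> unitaryK U -> stiefel (Y *m U).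
Proof.
by rewrite /stiefel /unitaryK => YY UU; rewrite ctrM mulmxA -(mulmxA U^H) YY mulmx1.
Qed.

Lemma hor_partM Y U B w : stiefel Y -> unitaryK U ->
  hor_part (Y *m U) (w *m U + Y *m B) = hor_part Y w *m U.
Proof.
move=> YY UU; have UU' : U *m U^H = 1%:M := unitaryC UU.
rewrite /hor_part ctrM !mulmxA -(mulmxA Y U) UU' mulmx1 mulmxDr.
rewrite mulmxBl !mulmxA -(mulmxA Y Y^H Y) YY mulmx1 -!mulmxA.
by rewrite opprD addrACA subrr addr0.
Qed.

Lemma gr_metric_invariant a0 a1 Y U B1 B2 w1 w2 : stiefel Y -> unitaryK U ->
  gr_metric a0 a1 (Y *m U) (w1 *m U + Y *m B1) (w2 *m U + Y *m B2) =
  gr_metric a0 a1 Y w1 w2.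
Proof.
move=> YY UU; rewrite !gr_metricE//; last exact: stiefelM.
rewrite !hor_partM// ctrM -mulmxA trR_mulC -!mulmxA (unitaryC UU) mulmx1.
by [].
Qed.

Lemma orbit_mx_self Y : orbit_mx Y Y.
Proof. by exists 1%:M; rewrite ?mulmx1// /unitaryK /= ctr1 mulmx1. Qed.

Lemma orbit_mxP Y Z : orbit_mx Y = orbit_mx Z ->
  exists2 U, unitaryK U & Z = Y *m U.
Proof.
by move=> YZ; have := orbit_mx_self Z; rewrite -YZ => -[U UU <-]; exists U.
Qed.

Lemma orbit_mxM Y U : unitaryK U -> orbit_mx (Y *m U) = orbit_mx Y.
Proof.
move=> UU; apply/seteqP; split=> _ [V VV <-].
  by exists (U *m V); [exact: unitaryM|rewrite mulmxA].
have UU' : U *m U^H = 1%:M := unitaryC UU.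
exists (U^H *m V); last by rewrite mulmxA -(mulmxA Y) UU' mulmx1.
by apply: unitaryM => //; rewrite ctrK.
Qed.

End Metrics.

Section FirstVariation.
Variables (R : realType) (k : scalar_kind) (n p : nat) (a0 : R).
Local Notation K := (scalars R k).
Local Notation M := 'M[K]_(n, p).
Implicit Types (F : R^o * R^o -> M) (E : R -> M).

Lemma linear_snd0 : linear (fun t : R^o => (0, t) : R^o * R^o).
Proof. by move=> c x y; apply: injective_projections => /=; rewrite ?scaler0 ?addr0. Qed.

Lemma continuous_snd0 : continuous (fun t : R^o => (0, t) : R^o * R^o).
Proof.
move=> t; apply: (@cvg_pair _ _ _ (nbhs t) (nbhs (0 : R^o)) (nbhs t) _ _ _ (fun=> 0) id).
  exact: cvg_cst.
exact: cvg_id.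
Qed.

Lemma vel_snd0 m q (H : R^o * R^o -> 'M[K]_(m, q)) t :
  vel (fun u => H (0, u)) t = partial_mx H (0, 1) (0, t).
Proof. exact: (partial_pullback linear_snd0). Qed.

Lemma smooth_snd0 m q (H : R^o * R^o -> 'M[K]_(m, q)) :
  smooth_mx H -> smooth_mx ((fun u => H (0, u)) : R^o -> _).
Proof. exact: (smooth_mx_pullback linear_snd0 continuous_snd0). Qed.

Lemma derive1_t (f : R^o * R^o -> R) t : Cinfty f ->
  derive1 (fun u : R => f (0, u)) t = 'D_(0, 1) f (0, t).
Proof. by move=> sf; rewrite derive1E; exact: (derive_pullback linear_snd0). Qed.

Lemma derive1_s (f : R^o * R^o -> R) t : Cinfty f ->
  derive1 (fun s : R => f (s, t)) 0 = 'D_(1, 0) f (0, t).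
Proof.
move=> sf; have [_] := is_derive_line ((0, t) : R^o * R^o) (1, 0) sf 0.
rewrite scale0r addr0 => <-; rewrite derive1E.
have -> : (fun s : R => f (s, t)) =
    (fun s : R^o => f (((0, t) : R^o * R^o) + s *: (1, 0))).
  apply/funext => s; congr f; apply: injective_projections => /=.
    by rewrite add0r; exact: (esym (mulr1 s)).
  by rewrite scaler0 addr0.
by [].
Qed.

Lemma smooth_st_metric (V : normedModType R) a1 (Y w1 w2 : V -> M) :
  smooth_mx Y -> smooth_mx w1 -> smooth_mx w2 ->
  Cinfty (fun z => st_metric a0 a1 (Y z) (w1 z) (w2 z)).
Proof.
move=> sY s1 s2; under eq_fun do rewrite st_metricE.
have sYH := smooth_mx_ctr sY.
by apply: CinftyD; (apply: CinftyM; first exact: Cinfty_cst); apply: Cinfty_trR;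
  apply: smooth_mxM; rewrite ?(smooth_mx_ctr, smooth_mxM)//;
  do ?apply: smooth_mx_ctr; do ?apply: smooth_mxM.
Qed.

Lemma derive_st_metric (V : normedModType R) a1 (Y w1 w2 : V -> M) v x :
  smooth_mx Y -> smooth_mx w1 -> smooth_mx w2 ->
  'D_v (fun z => st_metric a0 a1 (Y z) (w1 z) (w2 z)) x =
  a0 * trR ((partial_mx w1 v x)^H *m w2 x + (w1 x)^H *m partial_mx w2 v x) +
  (a1 - a0) * trR (
    (partial_mx (fun z => (Y z)^H *m w1 z) v x)^H *m ((Y x)^H *m w2 x) +
    ((Y x)^H *m w1 x)^H *m partial_mx (fun z => (Y z)^H *m w2 z) v x).
Proof.
move=> sY s1 s2; under eq_fun do rewrite st_metricE.
have sYH := smooth_mx_ctr sY; have s1H := smooth_mx_ctr s1.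
have sY1 := smooth_mxM sYH s1; have sY2 := smooth_mxM sYH s2.
have sY1H := smooth_mx_ctr sY1.
have t12 := Cinfty_trR (smooth_mxM s1H s2).
have tY := Cinfty_trR (smooth_mxM sY1H sY2).
have sc (c : R) (f : V -> R) : Cinfty f -> Cinfty (fun z => c * f z).
  by apply: CinftyM; exact: Cinfty_cst.
rewrite deriveD; [|exact: Cinfty_derivable (sc _ _ t12) _ _
                  |exact: Cinfty_derivable (sc _ _ tY) _ _].
rewrite !derive_mul//; try exact: Cinfty_cst.
rewrite !derive_cst !mul0r !add0r !derive_trR//; try exact: smooth_mxM.
by rewrite (partialM _ _ s1H s2) (partialM _ _ sY1H sY2) (partial_ctr _ _ s1) (partial_ctr _ _ sY1).
Qed.

Lemma stiefel_partial (V : normedModType R) (F : V -> M) v x :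
  (forall z, stiefel (F z)) -> smooth_mx F -> antisym ((F x)^H *m partial_mx F v x).
Proof.
move=> stF sF; apply: gram_antisym.
have := partialM v x (smooth_mx_ctr sF) sF; rewrite (partial_ctr _ _ sF) => <-.
have -> : (fun z => (F z)^H *m F z) = fun=> 1%:M by apply/funext => z; exact: stF.
exact: partial_cst.
Qed.

(** Write N for [F^H F_t]. Every term with the factor [a1 - a0] contains N or its derivative along
    [vt], both zero at [x]. The mixed derivatives cancel by symmetry, leaving [2 a0] times the real
    trace of [F_tt^H F_s = - A F^H F_s], which is 0 because [A] is Hermitian and [F^H F_s]
    antisymmetric. *)
Lemma first_variation_at (V : normedModType R) a1 (F : V -> M) (A : 'M[K]_p)
    (vs vt x : V) (Fs := partial_mx F vs) (Ft := partial_mx F vt) :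
  (forall z, stiefel (F z)) -> smooth_mx F -> A^H = A ->
  (F x)^H *m Ft x = 0 ->
  partial_mx (fun z => (F z)^H *m Ft z) vt x = 0 ->
  partial_mx Ft vt x = - (F x *m A) ->
  2 * 'D_vt (fun z => st_metric a0 a1 (F z) (Ft z) (Fs z)) x
  - 'D_vs (fun z => st_metric a0 a1 (F z) (Ft z) (Ft z)) x = 0.
Proof.
move=> stF sF hA N0 Ntt Ftt.
have sFs : smooth_mx Fs by exact: smooth_partial.
have sFt : smooth_mx Ft by exact: smooth_partial.
have sFH : smooth_mx (fun z => (F z)^H) by exact: smooth_mx_ctr.
have Fts : partial_mx Ft vs x = partial_mx Fs vt x by exact: partial_comm.
have hFs : antisym ((F x)^H *m Fs x) by exact: stiefel_partial.
move: Fs Ft sFs sFt Fts hFs N0 Ntt Ftt => Fs Ft sFs sFt Fts hFs N0 Ntt Ftt.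
have D1 := derive_st_metric a1 vt x sF sFt sFs.
have D2 := derive_st_metric a1 vs x sF sFt sFt.
apply: (etrans (congr2 (fun a b => 2 * a - b) D1 D2)).
rewrite Ntt !N0 ctr0 !mul0mx !mulmx0 !addr0 trR0 mulr0 !addr0.
rewrite Ftt Fts !trRD ctrN mulNmx trRN ctrM hA -mulmxA trR_antisym_herm//.
have -> : trR ((partial_mx Fs vt x)^H *m Ft x) = trR ((Ft x)^H *m partial_mx Fs vt x).
  by rewrite -[RHS]trR_ctr ctrM ctrK.
by rewrite oppr0 add0r; ring.
Qed.

Lemma first_variation a1 F (A : 'M[K]_p) : smooth_family F -> A^H = A ->
  (forall t, (F (0, t))^H *m vel (fun u => F (0, u)) t = 0) ->
  (forall t, vel (vel (fun u => F (0, u))) t = - (F (0, t) *m A)) ->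
  forall t,
  2 * derive1 (fun u : R =>
    st_metric a0 a1 (F (0, u)) (ddt F 0 u) (dds F 0 u)) t
  - derive1 (fun s : R => st_metric a0 a1 (F (s, t)) (ddt F s t) (ddt F s t)) 0
  = 0.
Proof.
move=> [stF sF] hA hor acc t.
have sFs : smooth_mx (partial_mx F (1, 0)) by exact: smooth_partial.
have sFt : smooth_mx (partial_mx F (0, 1)) by exact: smooth_partial.
have FtE u : vel (fun u => F (0, u)) u = partial_mx F (0, 1) (0, u).
  exact: (vel_snd0 F).
have N0 u : (F (0, u))^H *m partial_mx F (0, 1) (0, u) = 0.
  by have := hor u; rewrite FtE.
have D1 := derive1_t t (smooth_st_metric a1 sF sFt sFs).
have D2 := derive1_s t (smooth_st_metric a1 sF sFt sFt).
have Ntt : partial_mx (fun z => (F z)^H *m partial_mx F (0, 1) z) (0, 1) (0, t) = 0.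
  apply: (etrans (esym (vel_snd0 _ _))).
  have -> : (fun u => (F (0, u))^H *m partial_mx F (0, 1) (0, u)) = fun=> 0.
    by apply/funext => u; exact: N0.
  exact: vel_cst.
have Ftt : partial_mx (partial_mx F (0, 1)) (0, 1) (0, t) = - (F (0, t) *m A).
  rewrite -acc; apply: (etrans (esym (vel_snd0 _ _))).
  by congr (vel _ t); apply/funext => u; exact: (esym (FtE u)).
apply: (etrans (congr2 (fun a b => 2 * a - b) D1 D2)).
exact: (@first_variation_at _ a1 F A (1, 0) (0, 1) (0, t)).
Qed.

Lemma geodesic_St a1 Y eta E : horizontal_geodesic Y eta E ->
  geodesic (X := St k n p a0 a1) E.
Proof.
move=> hE; split; first by exists E; split=> //; exact: (hg_smooth hE).
move=> F sF FE t; have {}FE : (fun u => F (0, u)) = E by apply/funext.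
apply: (@first_variation a1 F (eta^H *m eta)) => //.
- by rewrite ctrM ctrK.
- by move=> u; rewrite FE -(hg_hor hE u); congr (_^H *m _); rewrite -FE.
- by move=> u; rewrite FE (hg_acc hE) -FE.
Qed.

(** A family projecting to the same curve meets [E] only up to a unitary factor [W t], which is
    smooth because it equals [F(0, t)^H E(t)]. Replacing [F] by [F W] moves points within their
    orbits, hence preserves the quotient metric of the velocities, and gives a family through [E]
    itself. *)
Lemma geodesic_Gr a1 Y eta E : horizontal_geodesic Y eta E ->
  geodesic (X := Gr k n p a0 a1) (fun t => orbit_mx (E t)).
Proof.
move=> hE; split; first by exists E; split=> //; exact: (hg_smooth hE).
move=> F [stF sF] FE t.
have [stE sE] := hg_smooth hE.
pose W u := (F (0, u))^H *m E u.
have sW : smooth_mx (W : R^o -> _).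
  by apply: smooth_mxM => //; apply: smooth_mx_ctr; exact: smooth_snd0.
have WE u : unitaryK (W u) /\ F (0, u) *m W u = E u.
  have [U UU EU] := orbit_mxP (FE u).
  have -> : W u = U by rewrite /W EU mulmxA stF mul1mx.
  by [].
have linsnd : linear (snd : R^o * R^o -> R^o) by [].
have csnd : continuous (snd : R^o * R^o -> R^o) by move=> z; exact: cvg_snd.
have sWz : smooth_mx (fun z : R^o * R^o => W z.2).
  exact: (smooth_mx_pullback linsnd csnd).
pose G z := F z *m W z.2.
have sG : smooth_family G.
  split; last exact: smooth_mxM.
  by move=> z; apply: stiefelM; [exact: stF|have [] := WE z.2].
have G0 : (fun u => G (0, u)) = E by apply/funext => u; have [] := WE u.
have Gv v z : partial_mx G v z =
    partial_mx F v z *m W z.2 + F z *m partial_mx (fun z => W z.2) v z.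
  exact: partialM.
have metricG v w z : st_metric a0 0 (G z) (partial_mx G v z) (partial_mx G w z) =
    gr_metric a0 a1 (F z) (partial_mx F v z) (partial_mx F w z).
  have [WW _] := WE z.2.
  rewrite -(@gr_metric_degenerate _ _ _ _ a0 a1); last by case: sG.
  by rewrite !Gv; apply: gr_metric_invariant.
have E1 : (fun u : R => gr_metric a0 a1 (F (0, u)) (ddt F 0 u) (dds F 0 u)) =
          (fun u : R => st_metric a0 0 (G (0, u)) (ddt G 0 u) (dds G 0 u)).
  by apply/funext => u; exact: (esym (metricG _ _ _)).
have E2 : (fun s : R => gr_metric a0 a1 (F (s, t)) (ddt F s t) (ddt F s t)) =
          (fun s : R => st_metric a0 0 (G (s, t)) (ddt G s t) (ddt G s t)).
  by apply/funext => s; exact: (esym (metricG _ _ _)).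
apply: (etrans (congr2 (fun f g : R -> R => 2 * derive1 f t - derive1 g 0) E1 E2)).
apply: (@first_variation 0 G (eta^H *m eta)) => //.
- by rewrite ctrM ctrK.
- by move=> u; rewrite G0 -(hg_hor hE u); congr (_^H *m _); rewrite -G0.
- by move=> u; rewrite G0 (hg_acc hE) -G0.
Qed.

End FirstVariation.

(** * Conservation laws and uniqueness of geodesics *)

Section Uniqueness.
Variables (R : realType) (k : scalar_kind) (n p : nat) (a0 : R).
Local Notation K := (scalars R k).
Local Notation M := 'M[K]_(n, p).
Implicit Types (g E : R -> M).

(** The coordinate projections of the parameter plane send one of the directions (1, 0), (0, 1) to
    the zero direction. *)
Lemma derive_dir0 (V : normedModType R) (f : V -> R) x : 'D_0 f x = 0.
Proof.
rewrite /derive; under eq_fun do rewrite scaler0 /= add0r subrr scaler0.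
exact: lim_cst.
Qed.

Lemma partial_dir0 (V : normedModType R) m q (F : V -> 'M[K]_(m, q)) x :
  partial_mx F 0 x = 0.
Proof.
by apply/matrixP=> i j; apply: scal_eqP;
  rewrite ?re_partial ?im_partial derive_dir0 mxE raddf0.
Qed.

Lemma vel0_cst m q (F : R -> 'M[K]_(m, q)) : smooth_mx (F : R^o -> _) ->
  (forall t, vel F t = 0) -> forall t, F t = F 0.
Proof.
move=> sF vF t; apply/matrixP=> i j; have [sre sim] := sF i j; apply: scal_eqP.
  apply: (@is_derive_0_is_cst R (fun t => scal_re (F t i j))) => x.
  have <- : 'D_1 ((fun t => scal_re (F t i j)) : R^o -> R) x = 0.
    by rewrite -re_partial -/(vel F x) vF mxE raddf0.
  exact: is_derive_Cinfty.
apply: (@is_derive_0_is_cst R (fun t => scal_im (F t i j))) => x.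
have <- : 'D_1 ((fun t => scal_im (F t i j)) : R^o -> R) x = 0.
  by rewrite -im_partial -/(vel F x) vF mxE raddf0.
exact: is_derive_Cinfty.
Qed.

Lemma st_metric_invariant a1 (Y w1 w2 : M) (P : 'M[K]_n) (Q : 'M[K]_p) :
  P^H *m P = 1%:M -> Q^H *m Q = 1%:M ->
  st_metric a0 a1 (P *m Y *m Q) (P *m w1 *m Q) (P *m w2 *m Q) =
  st_metric a0 a1 Y w1 w2.
Proof.
move=> PP QQ; have QQ' := unitaryC QQ.
have gram (A B : M) : (P *m A *m Q)^H *m (P *m B *m Q) = Q^H *m (A^H *m B) *m Q.
  by rewrite !ctrM !mulmxA -(mulmxA _ P^H P) PP mulmx1.
have conj (A : 'M[K]_p) : trR (Q^H *m A *m Q) = trR A.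
  by rewrite trR_mulC mulmxA QQ' mul1mx.
rewrite !st_metricE !gram conj; congr (_ + _ * _).
rewrite ctrM [(Q^H *m _)^H]ctrM ctrK !mulmxA.
rewrite -(mulmxA _ Q Q^H) QQ' mulmx1 -[RHS]conj.
by rewrite !mulmxA.
Qed.

(** The geodesic equation for a curve upstairs; with second parameter 0 it is, through [koszul_Gr],
    the condition satisfied by lifts of Grassmann geodesics. *)
Definition critical a1 g := forall F, smooth_family F -> (forall t, F (0, t) = g t) ->
  forall t, koszul (St k n p a0 a1) F t = 0.

Lemma koszul_Gr a1 (F : R^o * R^o -> M) t : smooth_family F ->
  koszul (Gr k n p a0 a1) F t = koszul (St k n p a0 0) F t.
Proof.
move=> [stF sF].
have E z v w : gr_metric a0 a1 (F z) v w = st_metric a0 0 (F z) v w.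
  exact: gr_metric_degenerate.
have E1 : (fun u : R => gr_metric a0 a1 (F (0, u)) (ddt F 0 u) (dds F 0 u)) =
          (fun u : R => st_metric a0 0 (F (0, u)) (ddt F 0 u) (dds F 0 u)).
  by apply/funext => u; exact: E.
have E2 : (fun s : R => gr_metric a0 a1 (F (s, t)) (ddt F s t) (ddt F s t)) =
          (fun s : R => st_metric a0 0 (F (s, t)) (ddt F s t) (ddt F s t)).
  by apply/funext => s; exact: E.
exact: (congr2 (fun f g : R -> R => 2 * derive1 f t - derive1 g 0) E1 E2).
Qed.

(* Noether's theorem for the isometries Y |-> P Y Q with P, Q unitary: the
   family F(s, t) = P(s) g(t) Q(s) has constant energy density in s. *)
Lemma noether a1 g (X : 'M[K]_n) (B : 'M[K]_p) : smooth_curve g -> critical a1 g ->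
  X^H = - X -> B^H = - B -> forall t,
  st_metric a0 a1 (g t) (vel g t) (X *m g t + g t *m B) =
  st_metric a0 a1 (g 0) (vel g 0) (X *m g 0 + g 0 *m B).
Proof.
move=> [stg sg] cg hX hB.
have [P [sP PP P0 vP]] := unitary_flow hX.
have [Q [sQ QQ Q0 vQ]] := unitary_flow hB.
pose F (z : R^o * R^o) := P z.1 *m g z.2 *m Q z.1.
have l1 : linear (fst : R^o * R^o -> R^o) by [].
have l2 : linear (snd : R^o * R^o -> R^o) by [].
have c1 : continuous (fst : R^o * R^o -> R^o) by move=> z; exact: cvg_fst.
have c2 : continuous (snd : R^o * R^o -> R^o) by move=> z; exact: cvg_snd.
have sP1 := smooth_mx_pullback l1 c1 sP.
have sQ1 := smooth_mx_pullback l1 c1 sQ.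
have sg2 := smooth_mx_pullback l2 c2 sg.
have sPg := smooth_mxM sP1 sg2.
have sF : smooth_family F.
  split; last exact: smooth_mxM.
  move=> z; apply: stiefelM; last exact: QQ.
  by rewrite /stiefel ctrM mulmxA -(mulmxA _ (P z.1)^H) PP mulmx1; exact: stg.
have Fv v z : partial_mx F v z =
    (partial_mx (P : R^o -> _) v.1 z.1 *m g z.2 +
     P z.1 *m partial_mx (g : R^o -> _) v.2 z.2) *m Q z.1 +
    P z.1 *m g z.2 *m partial_mx (Q : R^o -> _) v.1 z.1.
  have EP := partial_pullback l1 (P : R^o -> _) v z.
  have Eg := partial_pullback l2 (g : R^o -> _) v z.
  have EQ := partial_pullback l1 (Q : R^o -> _) v z.
  apply: (etrans (partialM v z sPg sQ1)).
  apply: (congr2 (fun A B => A *m Q z.1 + P z.1 *m g z.2 *m B) _ EQ).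
  apply: (etrans (partialM v z sP1 sg2)).
  exact: (congr2 (fun A B => A *m g z.2 + P z.1 *m B) EP Eg).
have Ft s t : ddt F s t = P s *m vel g t *m Q s.
  apply: (etrans (Fv _ _)) => /=.
  by rewrite !partial_dir0 mul0mx mulmx0 addr0 add0r.
have Fs t : dds F 0 t = X *m g t + g t *m B.
  apply: (etrans (Fv _ _)) => /=.
  rewrite partial_dir0 mulmx0 addr0.
  rewrite -[partial_mx _ _ 0]/(vel P 0) -[partial_mx Q _ 0]/(vel Q 0) vP vQ P0 Q0.
  by rewrite !mulmx1 mul1mx.
have F0 t : F (0, t) = g t by rewrite /F /= P0 Q0 mul1mx mulmx1.
pose phi (t : R) := st_metric a0 a1 (g t) (vel g t) (X *m g t + g t *m B).
have sphi : Cinfty (phi : R^o -> R).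
  apply: smooth_st_metric => //; first exact: smooth_vel.
  by apply: smooth_mxD; apply: smooth_mxM => //; exact: smooth_mx_cst.
have dphi t : 'D_1 (phi : R^o -> R) t = 0.
  have := cg F sF F0 t; rewrite /koszul /=.
  have E1 : (fun u : R => st_metric a0 a1 (F (0, u)) (ddt F 0 u) (dds F 0 u)) = phi.
    by apply/funext => u; rewrite Ft Fs F0 P0 Q0 mul1mx mulmx1.
  have E2 : (fun s : R => st_metric a0 a1 (F (s, t)) (ddt F s t) (ddt F s t)) =
      fun=> st_metric a0 a1 (g t) (vel g t) (vel g t).
    by apply/funext => s; rewrite Ft; exact: st_metric_invariant.
  move=> /(etrans (esym (congr2 (fun f g : R -> R => 2 * derive1 f t - derive1 g 0) E1 E2))).
  rewrite derive1_cst subr0 derive1E => /eqP; rewrite mulf_eq0 pnatr_eq0 /=.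
  by move=> /eqP.
move=> t; apply: (@is_derive_0_is_cst R phi) => x.
by rewrite -(dphi x); exact: is_derive_Cinfty.
Qed.

(** Up to a constant factor, each conserved quantity is the pairing of [X] with the antisymmetric
    matrix [h g^H - g h^H]. Testing with [X] equal to the change of this matrix shows that the
    change has norm 0. *)
Lemma momentum_const (g h : R -> M) :
  (forall X : 'M[K]_n, X^H = - X -> forall t,
     trR ((h t)^H *m (X *m g t)) = trR ((h 0)^H *m (X *m g 0))) ->
  forall t, h t *m (g t)^H - g t *m (h t)^H = h 0 *m (g 0)^H - g 0 *m (h 0)^H.
Proof.
move=> cst t; pose Om t := h t *m (g t)^H - g t *m (h t)^H.
have OmH u : (Om u)^H = - Om u by rewrite /Om ctrB !ctrM !ctrK opprB.
have pairing (X : 'M[K]_n) u : X^H = - X ->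
    trR (X *m Om u) = - (2 * trR ((h u)^H *m (X *m g u))).
  move=> hX.
  have e1 : trR (X *m (h u *m (g u)^H)) = - trR ((h u)^H *m (X *m g u)).
    rewrite -trR_ctr !ctrM ctrK hX mulmxN trRN -[_ *m _ *m X]mulmxA trR_mulC.
    by rewrite mulmxA.
  have e2 : trR (X *m (g u *m (h u)^H)) = trR ((h u)^H *m (X *m g u)).
    by rewrite mulmxA trR_mulC.
  by rewrite /Om mulmxBr trRB e1 e2 mulr2n mulrDl mul1r opprD.
pose D := Om t - Om 0.
have hD : D^H = - D by rewrite /D ctrB !OmH -opprB opprK addrC.
have D0 : trR (D *m D) = 0.
  by rewrite {2}/D mulmxBr trRB !pairing// (cst _ hD t) subrr.
apply/eqP; rewrite -subr_eq0 -/(Om t) -/(Om 0) -/D; apply/eqP.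
by apply: trR_gram_eq0; rewrite hD mulNmx trRN D0 oppr0.
Qed.

Lemma horizontal_ode g t (h := hor_part (g t) (vel g t))
    (Om := h *m (g t)^H - g t *m h^H) : stiefel (g t) ->
  vel g t = Om *m g t + g t *m ((g t)^H *m vel g t).
Proof.
move=> stg; have hg : h^H *m g t = 0.
  exact: horizontal_ctr (hor_part_horizontal _ stg).
by rewrite /Om mulmxBl -!mulmxA stg hg mulmx0 subr0 mulmx1 /h /hor_part subrK.
Qed.

(* If g' = Om g + g B then W = E^H g satisfies W' = W B, so W stays unitary,
   which forces g = E W. *)
Lemma horizontal_geodesic_follow Y eta E g : horizontal_geodesic Y eta E ->
  smooth_curve g ->
  (forall t, hor_part (g t) (vel g t) *m (g t)^H -
             g t *m (hor_part (g t) (vel g t))^H = eta *m Y^H - Y *m eta^H) ->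
  unitaryK (Y^H *m g 0) ->
  forall t, [/\ unitaryK ((E t)^H *m g t), g t = E t *m ((E t)^H *m g t)
    & vel (fun t => (E t)^H *m g t) t =
      (E t)^H *m g t *m ((g t)^H *m vel g t)].
Proof.
move=> hE [stg sg] mom U0.
have [stE sE] := hg_smooth hE; have sEH := smooth_mx_ctr sE.
pose Om := eta *m Y^H - Y *m eta^H.
have OmH : Om^H = - Om by rewrite /Om ctrB !ctrM !ctrK opprB.
have vg t : vel g t = Om *m g t + g t *m ((g t)^H *m vel g t).
  by rewrite {1}(horizontal_ode (stg t)) mom.
pose W t := (E t)^H *m g t.
have sW : smooth_mx (W : R^o -> _) by exact: smooth_mxM.
have vW t : vel W t = W t *m ((g t)^H *m vel g t).
  rewrite velM// vel_ctr// (hg_ode hE) -/Om {1}vg mulmxDr ctrM OmH.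
  by rewrite mulmxN mulNmx !mulmxA addrA addNr add0r.
have antiB t : antisym ((g t)^H *m vel g t) by exact: (@stiefel_partial R k n p R^o).
have WW0 t : W t *m (W t)^H = W 0 *m (W 0)^H.
  apply: (@vel0_cst _ _ (fun t => W t *m (W t)^H)).
    by apply: smooth_mxM => //; exact: smooth_mx_ctr.
  move=> u; rewrite velM//; last exact: smooth_mx_ctr.
  rewrite vel_ctr// vW ctrM antiB mulNmx mulmxN.
  by rewrite !mulmxA subrr.
have UW t : unitaryK (W t).
  apply: mulmx1C; rewrite WW0 /W (hg_0 hE); exact: unitaryC.
move=> t; split=> //; first exact: UW.
(* [E W - g] is orthogonal to [E], so its Gram matrix reduces to [- g^H (E W - g) = 1 - W^H W],
   which is 0. *)
apply/esym/eqP; rewrite -subr_eq0; apply/eqP.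
apply: trR_gram_eq0; rewrite -/(W t).
have gE : (g t)^H *m E t = (W t)^H by rewrite ctrM ctrK.
have e1 : (E t)^H *m (E t *m W t - g t) = 0.
  by rewrite mulmxBr mulmxA stE mul1mx subrr.
rewrite ctrB (ctrM (E t)) mulmxBl -mulmxA e1 mulmx0 sub0r mulmxBr mulmxA gE stg.
by rewrite (UW t) subrr oppr0 trR0.
Qed.

Lemma Gr_geodesic_unique a1 Y eta E c : 0 < a0 -> stiefel Y -> horizontal Y eta ->
  horizontal_geodesic Y eta E ->
  geodesic_from (X := Gr k n p a0 a1) (orbit_mx Y) (orbit_tvec Y eta) c ->
  forall t, c t = orbit_mx (E t).
Proof.
move=> ha0 stY hY hE [[_ gc] c0 [g [[sg cg] vg]]] t.
have [stg smg] := sg.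
have crit : critical 0 g.
  move=> F sF Fg u; rewrite -(koszul_Gr a1)//; apply: gc => // v.
  by rewrite Fg cg.
have hh0 u := hor_part_horizontal (vel g u) (stg u).
(* The lift [g] is only known to start in the class of [(Y, eta)]: [g 0 = Y U], and its velocity is
   [eta U] up to a vertical term. The momentum sees neither [U] nor the vertical term. *)
have [U [A [UU hA [g0 v0]]]] : orbit_tvec Y eta (g 0, vel g 0).
  rewrite -vg; exists 1%:M, 0; split; rewrite ?mulmx1 ?mulmx0 ?addr0//.
    by rewrite /unitaryK ctr1 mulmx1.
  by rewrite /antisym ctr0 oppr0.
have mom0 : hor_part (g 0) (vel g 0) *m (g 0)^H - g 0 *m (hor_part (g 0) (vel g 0))^H
    = eta *m Y^H - Y *m eta^H.
  rewrite v0 g0 -[Y *m U *m A]mulmxA hor_partM// hor_part_id//.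
  have UU' : U *m U^H = 1%:M := unitaryC UU.
  by rewrite !ctrM !mulmxA -(mulmxA eta) -(mulmxA Y U) UU' !mulmx1.
have mom : forall t, hor_part (g t) (vel g t) *m (g t)^H -
             g t *m (hor_part (g t) (vel g t))^H = eta *m Y^H - Y *m eta^H.
  move=> u; rewrite -mom0; move: u.
  apply: (@momentum_const g (fun t => hor_part (g t) (vel g t))) => X hX u.
  have nX v : st_metric a0 0 (g v) (vel g v) (X *m g v + g v *m 0) =
      a0 * trR ((hor_part (g v) (vel g v))^H *m (X *m g v)).
    rewrite mulmx0 addr0 -(@gr_metric_degenerate _ _ _ _ a0 a1)// gr_metricE//.
    rewrite [X in _ *m X]/hor_part mulmxBr [_ *m (g v *m _)]mulmxA.
    by rewrite (horizontal_ctr (hh0 v)) mul0mx subr0.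
  have h0 : (0 : 'M[K]_p)^H = - 0 by rewrite ctr0 oppr0.
  have := noether sg crit hX h0 u; rewrite !nX.
  by apply: mulfI; rewrite gt_eqF.
have U0 : unitaryK (Y^H *m g 0) by rewrite g0 mulmxA stY mul1mx.
have [UW gE _] := horizontal_geodesic_follow hE sg
  mom U0 t.
by rewrite cg /= gE orbit_mxM.
Qed.

Lemma St_geodesic_unique a1 Y eta E c : 0 < a0 -> 0 < a1 -> stiefel Y ->
  horizontal Y eta -> horizontal_geodesic Y eta E ->
  geodesic_from (X := St k n p a0 a1) Y (Y, eta) c ->
  forall t, c t = E t.
Proof.
move=> ha0 ha1 stY hY hE [[_ gc] c0 [g [[sg cg] vg]]] t.
have cg' : c = g by apply/funext => u; exact: cg.
move: vg => [g0 v0]; have [stg smg] := sg.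
have crit : critical a1 g by move=> F sF Fg; apply: gc => // v; rewrite cg'; exact: Fg.
have h0 q : (0 : 'M[K]_q)^H = - 0 by rewrite ctr0 oppr0.
(* Right multiplications conserve [a1] times the pairing of [g^H g'] with each antisymmetric [B]. It
   is 0 at the start, so the choice of [B] as [g^H g'] at time [u] shows that [g] stays horizontal,
   [a1] being nonzero. *)
have hor u : horizontal (g u) (vel g u).
  have anti : antisym ((g u)^H *m vel g u) by exact: (@stiefel_partial R k n p R^o).
  have nB v (B : 'M[K]_p) : st_metric a0 a1 (g v) (vel g v) (0 *m g v + g v *m B) =
      a1 * trR (((g v)^H *m vel g v)^H *m B).
    rewrite mul0mx add0r st_metricE [_ *m (g v *m B)]mulmxA.
    rewrite -{1}[g v]ctrK -ctrM [(g v)^H *m (g v *m B)]mulmxA stg mul1mx.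
    by ring.
  have := noether sg crit (h0 n) anti u; rewrite !nB g0 v0 hY ctr0 mul0mx trR0 mulr0.
  move=> /eqP; rewrite mulf_eq0 gt_eqF//= => /eqP.
  by move=> h; apply: trR_gram_eq0.
have mom0 : hor_part (g 0) (vel g 0) *m (g 0)^H - g 0 *m (hor_part (g 0) (vel g 0))^H
    = eta *m Y^H - Y *m eta^H.
  by rewrite (hor_part_id (hor 0)) g0 v0.
have mom : forall t, hor_part (g t) (vel g t) *m (g t)^H -
             g t *m (hor_part (g t) (vel g t))^H = eta *m Y^H - Y *m eta^H.
  move=> u; rewrite -mom0; move: u.
  apply: (@momentum_const g (fun t => hor_part (g t) (vel g t))) => X hX u.
  have nX v : st_metric a0 a1 (g v) (vel g v) (X *m g v + g v *m 0) =
      a0 * trR ((hor_part (g v) (vel g v))^H *m (X *m g v)).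
    rewrite mulmx0 addr0 st_metricE (hor_part_id (hor v)) (hor v).
    by rewrite ctr0 mul0mx trR0 mulr0 addr0.
  have := noether sg crit hX (h0 p) u; rewrite !nX.
  by apply: mulfI; rewrite gt_eqF.
have Y0 : Y^H *m g 0 = 1%:M by rewrite g0.
have U0 : unitaryK (Y^H *m g 0) by rewrite Y0 /unitaryK ctr1 mulmx1.
have follow := horizontal_geodesic_follow hE sg mom U0.
have [_ gE _] := follow t; have [_ sE] := hg_smooth hE.
(* Along a horizontal curve [W' = W g^H g'] vanishes, so the unitary factor keeps its initial value,
   the identity. *)
have W1 : (E t)^H *m g t = (E 0)^H *m g 0.
  apply: (@vel0_cst _ _ (fun t => (E t)^H *m g t)).
    by apply: smooth_mxM => //; exact: smooth_mx_ctr.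
  by move=> u; have [_ _ ->] := follow u; rewrite hor mulmx0.
by rewrite cg /= gE W1 (hg_0 hE) Y0 mulmx1.
Qed.

End Uniqueness.

(** * Angles *)

Section Angles.
Variable R : realType.
Implicit Types x y : R.

Lemma acos_le x y : -1 <= x -> x <= y -> y <= 1 -> acos y <= acos x.
Proof.
move=> x1 xy y1; have xB : -1 <= x <= 1 by rewrite x1 (le_trans xy).
have yB : -1 <= y <= 1 by rewrite y1 (le_trans x1).
have [/andP[ax0 axpi] cx] := acos_def xB; have [/andP[ay0 aypi] cy] := acos_def yB.
rewrite leNgt -ltr_cos ?in_itv/= ?ax0 ?ay0//.
by rewrite cx cy -leNgt.
Qed.

(* acos x = 2 b with b cos b <= sin b, cos b ^ 2 = (1 + x) / 2 and
   2 (1 - x) = (2 sin b) ^ 2. *)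
Lemma acos_le_chord x : -1 <= x <= 1 ->
  acos x * ((1 + x) / 2) <= Num.sqrt (2 * (1 - x)).
Proof.
move=> xB; have [/andP[a0 api] cx] := acos_def xB.
pose b := acos x / 2.
have b0 : 0 <= b by rewrite divr_ge0.
have bpi : b <= pi / 2 by rewrite ler_pM2r.
have pi0 := pi_gt0 R.
have E : acos x = b *+ 2 by rewrite /b -mulr_natr divfK.
have cb0 : 0 <= cos b by apply: cos_ge0_pihalf; rewrite bpi andbT; lra.
have sb0 : 0 <= sin b by apply: sin_ge0_pi; rewrite b0/=; lra.
have cb : cos b ^+ 2 = (1 + x) / 2.
  have := cos_mulr2n b; rewrite -E cx; lra.
have sb : sin b ^+ 2 = (1 - x) / 2 by rewrite sin2cos2 cb; lra.
have sqE : Num.sqrt (2 * (1 - x)) = 2 * sin b.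
  rewrite -[RHS]ger0_norm ?mulr_ge0// -sqrtr_sqr exprMn sb; congr Num.sqrt; lra.
have bs : b * cos b <= sin b.
  have [|c] := @MVT_segment R sin cos _ _ b0 (fun t _ => is_derive_sin t).
    by apply: continuous_subspaceT; exact: continuous_sin.
  rewrite in_itv /= => /andP[c0 cb']; rewrite sin0 !subr0 => ->.
  rewrite mulrC ler_wpM2r//; move: cb'; rewrite le_eqVlt => /orP[/eqP->//|cb'].
  apply: ltW; rewrite ltr_cos ?in_itv/=//; apply/andP; split=> //; lra.
have cb1 : cos b <= 1 by exact: cos_le1.
rewrite sqE -cb E -mulr_natr expr2 mulrA [b * 2]mulrC -2!mulrA ler_pM2l//.
by rewrite mulrA (le_trans _ bs)// ler_piMr// mulr_ge0.
Qed.

(** The hypothesis is the Gram determinant inequality of three unit vectors; it bounds [c] below by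
    [cos (acos a + acos b)]. When the sum of angles is at least pi the conclusion is immediate. *)
Lemma acos_triangle (a b c : R) : -1 <= a <= 1 -> -1 <= b <= 1 -> -1 <= c <= 1 ->
  (c - a * b) ^+ 2 <= (1 - a ^+ 2) * (1 - b ^+ 2) -> acos c <= acos a + acos b.
Proof.
move=> aB bB cB h.
have [/andP[aa0 aapi] ca] := acos_def aB; have [/andP[ab0 abpi] cb] := acos_def bB.
have [/andP[ac0 acpi] cc] := acos_def cB.
have [hpi|hpi] := leP pi (acos a + acos b); first exact: le_trans hpi.
rewrite leNgt -ltr_cos ?in_itv/= ?ac0 ?addr_ge0 ?(ltW hpi)// -leNgt.
rewrite cc cosD ca cb !sin_acos// -sqrtrM; last by case/andP: aB => *; nra.
rewrite lerBlDl -lerBlDr (le_trans (ler_norm _))// -sqrtr_sqr ler_wsqrtr//.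
by rewrite -sqrrN opprB.
Qed.

(** Read [D s t r] as a distance from [s] to [t] of at most [r], with [phi] bounding the speed.
    Continuous induction: the supremum [T] of the times reached is itself reached, because the local
    estimate at [T] extends back to some earlier time, and it is 1, because the estimate also
    extends forward. One half of [e] pays for the error in [D], the other for that of the
    primitive. *)
Lemma straddle (D : R -> R -> R -> Prop) (phi Phi : R -> R) :
  (forall s t u r r', D s t r -> D t u r' -> D s u (r + r')) ->
  (forall s t r r', r <= r' -> D s t r -> D s t r') ->
  (forall s t r, D s t r -> D t s r) ->
  D 0 0 0 ->
  (forall t, 0 <= t <= 1 -> is_derive (t : R^o) 1 (Phi : R^o -> R^o) (phi t)) ->
  (forall t e, 0 <= t <= 1 -> 0 < e -> exists2 d, 0 < d &
     forall b, `|b - t| < d -> D t b ((phi t + e) * `|b - t|)) ->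
  forall e, 0 < e -> D 0 1 (Phi 1 - Phi 0 + e).
Proof.
move=> Dtrans Dmono Dsym D0 dPhi Dloc e e0.
have e2 : 0 < e / 2 by rewrite divr_gt0.
have loc t : 0 <= t <= 1 -> exists2 d, 0 < d & forall b, `|b - t| < d ->
    D t b ((phi t + e / 2) * `|b - t|) /\
    `|Phi b - Phi t - phi t * (b - t)| <= e / 2 * `|b - t|.
  move=> t01; have [d1 d10 h1] := Dloc t _ t01 e2.
  have [d2 d20 h2] : exists2 d, 0 < d & forall b, `|b - t| < d ->
      `|Phi b - Phi t - phi t * (b - t)| <= e / 2 * `|b - t|.
    have [dt E] := dPhi t t01.
    have := dt => /cvgrPdist_le/(_ _ e2) /=; rewrite -[lim _]/('D_1 (Phi : R^o -> R^o) t) E.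
    move=> /nbhs_ballP[d /= d0 hd]; exists d => // b bt.
    have [->|bt0] := eqVneq b t; first by rewrite !subrr mulr0 subrr normr0 mulr0.
    have bt1 : b - t != 0 by rewrite subr_eq0.
    have := hd (b - t); rewrite /ball /= sub0r normrN => /(_ bt bt1).
    rewrite -[(b - t) *: (1 : R^o)]/((b - t) * 1) mulr1 subrK.
    rewrite -[(b - t)^-1 *: _]/((b - t)^-1 * _) => hq.
    have btn : 0 < `|b - t| by rewrite normr_gt0.
    have -> : Phi b - Phi t - phi t * (b - t) =
        (b - t) * ((b - t)^-1 * (Phi b - Phi t) - phi t).
      by rewrite [RHS]mulrBr mulVKf// [phi t * _]mulrC.
    by rewrite normrM mulrC ler_pM2r// distrC.
  exists (Num.min d1 d2) => [|b]; first by rewrite lt_min d10.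
  by rewrite lt_min => /andP[b1 b2]; split; [exact: h1|exact: h2].
pose S := [set t | 0 <= t <= 1 /\ D 0 t (Phi t - Phi 0 + e * t)].
have S0 : S 0 by split; rewrite ?lexx ?ler01// mulr0 subrr addr0.
have supS : has_sup S by split; [exists 0|exists 1 => t [/andP[]]].
set T := sup S.
have T0 : 0 <= T by exact: sup_upper_bound.
have T1 : T <= 1 by apply: ge_sup; [exists 0|move=> t [/andP[]]].
have T01 : 0 <= T <= 1 by rewrite T0.
have [d d0 hd] := loc T T01.
have ST : S T.
  have [t [/andP[t0 t1] Dt] tT] := sup_adherent d0 supS.
  rewrite -/T in tT.
  have tT' : t <= T by apply: sup_upper_bound => //; rewrite /S/= t0 t1.
  have := hd t; rewrite distrC ger0_norm ?subr_ge0// => /(_ _)[|DT hPhi]; first by clear -tT d0; lra.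
  split=> //; apply: (@Dmono _ _ _ _ _ (Dtrans _ _ _ _ _ Dt (Dsym _ _ _ DT))).
  move: hPhi; rewrite ler_norml => /andP[_]; lra.
suff T1E : T = 1 by case: ST => _; rewrite T1E mulr1.
apply/eqP; rewrite eq_le T1 leNgt; apply/negP => T1'.
pose b := Num.min 1 (T + d / 2).
have Tb : T < b by rewrite /b lt_min T1'/= ltrDl divr_gt0.
have b1 : b <= 1 by rewrite /b ge_min lexx.
have bd : b <= T + d / 2 by rewrite /b ge_min lexx orbT.
have Sb : S b.
  have := hd b; rewrite gtr0_norm ?subr_gt0// => /(_ _)[|DT hPhi]; first by clear -bd d0; lra.
  split; first by rewrite b1 (le_trans T0)// ltW.
  case: ST => _ DT0; apply: (@Dmono _ _ _ _ _ (Dtrans _ _ _ _ _ DT0 DT)).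
  move: hPhi; rewrite ler_norml => /andP[+ _]; lra.
by have := sup_upper_bound supS Sb; rewrite leNgt Tb.
Qed.

End Angles.

(** * Lower bound for the length of curves in the Grassmann manifold *)

Section Transport.
Variables (R : realType) (k : scalar_kind) (n p : nat).
Local Notation K := (scalars R k).
Local Notation M := 'M[K]_(n, p).

Lemma trR_cauchy_schwarz m q (A B : 'M[K]_(m, q)) :
  trR (A^H *m B) ^+ 2 <= trR (A^H *m A) * trR (B^H *m B).
Proof.
set x := trR (A^H *m A); set y := trR (B^H *m B); set z := trR (A^H *m B).
have BA : trR (B^H *m A) = z by rewrite -trR_ctr ctrM ctrK.
have [y0|y0] := eqVneq y 0.
  by rewrite /z (trR_gram_eq0 y0) mulmx0 trR0 y0 mulr0 expr0n.
have ypos : 0 < y by rewrite lt_neqAle eq_sym y0; exact: trR_gram_ge0.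
(* The squared norm of [y A - z B] is [y (x y - z ^ 2)]. *)
have := trR_gram_ge0 (scal_real k y *: A - scal_real k z *: B).
rewrite ctrB !ctrZ mulmxBl !mulmxBr !trRB -!scalemxAl -!scalemxAr !trRZ BA.
rewrite -/x -/y -/z => h.
have : 0 <= y * (x * y - z ^+ 2).
  by apply: le_trans h _; rewrite le_eqVlt; apply/orP; left; apply/eqP; ring.
by rewrite pmulr_rge0// subr_ge0.
Qed.

(** The real part is taken so that, over the complex numbers too, angles are those of the underlying
    real Euclidean space. *)
Definition col_ip m q (A B : 'M[K]_(m, q)) i : R := scal_re ((A^H *m B) i i).

Lemma col_ipE m q (A B : 'M[K]_(m, q)) i :
  col_ip A B i = trR ((col i A)^H *m col i B).
Proof.
rewrite trRE big_ord1 /col_ip !mxE; congr scal_re; apply: eq_bigr => l _.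
by rewrite !mxE.
Qed.

Lemma col_ip_sum m q (A B : 'M[K]_(m, q)) : \sum_i col_ip A B i = trR (A^H *m B).
Proof. by rewrite trRE. Qed.

Lemma col_ipC m q (A B : 'M[K]_(m, q)) i : col_ip A B i = col_ip B A i.
Proof. by rewrite /col_ip -[A^H *m B]ctrK ctrM ctrK ctrE scal_re_conj. Qed.

Lemma col_ip_sub m q (A B : 'M[K]_(m, q)) i :
  col_ip (A - B) (A - B) i = col_ip A A i + col_ip B B i - 2 * col_ip B A i.
Proof.
rewrite mulr_natl mulr2n {1}[in RHS]/col_ip.
have -> : col_ip (A - B) (A - B) i =
    col_ip A A i - col_ip A B i - (col_ip B A i - col_ip B B i).
  by rewrite {1}/col_ip ctrB mulmxBl !mulmxBr !mxE !raddfB /= /col_ip !mxE.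
by rewrite [col_ip A B i]col_ipC -/(col_ip A A i); ring.
Qed.

Lemma col_ip_stiefel (A : M) i : stiefel A -> col_ip A A i = 1.
Proof. by rewrite /col_ip => ->; rewrite mxE eqxx -(rmorph1 (@scal_real R k)) scal_re_real. Qed.

Lemma col_ip_ge0 m q (A : 'M[K]_(m, q)) i : 0 <= col_ip A A i.
Proof. by rewrite col_ipE; exact: trR_gram_ge0. Qed.

Lemma col_ip_bound (A B : M) i : stiefel A -> stiefel B -> -1 <= col_ip A B i <= 1.
Proof.
move=> stA stB; rewrite -ler_norml -(@expr_le1 _ 2)// -normrX ger0_norm ?sqr_ge0//.
rewrite col_ipE (le_trans (trR_cauchy_schwarz _ _))//.
by rewrite -!col_ipE !col_ip_stiefel// mulr1.
Qed.

(** Cauchy-Schwarz for the components of the columns of [A] and [C] orthogonal to the column of [B]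
    gives the Gram inequality. *)
Lemma col_angle_triangle (A B C : M) i : stiefel A -> stiefel B -> stiefel C ->
  acos (col_ip A C i) <= acos (col_ip A B i) + acos (col_ip B C i).
Proof.
move=> stA stB stC; apply: acos_triangle; try exact: col_ip_bound.
set a := col_ip A B i; set b := col_ip B C i; set c := col_ip A C i.
have AA := col_ip_stiefel i stA; have BB := col_ip_stiefel i stB.
have CC := col_ip_stiefel i stC; have BA := col_ipC B A i; have CB := col_ipC C B i.
rewrite -/a -/b in BA CB.
have := trR_cauchy_schwarz (col i A - scal_real k a *: col i B)
                           (col i C - scal_real k b *: col i B).
rewrite !ctrB !ctrZ !mulmxBl !mulmxBr !trRB -!scalemxAl -!scalemxAr !trRZ.
rewrite -!col_ipE AA BB CC BA CB -/a -/b -/c.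
by congr (_ <= _); ring.
Qed.

(* Q stands for the parallel transport of frames from Y to Z. *)
Definition transport_bound (w : 'I_p -> R) (Y Z : M) (r : R) :=
  exists2 Q : 'M[K]_p, unitaryK Q & forall V, unitaryK V ->
    \sum_i w i * acos (col_ip (Y *m V) (Z *m Q *m V) i) <= r.

Section Weights.
Variable w : 'I_p -> R.
Hypothesis w0 : forall i, 0 <= w i.

Lemma transport_bound_refl Y : stiefel Y -> transport_bound w Y Y 0.
Proof.
move=> stY; exists 1%:M; first by rewrite /unitaryK ctr1 mulmx1.
move=> V UV; rewrite big1 // => i _; rewrite mulmx1 col_ip_stiefel ?acos1 ?mulr0//.
exact: stiefelM.
Qed.

(** The second bound is used on the frame [P V] produced by the first transport; this is one reason
    why a bound is asked for all frames at once. *)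
Lemma transport_bound_trans X Y Z r r' : stiefel X -> stiefel Y -> stiefel Z ->
  transport_bound w X Y r -> transport_bound w Y Z r' ->
  transport_bound w X Z (r + r').
Proof.
move=> stX stY stZ [P UP hP] [Q UQ hQ]; exists (Q *m P); first exact: unitaryM.
move=> V UV; have UPV : unitaryK (P *m V) by exact: unitaryM.
apply: le_trans (lerD (hP V UV) (hQ _ UPV)); rewrite -big_split /=.
apply: ler_sum => i _; rewrite -mulrDr ler_wpM2l//.
have -> : Z *m (Q *m P) *m V = Z *m Q *m (P *m V) by rewrite !mulmxA.
rewrite (mulmxA Y P V); apply: col_angle_triangle; first exact: stiefelM.
  by rewrite -mulmxA; exact: stiefelM.
by rewrite -mulmxA; apply: stiefelM => //; exact: unitaryM.
Qed.

Lemma transport_bound_sym Y Z r : transport_bound w Y Z r -> transport_bound w Z Y r.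
Proof.
move=> [Q UQ hQ]; have UQ' : Q *m Q^H = 1%:M := unitaryC UQ.
exists Q^H => [|V UV]; first by rewrite /unitaryK ctrK.
have UQV : unitaryK (Q^H *m V) by apply: unitaryM => //; rewrite ctrK.
apply: le_trans (hQ _ UQV); apply: ler_sum => i _.
by rewrite col_ipC !mulmxA -(mulmxA Z Q) UQ' mulmx1.
Qed.

End Weights.

Lemma sum_mul_le (I : finType) (c d : I -> R) (s t : R) : 0 < s -> 0 < t ->
  \sum_i c i ^+ 2 <= s ^+ 2 -> \sum_i d i ^+ 2 <= t ^+ 2 ->
  \sum_i c i * d i <= s * t.
Proof.
move=> s0 t0 hc hd.
have h i : c i * d i <= t / s / 2 * c i ^+ 2 + s / t / 2 * d i ^+ 2.
  rewrite -subr_ge0.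
  have -> : t / s / 2 * c i ^+ 2 + s / t / 2 * d i ^+ 2 - c i * d i =
      (t * c i - s * d i) ^+ 2 / (2 * s * t) by field; rewrite !gt_eqF.
  by rewrite divr_ge0 ?sqr_ge0// !mulr_ge0// ltW.
apply: le_trans (ler_sum _ (fun i _ => h i)) _.
rewrite big_split -!mulr_sumr /=.
have ts0 : 0 <= t / s / 2 by rewrite !divr_ge0// ltW.
have st0 : 0 <= s / t / 2 by rewrite !divr_ge0// ltW.
apply: le_trans (lerD (ler_wpM2l ts0 hc) (ler_wpM2l st0 hd)) _.
by rewrite le_eqVlt; apply/orP; left; apply/eqP; field; rewrite !gt_eqF.
Qed.

(** The squared norm of the difference quotient, written in real and imaginary parts of the entries,
    tends to that of the velocity. *)
Lemma quotient_gram_bound m q (F : R -> 'M[K]_(m, q)) t e :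
  smooth_mx (F : R^o -> _) -> 0 < e ->
  exists2 d, 0 < d & forall b, `|b - t| < d ->
    trR ((F b - F t)^H *m (F b - F t)) <=
    (trR ((vel F t)^H *m vel F t) + e) * (b - t) ^+ 2.
Proof.
move=> sF e0.
pose quot (f : R -> R) h : R := h^-1 * (f (h + t) - f t).
have cvgq (f : R -> R) : Cinfty (f : R^o -> R) ->
    quot f h @[h --> 0^'] --> 'D_1 (f : R^o -> R) t.
  move=> sf; have dft : derivable (f : R^o -> R) t 1 by exact: Cinfty_derivable.
  have -> : quot f = fun h => h^-1 *: ((f \o shift t) (h *: (1 : R^o)) - f t).
    by apply/funext => h; rewrite /= -[h *: (1 : R^o)]/(h * 1) mulr1.
  exact: dft.
pose N h := \sum_j \sum_i (quot (fun u => scal_re (F u i j)) h ^+ 2 +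
                           quot (fun u => scal_im (F u i j)) h ^+ 2).
have cvgN : N h @[h --> 0^'] --> trR ((vel F t)^H *m vel F t).
  rewrite trR_gramE; apply: cvg_bigsum => j; apply: cvg_bigsum => i.
  have [sre sim] := sF i j.
  apply: cvgD; rewrite ?re_partial ?im_partial.
    by under eq_fun do rewrite expr2; rewrite expr2; apply: cvgM; exact: cvgq.
  by under eq_fun do rewrite expr2; rewrite expr2; apply: cvgM; exact: cvgq.
have /cvgrPdist_lt/(_ e e0) /nbhs_ballP[d /= d0 hd] := cvgN.
exists d => // b bt.
have [->|bt0] := eqVneq b t.
  by rewrite !subrr ctr0 mulmx0 trR0 expr0n mulr0.
have bt1 : b - t != 0 by rewrite subr_eq0.
have sqK (D : R) : ((b - t)^-1 * D) ^+ 2 * (b - t) ^+ 2 = D ^+ 2.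
  by rewrite -exprMn mulrAC mulVf// mul1r.
have NE : trR ((F b - F t)^H *m (F b - F t)) = N (b - t) * (b - t) ^+ 2.
  rewrite trR_gramE /N mulr_suml; apply: eq_bigr => j _.
  rewrite mulr_suml; apply: eq_bigr => i _.
  by rewrite mulrDl /quot subrK !sqK !mxE !raddfB.
rewrite NE ler_wpM2r ?sqr_ge0//.
have := hd (b - t); rewrite /ball /= sub0r normrN => /(_ bt bt1).
by rewrite ltr_distl => /andP[/ltW + _]; rewrite lerBlDr.
Qed.

(** Freezing [B = g^H g'] at time [t] and moving the frame by the one-parameter group of [- B] makes
    [y = g Q] horizontal at [t], which suffices to first order. Column [i] of [y V] then covers a
    chord of length [sqrt (chi i)]; chords become angles by [acos_le_chord] and are summed by
    Cauchy-Schwarz. *)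
Lemma transport_bound_local (w : 'I_p -> R) (a0 a1 : R) g t e :
  (forall i, 0 <= w i) -> \sum_i w i ^+ 2 <= a0 -> 0 < a0 -> smooth_curve g -> 0 < e ->
  exists2 d, 0 < d & forall b, `|b - t| < d ->
    transport_bound w (g t) (g b)
      ((Num.sqrt (gr_metric a0 a1 (g t) (vel g t) (vel g t)) + e) * `|b - t|).
Proof.
move=> w0 hw a00 [stg sg] e0; set m := Num.sqrt _.
have stgt := stg t.
pose B := (g t)^H *m vel g t.
have hB : (- B)^H = - (- B).
  by rewrite ctrN (_ : B^H = - B)//; exact: (@stiefel_partial R k n p R^o).
have [Q0 [sQ0 UQ0 _ vQ0]] := unitary_flow hB.
pose Q b := Q0 b *m (Q0 t)^H.
have UQ b : unitaryK (Q b) by apply: unitaryM => //; rewrite ctrK; exact: unitaryC.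
have Qt : Q t = 1%:M by exact: unitaryC.
have sQ : smooth_mx (Q : R^o -> _) by apply: smooth_mxM => //; exact: smooth_mx_cst.
have vQ : vel Q t = - B by rewrite velMr// vQ0 -mulmxA (unitaryC (UQ0 t)) mulmx1.
pose y b := g b *m Q b.
have sy : smooth_mx (y : R^o -> _) by exact: smooth_mxM.
have sty b : stiefel (y b) by exact: stiefelM.
have vy : vel y t = hor_part (g t) (vel g t).
  by rewrite velM// vQ Qt mulmx1 mulmxN.
have yt : y t = g t by rewrite /y Qt mulmx1.
pose N := trR ((vel y t)^H *m vel y t).
have N0 : 0 <= N by exact: trR_gram_ge0.
have mE : m = Num.sqrt (a0 * N) by rewrite /m gr_metricE// /N vy.
have m0 : 0 <= m by rewrite mE sqrtr_ge0.
have m2 : m ^+ 2 = a0 * N by rewrite mE sqr_sqrtr// mulr_ge0// ltW.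
(* This makes [a0 (N + e')] at most [(m + e / 2) ^ 2]: one half of [e] absorbs the error in the
   squared speed, and [kap] below spends the other half on replacing chords by angles. *)
pose e' := e ^+ 2 / (4 * a0).
have e'0 : 0 < e' by rewrite divr_gt0 ?exprn_gt0// mulr_gt0.
have me0 : 0 < m + e by rewrite ltr_wpDl.
pose kap := e / 2 / (m + e).
have kap0 : 0 < kap by rewrite !divr_gt0.
have kapE : (1 - kap) * (m + e) = m + e / 2.
  by rewrite /kap; field; rewrite gt_eqF.
have M0 : 0 < N + e' by rewrite ltr_wpDl.
have aM : Num.sqrt a0 * Num.sqrt (N + e') <= m + e / 2.
  rewrite -sqrtrM ?(ltW a00)// -[leRHS]ger0_norm ?addr_ge0 ?divr_ge0// ?(ltW e0)//.
  rewrite -sqrtr_sqr ler_wsqrtr// mulrDr -m2 /e'.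
  have -> : a0 * (e ^+ 2 / (4 * a0)) = e ^+ 2 / 4 by field; rewrite gt_eqF.
  have -> : (m + e / 2) ^+ 2 = m ^+ 2 + m * e + e ^+ 2 / 4 by field.
  by rewrite lerD2r lerDl mulr_ge0// ltW.
have [d1 d10 hd1] := quotient_gram_bound t sy e'0.
(* As [|b - t| < 1] bounds the square of [|b - t|] by [|b - t|], the third term keeps every [chi i]
   below [4 kap]; equivalently, every cosine [x] has [(1 + x) / 2] at least [1 - kap]. *)
exists (Num.min d1 (Num.min 1 (4 * kap / (N + e')))).
  by rewrite !lt_min d10 ltr01 divr_gt0// mulr_gt0.
move=> b; rewrite !lt_min => /and3P[bt1 bt2 bt3].
have [->|bt0] := eqVneq b t.
  by rewrite subrr normr0 mulr0; exact: transport_bound_refl.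
have nbt : 0 < `|b - t| by rewrite normr_gt0 subr_eq0.
have rho := hd1 b bt1; rewrite -/N in rho.
have rho4 : (N + e') * (b - t) ^+ 2 <= 4 * kap.
  rewrite -ler_pdivlMl// mulrC -real_normK ?num_real// expr2.
  by rewrite (le_trans _ (ltW bt3))// ler_piMr// ltW.
exists (Q b) => // V UV.
pose chi i := col_ip ((y b - y t) *m V) ((y b - y t) *m V) i.
have chiE i : chi i = 2 * (1 - col_ip (g t *m V) (g b *m Q b *m V) i).
  rewrite /chi mulmxBl col_ip_sub !col_ip_stiefel; try exact: stiefelM.
  by rewrite yt -/(y b); ring.
(* Right multiplication by the unitary [V] preserves the norm, so the estimate is uniform over all
   frames. *)
have chi_sum : \sum_i chi i = trR ((y b - y t)^H *m (y b - y t)).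
  rewrite col_ip_sum ctrM -mulmxA trR_mulC -!mulmxA (unitaryC UV) mulmx1.
  by [].
have chi0 i : 0 <= chi i by exact: col_ip_ge0.
have chi_le i : chi i <= 4 * kap.
  apply: le_trans rho4; apply: le_trans rho; rewrite -chi_sum (bigD1 i)//=.
  by rewrite lerDl sumr_ge0.
have kap1 : 0 < 1 - kap.
  by rewrite -(pmulr_lgt0 _ me0) kapE ltr_wpDl// divr_gt0.
have ang i : (1 - kap) * acos (col_ip (g t *m V) (g b *m Q b *m V) i) <= Num.sqrt (chi i).
  have xB := col_ip_bound i (stiefelM stgt UV) (stiefelM (sty b) UV).
  rewrite chiE; apply: le_trans (acos_le_chord xB).
  rewrite mulrC ler_wpM2l ?acos_ge0//.
  by have := chi_le i; rewrite chiE; set x := col_ip _ _ _; lra.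
rewrite -(ler_pM2l kap1) mulrA kapE mulr_sumr.
apply: (@le_trans _ _ (\sum_i w i * Num.sqrt (chi i))).
  by apply: ler_sum => i _; rewrite mulrCA ler_wpM2l.
have t0 : 0 < Num.sqrt (N + e') * `|b - t| by rewrite mulr_gt0 ?sqrtr_gt0.
apply: (@le_trans _ _ (Num.sqrt a0 * (Num.sqrt (N + e') * `|b - t|))).
  apply: sum_mul_le; rewrite ?sqrtr_gt0//; first by rewrite sqr_sqrtr// ltW.
  rewrite exprMn sqr_sqrtr ?(ltW M0)// real_normK ?num_real//.
  apply: le_trans rho; rewrite -chi_sum le_eqVlt; apply/orP; left; apply/eqP.
  by apply: eq_bigr => i _; rewrite sqr_sqrtr.
by rewrite mulrA ler_pM2r.
Qed.

End Transport.

(** * From local transport to a bound by the length of the curve *)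

Section LengthBound.
Variables (R : realType) (k : scalar_kind) (n p : nat).
Local Notation K := (scalars R k).
Local Notation M := 'M[K]_(n, p).
Local Notation mu := (@lebesgue_measure R).

Lemma continuous_primitive (f : R -> R) : continuous f ->
  exists Phi : R -> R,
    (forall t, 0 <= t <= 1 -> is_derive (t : R^o) 1 (Phi : R^o -> R^o) (f t)) /\
    \int[mu]_(t in `[0, 1]) f t = Phi 1 - Phi 0.
Proof.
move=> cf.
have intf (a b : R) : mu.-integrable `[a, b] (EFin \o f).
  apply: continuous_compact_integrable; first exact: segment_compact.
  exact: continuous_subspaceT.
(* Integrating from -1 makes 0 and 1 interior points, so that [Phi] has two-sided derivatives on the
   whole unit interval. *)
pose Phi x := \int[mu]_(t in `[(-1)%R, x]) f t.
have dPhi x : -1 < x -> x < 2 -> derivable Phi x 1 /\ derive1 Phi x = f x.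
  by move=> x1 x2; apply: (@continuous_FTC1_closed _ f (-1) x 2) => //; exact: cf.
have cPhi x : -1 < x -> x < 2 -> {for x, continuous Phi}.
  move=> x1 x2; have [dx _] := dPhi x x1 x2.
  exact/differentiable_continuous/derivable1_diffP.
exists Phi; split.
  move=> t /andP[t0 t1]; have [||dt <-] := dPhi t; [lra|lra|].
  by rewrite derive1E; apply: DeriveDef.
rewrite /Rintegral (@continuous_FTC2 _ f Phi 0 1)//.
- exact: continuous_subspaceT.
- split.
  + by move=> x; rewrite in_itv /= => /andP[x0 x1]; have [||dx _] := dPhi x; [lra|lra|exact: dx].
  + by apply: cvg_at_right_filter; apply: cPhi; lra.
  + by apply: cvg_at_left_filter; apply: cPhi; lra.
- by move=> x; rewrite in_itv /= => /andP[x0 x1]; have [||_ ->] := dPhi x; [lra|lra|by []].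
Qed.

(** Continuity is all that can be expected: the square root is not smooth where the horizontal
    velocity vanishes. *)
Lemma continuous_gr_speed (a0 a1 : R) (g : R -> M) : smooth_curve g ->
  continuous (fun t => Num.sqrt (gr_metric a0 a1 (g t) (vel g t) (vel g t))).
Proof.
move=> [stg sg] t.
apply: (@continuous_comp _ _ _ (fun t => gr_metric a0 a1 (g t) (vel g t) (vel g t))).
  rewrite (_ : (fun _ => _) = fun t => st_metric a0 0 (g t) (vel g t) (vel g t)).
    have sm : Cinfty ((fun t => st_metric a0 0 (g t) (vel g t) (vel g t)) : R^o -> R).
      by apply: smooth_st_metric => //; exact: smooth_vel.
    exact: (Cinfty_continuous sm).
  by apply/funext => u; exact: gr_metric_degenerate.
exact: sqrt_continuous.
Qed.

Lemma transport_bound_length (w : 'I_p -> R) (a0 a1 : R) (g : R -> M) e :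
  (forall i, 0 <= w i) -> \sum_i w i ^+ 2 <= a0 -> 0 < a0 -> smooth_curve g -> 0 < e ->
  transport_bound w (g 0) (g 1) (curve_length (Gr k n p a0 a1) g + e).
Proof.
move=> w0 hw a00 sg e0; have stg := sg.1.
have [Phi [dPhi lenE]] := continuous_primitive (@continuous_gr_speed a0 a1 g sg).
have -> : curve_length (Gr k n p a0 a1) g = Phi 1 - Phi 0 by exact: lenE.
apply: (@straddle R (fun s t r => transport_bound w (g s) (g t) r)
  (fun t => Num.sqrt (gr_metric a0 a1 (g t) (vel g t) (vel g t))) Phi) => //.
- by move=> s t u r r'; exact: transport_bound_trans.
- by move=> s t r r' rr' [Q UQ hQ]; exists Q => // V /hQ h; exact: le_trans rr'.
- by move=> s t r; exact: transport_bound_sym.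
- exact: transport_bound_refl.
- by move=> t e1 _ e10; exact: transport_bound_local.
Qed.

Lemma real_diag_entry (A : 'M[K]_p) (s : 'rV[R]_p) i :
  scal_re ((A *m real_diag k s) i i) = scal_re (A i i) * s ord0 i.
Proof. by rewrite /real_diag mul_mx_diag !mxE mulrC scal_reZ mulrC. Qed.

Lemma unitary_entry (T : 'M[K]_p) i : unitaryK T -> `|scal_re (T i i)| <= 1.
Proof.
move=> UT.
have UT' : (T : 'M[K]_(p, p))^H *m T = 1%:M by exact: UT.
have := @col_ip_bound R k p p 1%:M T i.
rewrite /col_ip ctr1 mul1mx /stiefel ctr1 mul1mx ler_norml; apply => //.
Qed.

(** [V0] is chosen so that the frame arriving at [Z] is [Z V^H], the right singular vectors. The
    matrix of inner products is then [T Sigma] with [T] unitary, and its diagonal entries have real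
    part at most [s i], since the entries of [T] have real part at most 1 in absolute value. *)
Lemma transport_bound_svd (w : 'I_p -> R) (Y Z : M) (U V U0 U1 : 'M[K]_p)
    (s : 'rV[R]_p) r :
  (forall i, 0 <= w i) -> U^H *m U = 1%:M -> V^H *m V = 1%:M ->
  (forall i, 0 <= s ord0 i <= 1) -> Y^H *m Z = U *m real_diag k s *m V ->
  unitaryK U0 -> unitaryK U1 -> transport_bound w (Y *m U0) (Z *m U1) r ->
  \sum_i w i * acos (s ord0 i) <= r.
Proof.
move=> w0 UU VV s01 YZ UU0 UU1 [Q UQ hQ].
have UA : unitaryK (V *m U1 *m Q) by do 2![apply: unitaryM => //].
have UA' := unitaryC UA.
pose V0 := (V *m U1 *m Q)^H.
have UV0 : unitaryK V0 by rewrite /unitaryK ctrK.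
apply: le_trans (hQ V0 UV0); apply: ler_sum => i _; rewrite ler_wpM2l//.
have -> : col_ip (Y *m U0 *m V0) (Z *m U1 *m Q *m V0) i =
    scal_re ((V0^H *m U0^H *m U) i i) * s ord0 i.
  rewrite -real_diag_entry /col_ip !ctrM !mulmxA -(mulmxA _ Y^H Z) YZ.
  congr (scal_re (fun_of_matrix _ i i)).
  by rewrite -[RHS]mulmx1 -UA' !mulmxA.
have /unitary_entry : unitaryK (V0^H *m U0^H *m U).
  have UV0' : unitaryK V0^H by rewrite /unitaryK ctrK; exact: unitaryC UV0.
  have UU0' : unitaryK U0^H by rewrite /unitaryK ctrK; exact: unitaryC UU0.
  exact: unitaryM (unitaryM UV0' UU0') UU.
move=> /(_ i); rewrite ler_norml => /andP[Tm TM].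
have /andP[s0 s1] := s01 i.
apply: acos_le => //; last by rewrite ler_piMl.
rewrite -[leRHS]opprK lerN2 -mulNr (le_trans _ s1)// ler_piMl// lerNl.
by [].
Qed.

Lemma gr_length_lower_bound (a0 a1 : R) (Y Z : M) (U V : 'M[K]_p) (s : 'rV[R]_p) g :
  0 < a0 -> U^H *m U = 1%:M -> V^H *m V = 1%:M ->
  (forall i, 0 <= s ord0 i <= 1) -> Y^H *m Z = U *m real_diag k s *m V ->
  smooth_curve g -> orbit_mx (g 0) = orbit_mx Y -> orbit_mx (g 1) = orbit_mx Z ->
  Num.sqrt (a0 * \sum_i acos (s ord0 i) ^+ 2) <= curve_length (Gr k n p a0 a1) g.
Proof.
move=> a00 UU VV s01 YZ sg g0 g1; set len := Num.sqrt _.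
have S0 : 0 <= \sum_i acos (s ord0 i) ^+ 2 by apply: sumr_ge0 => i _; exact: sqr_ge0.
have len2 : len ^+ 2 = a0 * \sum_i acos (s ord0 i) ^+ 2.
  by rewrite sqr_sqrtr// mulr_ge0// ltW.
have ac0 i : 0 <= acos (s ord0 i).
  by have /andP[s0 s1] := s01 i; rewrite acos_ge0// s1 andbT (le_trans _ s0).
(* The degenerate case is split off because the weights divide by [len]. *)
have [len0|len0] := eqVneq len 0.
  by rewrite len0 /curve_length /Rintegral fine_ge0// integral_ge0// => t _;
     rewrite lee_fin sqrtr_ge0.
have lenp : 0 < len by rewrite lt_neqAle eq_sym len0 sqrtr_ge0.
(* The extremal weights for Cauchy-Schwarz: their squares add up to [a0], and the weighted sum of
   the angles is exactly [len]. *)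
pose w i := a0 / len * acos (s ord0 i).
have w0 i : 0 <= w i by rewrite /w mulr_ge0// divr_ge0// ltW.
have SE : \sum_i acos (s ord0 i) ^+ 2 = len ^+ 2 / a0.
  by rewrite len2 mulrC mulKf// gt_eqF.
have hw : \sum_i w i ^+ 2 <= a0.
  under eq_bigr do rewrite exprMn.
  rewrite -mulr_sumr SE le_eqVlt; apply/orP; left; apply/eqP.
  by field; rewrite len0 gt_eqF.
have hlen : \sum_i w i * acos (s ord0 i) = len.
  under eq_bigr do rewrite -mulrA -expr2.
  rewrite -mulr_sumr SE.
  by field; rewrite len0 gt_eqF.
have [U0 UU0 E0] := orbit_mxP (esym g0); have [U1 UU1 E1] := orbit_mxP (esym g1).
apply/ler_addgt0Pr => e e0; rewrite -hlen.
have := transport_bound_length a1 w0 hw a00 sg e0; rewrite E0 E1.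
exact: (transport_bound_svd w0 UU VV s01 YZ UU0 UU1).
Qed.

End LengthBound.

(** * Exponentials and logarithms *)

Section Exponentials.
Variables (R : realType) (k : scalar_kind) (n p : nat) (a0 a1 : R).
Hypotheses (a0_gt0 : 0 < a0) (a1_gt0 : 0 < a1).
Local Notation K := (scalars R k).
Local Notation M := 'M[K]_(n, p).
Local Notation StX := (St k n p a0 a1).
Local Notation GrX := (Gr k n p a0 a1).

Lemma Gr_geodesic_from (Y eta : M) E : horizontal_geodesic Y eta E ->
  geodesic_from (X := GrX) (orbit_mx Y) (orbit_tvec Y eta) (fun t => orbit_mx (E t)).
Proof.
move=> hE; split; first exact: geodesic_Gr hE.
  by rewrite (hg_0 hE).
exists E; split; first by split; [exact: (hg_smooth hE)|].
by rewrite /= (hg_0 hE) (hg_vel0 hE).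
Qed.

Lemma is_Exp_St (Y eta : M) E : stiefel Y -> horizontal Y eta ->
  horizontal_geodesic Y eta E -> is_Exp (X := StX) Y (Y, eta) (E 1).
Proof.
move=> stY hY hE; split; last first.
  by move=> c gc; exact: (St_geodesic_unique a0_gt0 a1_gt0 stY hY hE gc).
exists E; split; [exact: geodesic_St hE|exact: (hg_0 hE)|].
exists E; split; first by split; [exact: (hg_smooth hE)|].
by rewrite /= (hg_0 hE) (hg_vel0 hE).
Qed.

Lemma is_Exp_Gr (Y eta : M) E : stiefel Y -> horizontal Y eta ->
  horizontal_geodesic Y eta E ->
  is_Exp (X := GrX) (orbit_mx Y) (orbit_tvec Y eta) (orbit_mx (E 1)).
Proof.
move=> stY hY hE; split; first by eexists; exact: Gr_geodesic_from hE.
by move=> c gc; exact: (Gr_geodesic_unique a0_gt0 stY hY hE gc).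
Qed.

Lemma orbit_tvec_self (Y w : M) : orbit_tvec Y w (Y, w).
Proof.
exists 1%:M, 0; split; rewrite ?mulmx1 ?mulmx0 ?addr0//.
  by rewrite /unitaryK ctr1 mulmx1.
by rewrite /antisym ctr0 oppr0.
Qed.

(** The difference [Y Y^H w] is tangent to the orbit and can be absorbed in the matrix [A] of
    [orbit_tvec]. Every tangent vector of the quotient thus has a horizontal lift, to which the
    explicit geodesics apply. *)
Lemma orbit_tvec_hor (Y w : M) : tangent Y w ->
  orbit_tvec Y (hor_part Y w) = orbit_tvec Y w.
Proof.
rewrite /tangent => tw; set B := Y^H *m w in tw.
have wE U A : unitaryK U -> hor_part Y w *m U + Y *m U *m (U^H *m B *m U + A) =
    w *m U + Y *m U *m A.
  move=> UU; rewrite /hor_part -/B mulmxDr !mulmxA -(mulmxA Y U) (unitaryC UU) mulmx1.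
  by rewrite mulmxBl addrA subrK.
clearbody B.
have antiB U : (U^H *m B *m U)^H = - (U^H *m B *m U).
  by rewrite !ctrM ctrK tw mulNmx mulmxN mulmxA.
apply/seteqP; split=> _ [U [A [UU hA ->]]].
  exists U, (A - U^H *m B *m U); split=> //.
    by rewrite /antisym ctrB hA antiB opprB opprK addrC.
  by rewrite -wE// subrKC.
exists U, (U^H *m B *m U + A); split=> //; last by rewrite wE.
by rewrite /antisym ctrD hA antiB opprD.
Qed.

(** [tnorm] picks some representative [(Y', w')] of the class; it differs from [(Y, w)] by a unitary
    factor and a vertical term, which the quotient metric ignores. *)
Lemma tnorm_Gr (Y w : M) : stiefel Y -> tangent Y w ->
  tnorm (X := GrX) (orbit_tvec Y w) = Num.sqrt (gr_metric a0 a1 Y w w).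
Proof.
move=> stY tw; rewrite /tnorm.
have [Y' [w' [stY' tw' E ->]]] := @xgetPex R 0
  [set r | exists Y' w', [/\ stiefel Y', tangent Y' w',
     dproj GrX Y' w' = orbit_tvec Y w & r = Num.sqrt (metric GrX Y' w' w')]]
  (ex_intro _ _ (ex_intro _ Y (ex_intro _ w (And4 stY tw erefl erefl)))).
have := orbit_tvec_self Y' w'; rewrite [orbit_tvec _ _]E => -[U [A [UU _ [-> ->]]]].
by rewrite /= -mulmxA gr_metric_invariant.
Qed.

Lemma tnorm_St (Y w : M) : stiefel Y -> tangent Y w ->
  tnorm (X := StX) (Y, w) = Num.sqrt (st_metric a0 a1 Y w w).
Proof.
move=> stY tw; rewrite /tnorm.
by have [Y' [w' [_ _ [-> ->] ->]]] := @xgetPex R 0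
  [set r | exists Y' w', [/\ stiefel Y', tangent Y' w',
     dproj StX Y' w' = (Y, w) & r = Num.sqrt (metric StX Y' w' w')]]
  (ex_intro _ _ (ex_intro _ Y (ex_intro _ w (And4 stY tw erefl erefl)))).
Qed.

Lemma gr_metric_horizontal (Y w : M) : stiefel Y -> horizontal Y w ->
  gr_metric a0 a1 Y w w = a0 * trR (w^H *m w).
Proof. by move=> stY hw; rewrite gr_metricE// hor_part_id. Qed.

Lemma length_horizontal_geodesic (Y eta : M) E : horizontal_geodesic Y eta E ->
  curve_length GrX E = Num.sqrt (a0 * trR (eta^H *m eta)).
Proof.
move=> hE; have [stE _] := hg_smooth hE.
have cE t : Num.sqrt (metric GrX (E t) (vel E t) (vel E t)) =
    Num.sqrt (a0 * trR (eta^H *m eta)).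
  by rewrite /= gr_metric_horizontal// ?(hg_speed hE)//; exact: (hg_hor hE).
rewrite /curve_length; under eq_Rintegral do rewrite cE.
rewrite Rintegral_cst//.
have mu01 : lebesgue_measure (`[0, 1]%classic : set R) = 1%E.
  by rewrite lebesgue_measure_itv /= lte_fin ltr01 oppr0 adde0.
rewrite -[RHS]mulr1; congr (_ * _); exact: (congr1 fine mu01).
Qed.

Lemma tangent_horizontal (Y w : M) : horizontal Y w -> tangent Y w.
Proof. by rewrite /tangent /antisym => ->; rewrite ctr0 oppr0. Qed.

(** * Principal angles and the logarithm *)

Section PrincipalAngles.
Variables (Y Z : M) (U V : 'M[K]_p) (s : 'rV[R]_p).
Hypotheses (stY : stiefel Y) (stZ : stiefel Z).
Hypotheses (UU : U^H *m U = 1%:M) (VV : V^H *m V = 1%:M).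
Hypotheses (s01 : forall i, 0 <= s ord0 i <= 1).
Hypothesis YZ : Y^H *m Z = U *m real_diag k s *m V.

Let eta := (Z - Y *m Y^H *m Z) *m V^H
             *m real_diag k (map_mx (@acos_ratio R) s) *m U^H.

Lemma real_diag_mapM (e e' : R -> R) :
  real_diag k (map_mx e s) *m real_diag k (map_mx e' s) =
  real_diag k (map_mx (fun x => e x * e' x) s).
Proof.
rewrite /real_diag mulmx_diag; congr diag_mx; apply/rowP => i.
by rewrite !mxE rmorphM.
Qed.

Let D (e : R -> R) : 'M[K]_p := real_diag k (map_mx e s).

Lemma principal_horizontal : horizontal Y eta.
Proof.
rewrite /horizontal /eta !mulmxA mulmxBr !mulmxA stY mul1mx subrr.
by rewrite !mul0mx.
Qed.

(** [Y U] and [Z V^H] are the principal vectors of the two subspaces. [N] holds the components of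
    the latter orthogonal to the former; their lengths are the sines of the principal angles. *)
Let N := Z *m V^H - Y *m U *m real_diag k s.

Lemma principal_etaE : eta = N *m D (@acos_ratio R) *m U^H.
Proof.
rewrite /eta /N mulmxBl -(mulmxA Y) YZ -!mulmxA (unitaryC VV) mulmx1.
by rewrite !mulmxA.
Qed.

Lemma real_diag_ext (e e' : R -> R) :
  (forall i, e (s ord0 i) = e' (s ord0 i)) -> D e = D e'.
Proof.
move=> ee; rewrite /D (_ : map_mx e s = map_mx e' s)//.
by apply/rowP => i; rewrite !mxE ee.
Qed.

Lemma real_diag_id : D id = real_diag k s.
Proof. by rewrite /D (_ : map_mx id s = s)//; apply/rowP => i; rewrite mxE. Qed.

Lemma real_diag1 : D (fun=> 1) = 1%:M.
Proof.
rewrite /D (_ : map_mx _ s = const_mx 1); last by apply/rowP => i; rewrite !mxE.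
by rewrite /real_diag map_const_mx rmorph1 diag_const_mx.
Qed.

Lemma principal_gram : N^H *m N = D (fun x => 1 - x ^+ 2).
Proof.
set P1 := Z *m V^H; set P2 := Y *m U *m real_diag k s.
have DD : real_diag k s *m real_diag k s = D (fun x => x ^+ 2).
  by rewrite -real_diag_id /D real_diag_mapM; apply: real_diag_ext => i; rewrite expr2.
have e11 : P1^H *m P1 = 1%:M.
  by rewrite ctrM ctrK mulmxA -(mulmxA V) stZ mulmx1 (unitaryC VV).
have e21 : P2^H *m P1 = D (fun x => x ^+ 2).
  rewrite /P2 !ctrM ctr_real_diag /P1 !mulmxA -(mulmxA _ Y^H Z) YZ -DD.
  by rewrite !mulmxA -(mulmxA _ V) (unitaryC VV) mulmx1 -(mulmxA _ U^H U) UU mulmx1.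
have DH : (D (fun x => x ^+ 2))^H = D (fun x => x ^+ 2) by exact: ctr_real_diag.
have e12 : P1^H *m P2 = D (fun x => x ^+ 2) by rewrite -[LHS]ctrK ctrM ctrK e21 DH.
have e22 : P2^H *m P2 = D (fun x => x ^+ 2).
  rewrite /P2 !ctrM ctr_real_diag !mulmxA -(mulmxA _ Y^H Y) stY mulmx1.
  by rewrite -(mulmxA _ U^H U) UU mulmx1 DD.
rewrite /N -/P1 -/P2 ctrB mulmxBl !mulmxBr e11 e12 e21 e22 subrr subr0.
rewrite -real_diag1 /D /real_diag -raddfB; congr diag_mx.
by apply/rowP => i; rewrite !mxE raddfB.
Qed.

Lemma acos_ratio_speed (x : R) : 0 <= x <= 1 ->
  acos_ratio x * (1 - x ^+ 2) * acos_ratio x = acos x ^+ 2.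
Proof.
move=> /andP[x0 x1]; rewrite /acos_ratio; case: eqVneq => [->|xn1].
  by rewrite acos1 expr1n subrr mulr0 mul0r expr0n.
have x2 : 0 < 1 - x ^+ 2 by rewrite subr_gt0 expr_lt1// lt_neqAle xn1.
have q0 : Num.sqrt (1 - x ^+ 2) != 0 by rewrite sqrtr_eq0 -ltNge.
by rewrite -{2}(sqr_sqrtr (ltW x2)); field.
Qed.

(** [sin (acos x)] is the square root of [1 - x ^ 2], which cancels the denominator of [acos_ratio];
    at [x = 1] the convention 1 matches [sinc 0 = 1]. *)
Lemma acos_ratio_sinc (x : R) : 0 <= x <= 1 -> acos_ratio x * sinc (acos x) = 1.
Proof.
move=> /andP[x0 x1]; rewrite /acos_ratio /sinc; case: eqVneq => [->|xn1].
  by rewrite acos1 eqxx mulr1.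
have xB : -1 <= x <= 1 by rewrite x1 (le_trans _ x0).
have x2 : 0 < 1 - x ^+ 2 by rewrite subr_gt0 expr_lt1// lt_neqAle xn1.
have q0 : Num.sqrt (1 - x ^+ 2) != 0 by rewrite sqrtr_eq0 -ltNge.
have a0' : acos x != 0.
  rewrite gt_eqF// acos_gt0//; apply/andP; split; first by case/andP: xB.
  by rewrite lt_neqAle xn1.
by rewrite (negPf a0') sin_acos//; field; rewrite ?q0 ?a0'.
Qed.

Lemma principal_speed :
  eta^H *m eta = ucalc U^H s (fun x => acos x ^+ 2).
Proof.
rewrite principal_etaE 2!ctrM ctrK [(D _)^H]ctr_real_diag /ucalc ctrK.
rewrite -!mulmxA (mulmxA N^H) principal_gram; congr (_ *m _).
rewrite !mulmxA; congr (_ *m _); rewrite /D !real_diag_mapM.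
by apply: real_diag_ext => i; exact: acos_ratio_speed.
Qed.

(** In the basis [U], csr gives [cos (acos Sigma) = Sigma] and ssr undoes [acos_ratio]. The sum is
    [Y U Sigma U^H + N U^H], where the subtracted part of [N] cancels the first term. *)
Lemma principal_exp :
  Y *m mxcsr (eta^H *m eta) + eta *m mxssr (eta^H *m eta) = Z *m V^H *m U^H.
Proof.
have UU' : U^H^H *m U^H = 1%:M by rewrite ctrK; exact: unitaryC.
have [Pi [rPi ucE]] := ucalc_resolution s UU'.
have xB i : -1 <= s ord0 i <= 1.
  by have /andP[x0 x1] := s01 i; rewrite x1 (le_trans _ x0).
have -> : mxcsr (eta^H *m eta) = ucalc U^H s id.
  rewrite principal_speed !ucE mxcsr_rcalc//; apply: rcalc_ext => i.
  by rewrite acosK // in_itv; exact: xB.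
have -> : mxssr (eta^H *m eta) = ucalc U^H s (fun x => sinc (acos x)).
  by rewrite principal_speed !ucE mxssr_rcalc.
rewrite ucalc_id principal_etaE /ucalc ctrK !mulmxA -(mulmxA (N *m _) U^H) UU mulmx1.
rewrite -(mulmxA N) /D real_diag_mapM -/(D _).
rewrite (@real_diag_ext _ (fun=> 1)); last by move=> i; exact: acos_ratio_sinc.
by rewrite real_diag1 mulmx1 /N mulmxBl addrC subrK.
Qed.

Lemma principal_trR :
  trR (eta^H *m eta) = \sum_i acos (s ord0 i) ^+ 2.
Proof.
rewrite principal_speed /ucalc ctrK trR_mulC mulmxA UU mul1mx.
by rewrite trRE; apply: eq_bigr => i _; rewrite !mxE eqxx mulr1n scal_re_real.
Qed.

Lemma principal_dist :
  geodesic_dist (X := GrX) (orbit_mx Y) (orbit_mx Z) =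
  (Num.sqrt (a0 * trR (eta^H *m eta)))%:E.
Proof.
have hY := principal_horizontal.
have UU' : unitaryK (V^H *m U^H).
  by apply: unitaryM; rewrite ctrK; exact: unitaryC.
have [E hE] := horizontal_geodesic_exists stY hY.
apply/eqP; rewrite eq_le; apply/andP; split.
  rewrite -(length_horizontal_geodesic hE); apply: ereal_inf_lbound.
  exists E => //; split; first exact: (hg_smooth hE).
    by rewrite (hg_0 hE).
  by rewrite (hg_1 hE) principal_exp -mulmxA /= orbit_mxM.
apply: le_ereal_inf_tmp => _ [g [sg g0 g1] <-]; rewrite lee_fin principal_trR.
exact: (gr_length_lower_bound a1 a0_gt0 UU VV s01 YZ sg g0 g1).
Qed.

Lemma principal_log : is_Log (X := GrX) (orbit_mx Y) (orbit_mx Z) (orbit_tvec Y eta).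
Proof.
have hY := principal_horizontal; have tY := tangent_horizontal hY.
have UU' : unitaryK (V^H *m U^H).
  by apply: unitaryM; rewrite ctrK; exact: unitaryC.
split; first by exists Y, eta; split.
  have [E hE] := horizontal_geodesic_exists stY hY.
  have := is_Exp_Gr stY hY hE.
  by rewrite (hg_1 hE) principal_exp -mulmxA /= orbit_mxM.
(* A competitor is replaced by its horizontal lift at some [Y1] in the orbit of [Y]. Its explicit
   geodesic must end in the class of [Z], so its length, which is the norm of the competitor, obeys
   the lower bound valid for all curves. *)
move=> w [Y1 [w1 [stY1 tw1 /= Y1E <-]]] [_ Exp1].
have hh := hor_part_horizontal w1 stY1.
have [E hE] := horizontal_geodesic_exists stY1 hh.
have E1 : orbit_mx (E 1) = orbit_mx Z.
  apply: (Exp1 (fun t => orbit_mx (E t))).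
  by have := Gr_geodesic_from hE; rewrite orbit_tvec_hor// Y1E.
have -> : tnorm (X := GrX) (dproj GrX Y1 w1) = curve_length GrX E.
  rewrite (length_horizontal_geodesic hE) /= -(orbit_tvec_hor tw1) tnorm_Gr//.
    by rewrite gr_metric_horizontal.
  exact: tangent_horizontal.
rewrite tnorm_Gr// gr_metric_horizontal// principal_trR.
apply: (gr_length_lower_bound a1 a0_gt0 UU VV s01 YZ (hg_smooth hE)) => //.
by rewrite (hg_0 hE).
Qed.

End PrincipalAngles.

End Exponentials.

Theorem proposition1 (R : realType) (k : scalar_kind) (n p : nat) (a0 a1 : R)
    (ha0 : 0 < a0) (ha1 : 0 < a1) :
  (forall Y eta : 'M[scalars R k]_(n, p),
     stiefel Y -> tangent Y eta -> horizontal Y eta ->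
     let A := eta^H *m eta in
     let E := Y *m mxcsr A + eta *m mxssr A in
     [/\ is_Exp (X := St k n p a0 a1) Y (Y, eta) E,
         E = Y *m mxcos (mxsqrt A) + eta *m mxssr A
       & is_Exp (X := Gr k n p a0 a1)
           (orbit_mx Y) (orbit_tvec Y eta) (orbit_mx E)])
  /\
  (forall (Y Z : 'M[scalars R k]_(n, p)) (U V : 'M[scalars R k]_p)
          (s : 'rV[R]_p),
     stiefel Y -> stiefel Z ->
     U^H *m U = 1%:M -> V^H *m V = 1%:M ->
     (forall i, 0 <= s ord0 i <= 1) ->
     Y^H *m Z = U *m real_diag k s *m V ->
     let eta := (Z - Y *m Y^H *m Z) *m V^H
                  *m real_diag k (map_mx (@acos_ratio R) s) *m U^H in
     let len := Num.sqrt (a0 * trR (real_diag k (map_mx (@acos R) s) ^+ 2)) in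
     [/\ tangent Y eta /\ horizontal Y eta,
         is_Exp (X := St k n p a0 a1) Y (Y, eta) (Z *m V^H *m U^H),
         orbit_mx (Z *m V^H *m U^H) = orbit_mx Z
       & [/\ tnorm (X := St k n p a0 a1) (Y, eta) = len,
             geodesic_dist (X := Gr k n p a0 a1) (orbit_mx Y) (orbit_mx Z)
               = len%:E
           & is_Log (X := Gr k n p a0 a1)
               (orbit_mx Y) (orbit_mx Z) (orbit_tvec Y eta)]]).
Proof.
split=> [Y eta stY _ hY A E|Y Z U V s stY stZ UU VV s01 YZ eta len].
  have [g hg] := horizontal_geodesic_exists stY hY.
  have gE : E = g 1 by rewrite (hg_1 hg).
  split; rewrite ?gE; [exact: is_Exp_St|by rewrite -gE mxcos_sqrt_gram|].
  exact: is_Exp_Gr.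
have hY : horizontal Y eta by exact: principal_horizontal.
have etaE := principal_exp stY stZ UU VV s01 YZ; rewrite -/eta in etaE.
have lenE : Num.sqrt (a0 * trR (eta^H *m eta)) = len.
  rewrite (principal_trR stY stZ UU VV s01 YZ) /len; congr (Num.sqrt (a0 * _)).
  rewrite expr2 -mulmxE /real_diag mulmx_diag trRE; apply: eq_bigr => i _.
  by rewrite !mxE eqxx mulr1n scal_reM !scal_re_real !scal_im_real mulr0 subr0 expr2.
have [g hg] := horizontal_geodesic_exists stY hY.
split.
- by split=> //; exact: tangent_horizontal.
- by rewrite -etaE -(hg_1 hg); exact: is_Exp_St.
- by rewrite -mulmxA orbit_mxM//; apply: unitaryM; rewrite ctrK; exact: unitaryC.
- split.
  (* On a horizontal vector the term of the Stiefel metric with factor [a1 - a0] vanishes. *)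
  + rewrite tnorm_St//; last exact: tangent_horizontal.
    by rewrite st_metricE hY ctr0 mul0mx trR0 mulr0 addr0.
  + by rewrite -lenE; exact: principal_dist.
  + exact: (principal_log a1 ha0 stY stZ UU VV s01 YZ).
Qed.
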